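(* Let $u_0\in\mathcal{S}([0,\infty))$ and $g_0\in C^\infty([0,\infty))$, and let $u(x,t)$ be defined for $(x,t)\in Q=\{(x,t)\in\mathbb{R}^2:x>0,\ t>0\}$ by $$u(x,t)=\frac{1}{2\pi}\int_{-\infty}^{\infty}e^{i\lambda x-\lambda^2t}\,\hat u_0(\lambda)\,d\lambda-\frac{1}{2\pi}\int_{\Gamma}e^{i\lambda x-\lambda^2t}\,\hat u_0(-\lambda)\,d\lambda-\frac{i}{\pi}\int_{\Gamma}e^{i\lambda x-\lambda^2t}\,\lambda\,\tilde g_0(\lambda,t)\,d\lambda .$$ Then $u$ extends to a $C^\infty$ function on $\overline{Q}\setminus\{(0,0)\}$, i.e., for all integers $k,\ell\ge0$ the derivative $\frac{\partial^{k+\ell}u(x,t)}{\partial x^k\partial t^\ell}$, $(x,t)\in Q$, extends continuously to $\{(x,t)\in\mathbb{R}^2:x\ge0,\ t\ge0\}\setminus\{(0,0)\}$.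
   Context: Function spaces: a $C^\infty$ function $f:(0,\infty)\to\mathbb{C}$ belongs to $C^\infty([0,\infty))$ if $\lim_{x\to0^+}\frac{d^Nf(x)}{dx^N}$ exists for every integer $N\ge0$ (equivalently, $f$ extends to a $C^\infty$ function on $\mathbb{R}$); values of $f$ and its derivatives at $0$ denote these limits. $f\in\mathcal{S}([0,\infty))$ means $f\in C^\infty([0,\infty))$ and $\sup_{x\ge0}\left|x^M\frac{d^Nf(x)}{dx^N}\right|<\infty$ for all integers $M,N\ge0$. Transforms: $\hat u_0(\lambda)=\int_0^\infty u_0(x)e^{-i\lambda x}\,dx$ for $\lambda\in\mathbb{C}$ with $\operatorname{Im}\lambda\le0$; $\tilde g_0(\lambda,t)=\int_0^te^{\lambda^2\tau}g_0(\tau)\,d\tau$ for $\lambda\in\mathbb{C}$. Contour: $\Gamma=\{\lambda\in\mathbb{C}:\operatorname{Im}\lambda\ge0,\ \operatorname{Re}(\lambda^2)=0\}$ is the positively oriented boundary of $\Omega^-=\{\lambda\in\mathbb{C}:\operatorname{Im}\lambda\ge0,\ \operatorname{Re}(\lambda^2)\le0\}$, i.e. it comes in from infinity along the ray $\arg\lambda=3\pi/4$ to $0$ and then goes out to infinity along the ray $\arg\lambda=\pi/4$. *)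

(* Defs.v *)
From Stdlib Require Import Reals.
From Coquelicot Require Import Coquelicot.

Open Scope C_scope.

(** [F] is the tower of derivatives of [f] on (0,oo): [F N] agrees there with
    the [N]-th derivative of [f].  In addition [F N 0] is the limit of that
    derivative at 0+, so such an [F] exists exactly when [f] is smooth on
    (0,oo) and all these limits exist.  The values [f x], [x <= 0], are
    irrelevant. *)
Definition derivatives_half_line (f : R -> C) (F : nat -> R -> C) : Prop :=
  (forall x : R, (0 < x)%R -> F 0%nat x = f x) /\
  (forall (N : nat) (x : R), (0 < x)%R ->
     is_derive (K := R_AbsRing) (V := C_R_NormedModule) (F N) x (F (S N) x)) /\
  (forall N : nat, filterlim (F N) (at_right 0) (locally (F N 0%R))).

Definition smooth_half_line (f : R -> C) : Prop :=
  exists F : nat -> R -> C, derivatives_half_line f F.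

Definition schwartz_half_line (f : R -> C) : Prop :=
  exists F : nat -> R -> C,
    derivatives_half_line f F /\
    forall M N : nat, exists B : R, forall x : R, (0 <= x)%R ->
      (Cmod (RtoC (x ^ M) * F N x) <= B)%R.

Definition Cexp (z : C) : C :=
  ((exp (Re z) * cos (Im z))%R, (exp (Re z) * sin (Im z))%R).

(** All integrals are (improper) Riemann integrals of complex-valued functions
    of a real variable. *)
Definition CInt (f : R -> C) (a b : R) : C :=
  RInt (V := C_R_CompleteNormedModule) f a b.

Definition CInt_half_line (f : R -> C) : C :=
  RInt_gen (V := C_R_CompleteNormedModule) f
    (at_point 0%R) (Rbar_locally p_infty).

Definition CInt_line (f : R -> C) : C :=
  RInt_gen (V := C_R_CompleteNormedModule) f
    (Rbar_locally m_infty) (Rbar_locally p_infty).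

(** Integral along the ray [arg lambda = theta], from 0 out to infinity. *)
Definition CInt_ray (theta : R) (f : C -> C) : C :=
  CInt_half_line
    (fun r : R => f (RtoC r * Cexp (Ci * RtoC theta)) * Cexp (Ci * RtoC theta)).

(** [Gamma] comes in from infinity along [arg lambda = 3 PI / 4], hence the
    minus sign, and goes out to infinity along [arg lambda = PI / 4]. *)
Definition CInt_Gamma (f : C -> C) : C :=
  CInt_ray (PI / 4) f - CInt_ray (3 * PI / 4) f.

(** Only meaningful for [Im lambda <= 0]. *)
Definition u0_hat (u0 : R -> C) (lambda : C) : C :=
  CInt_half_line (fun x : R => u0 x * Cexp (- (Ci * lambda * RtoC x))).

Definition g0_tilde (g0 : R -> C) (lambda : C) (t : R) : C :=
  CInt (fun tau : R => Cexp (lambda * lambda * RtoC tau) * g0 tau) 0 t.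

Definition heat_exp (x t : R) (lambda : C) : C :=
  Cexp (Ci * lambda * RtoC x - lambda * lambda * RtoC t).

Definition fokas_formula (u0 g0 : R -> C) (x t : R) : C :=
  / RtoC (2 * PI) *
    CInt_line (fun l : R => heat_exp x t (RtoC l) * u0_hat u0 (RtoC l))
  - / RtoC (2 * PI) *
    CInt_Gamma (fun l : C => heat_exp x t l * u0_hat u0 (- l))
  - Ci / RtoC PI *
    CInt_Gamma (fun l : C => heat_exp x t l * l * g0_tilde g0 l t).

Definition punctured_quadrant (p : R * R) : Prop :=
  (0 <= fst p)%R /\ (0 <= snd p)%R /\ p <> (0%R, 0%R).

(** [U k l] is, on the open quadrant, the partial derivative of [u] of order
    [k] in [x] and [l] in [t] (taken in any order), and on
    [punctured_quadrant] its continuous extension. *)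
Definition smooth_extension_punctured_quadrant (u : R -> R -> C) : Prop :=
  exists U : nat -> nat -> R * R -> C,
    (forall x t : R, (0 < x)%R -> (0 < t)%R -> U 0%nat 0%nat (x, t) = u x t) /\
    (forall (k l : nat) (x t : R), (0 < x)%R -> (0 < t)%R ->
       is_derive (K := R_AbsRing) (V := C_R_NormedModule)
         (fun y : R => U k l (y, t)) x (U (S k) l (x, t)) /\
       is_derive (K := R_AbsRing) (V := C_R_NormedModule)
         (fun s : R => U k l (x, s)) t (U k (S l) (x, t))) /\
    (forall k l : nat, continuous_on punctured_quadrant (U k l)).

(* Main.v *)
(** Put [lambda = i kappa r] on each ray of integration ([kappa = i, -i] for the two halves of the
    real line, [kappa = exp (-i pi/4), exp (i pi/4)] for the two rays of Gamma).  Each of the three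
    terms extends separately, so no cancellation between them is needed.  The transform of [u0] along a
    ray is a symbol of order -1 in [r], and derivatives in [x] and [t] of the first two terms only
    multiply the symbol by powers of [r].  A ray integral of a symbol converges absolutely on one part
    of the boundary; on the other part, integration by parts in [r] trades factors [x] and [t] against
    the order of the symbol until it is at most -2.  In the third term, integration by parts in time
    turns a factor [lambda^2] into a time derivative of [g0], plus a ray integral of a symbol, plus
    [g0 t] times an integral of [exp (i lambda x) lambda^n], which cancels between the rays of Gamma;
    this reduces all derivatives to amplitudes of low degree, which are handled directly. *)

Require Import Defs.
From Stdlib Require Import Reals Arith Lra Lia Psatz FunctionalExtensionality ClassicalEpsilon.
From Coquelicot Require Import Coquelicot.
Open Scope C_scope.

(** The two sources of decay belong to different edges: along the rays of Gamma it is
    [exp (i lambda x)] with x > 0, along the real line [exp (- lambda^2 t)] with t > 0, and nothing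
    decays at the corner. So each ray integral is easy next to one edge only, and two local
    extensions are glued along the open quadrant. On a slanted ray the edge x = 0 is reached by
    dividing by t. The order is lowered by the factor 1 / (1 + kappa r) and not by 1 / r, which
    would be singular at the vertex of the ray. On the real line the edge t = 0 is reached by
    dividing by x. This creates a factor t r, one order worse in r, but a factor t is worth two
    orders there, so every step still gains. In the third term, the integral of
    [exp (i lambda x) lambda^n] along one ray has size x^(-n-1) and is multiplied by g0 t. A single
    ray therefore does not extend to x = 0; only the difference over Gamma does. Reducing degrees by
    two ends at 0 and 1. Degree 1 cannot be lowered to -1, again because of the vertex, and 1 / (1 +
    kappa r) is used a second time. *)

(** * Limits in C by means of the modulus *)

Definition cder (f : R -> C) (x : R) (l : C) : Prop :=
  is_derive (K := R_AbsRing) (V := C_R_NormedModule) f x l.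

Lemma C_eq (a b : C) : Re a = Re b -> Im a = Im b -> a = b.
Proof. destruct a, b; cbn; congruence. Qed.

Lemma Cmod_le_Re_Im (z : C) : (Cmod z <= Rabs (Re z) + Rabs (Im z))%R.
Proof.
  replace z with (RtoC (Re z) + Ci * RtoC (Im z)) at 1.
  - eapply Rle_trans; [apply Cmod_triangle|].
    rewrite Cmod_mult, Cmod_Ci, !Cmod_R; lra.
  - destruct z; apply C_eq; unfold Re, Im; cbn; ring.
Qed.

Lemma Re_le_Cmod (z : C) : (Rabs (Re z) <= Cmod z)%R.
Proof. apply re_le_Cmod. Qed.

Lemma Im_le_Cmod (z : C) : (Rabs (Im z) <= Cmod z)%R.
Proof. eapply Rle_trans; [apply Rmax_r|apply Rmax_Cmod]. Qed.

Lemma filterlim_C {T : Type} (F : (T -> Prop) -> Prop) {FF : Filter F}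
  (f : T -> C) (l : C) :
  filterlim f F (locally l) <->
  forall eps : R, (0 < eps)%R -> F (fun x => (Cmod (f x - l) < eps)%R).
Proof.
  split.
  - intros H eps He.
    (* A product ball of C lies in a modulus ball whose radius is larger by the factor
       [sqrt 2 < 2]. *)
    assert (He2 : (0 < eps / 2)%R) by lra.
    apply (filterlim_locally (U := C_UniformSpace)) with (eps := mkposreal _ He2) in H.
    revert H; apply filter_imp; intros x H.
    apply C_NormedModule_mixin_compat2 in H; cbn in H.
    assert (sqrt 2 < 2)%R.
    { rewrite <- (sqrt_Rsqr 2) at 2 by lra. apply sqrt_lt_1; unfold Rsqr; lra. }
    eapply Rlt_le_trans; [exact H|nra].
  - intros H; apply (filterlim_locally (U := C_UniformSpace)); intros eps.
    generalize (H eps (cond_pos eps)); apply filter_imp; intros x Hx.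
    apply C_NormedModule_mixin_compat1; exact Hx.
Qed.

Lemma filterlim_Cplus {T : Type} (F : (T -> Prop) -> Prop) {FF : Filter F}
  (f g : T -> C) (a b : C) :
  filterlim f F (locally a) -> filterlim g F (locally b) ->
  filterlim (fun x => f x + g x) F (locally (a + b)).
Proof.
  intros Hf Hg.
  exact (filterlim_comp_2 f g _ Hf Hg (filterlim_plus (V := C_R_NormedModule) a b)).
Qed.

Lemma filterlim_Cmult {T : Type} (F : (T -> Prop) -> Prop) {FF : Filter F}
  (f g : T -> C) (a b : C) :
  filterlim f F (locally a) -> filterlim g F (locally b) ->
  filterlim (fun x => f x * g x) F (locally (a * b)).
Proof.
  rewrite !filterlim_C by assumption.
  intros Hf Hg eps He.
  pose proof (Cmod_ge_0 a) as Ha; pose proof (Cmod_ge_0 b) as Hb.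
  set (d := Rmin 1 (eps / (1 + Cmod a + Cmod b))).
  assert (Hq : (0 < eps / (1 + Cmod a + Cmod b))%R) by (apply Rdiv_lt_0_compat; lra).
  assert (Hd : (0 < d)%R) by (apply Rmin_pos; lra).
  assert (Hd1 : (d <= 1)%R) by apply Rmin_l.
  assert (Hd2 : (d * (1 + Cmod a + Cmod b) <= eps)%R).
  { replace eps with (eps / (1 + Cmod a + Cmod b) * (1 + Cmod a + Cmod b))%R at 1
      by (field; lra).
    apply Rmult_le_compat_r; [lra|apply Rmin_r]. }
  generalize (filter_and _ _ (Hf d Hd) (Hg d Hd)); apply filter_imp; intros x [H1 H2].
  replace (f x * g x - a * b)
    with ((f x - a) * (g x - b) + a * (g x - b) + b * (f x - a)) by ring.
  eapply Rle_lt_trans; [apply Cmod_triangle|].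
  eapply Rle_lt_trans; [apply Rplus_le_compat_r, Cmod_triangle|].
  rewrite !Cmod_mult.
  pose proof (Cmod_ge_0 (f x - a)); pose proof (Cmod_ge_0 (g x - b)).
  nra.
Qed.

Lemma filterlim_Cinv {T : Type} (F : (T -> Prop) -> Prop) {FF : Filter F}
  (f : T -> C) (a : C) :
  a <> 0 -> filterlim f F (locally a) -> filterlim (fun x => / f x) F (locally (/ a)).
Proof.
  rewrite !filterlim_C by assumption.
  intros Ha Hf eps He.
  assert (Ha' : (0 < Cmod a)%R) by now apply Cmod_gt_0.
  set (d := Rmin (Cmod a / 2) (eps * (Cmod a * Cmod a) / 2)).
  assert (Hp : (0 < eps * (Cmod a * Cmod a) / 2)%R).
  { apply Rdiv_lt_0_compat; [|lra]. repeat apply Rmult_lt_0_compat; lra. }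
  assert (Hd : (0 < d)%R) by (apply Rmin_pos; lra).
  assert (Hd1 : (d <= Cmod a / 2)%R) by apply Rmin_l.
  assert (Hd2 : (d <= eps * (Cmod a * Cmod a) / 2)%R) by apply Rmin_r.
  generalize (Hf d Hd); apply filter_imp; intros x H.
  assert (Hfx : (Cmod a / 2 < Cmod (f x))%R).
  { pose proof (Cmod_triangle (f x) (a - f x)) as Ht.
    replace (f x + (a - f x)) with a in Ht by ring.
    rewrite <- (Cmod_opp (a - f x)) in Ht.
    replace (- (a - f x)) with (f x - a) in Ht by ring. lra. }
  assert (Hnz : f x <> 0).
  { intro E; rewrite E, Cmod_0 in Hfx; lra. }
  replace (/ f x - / a) with (- ((f x - a) / (f x * a))) by (field; auto).
  rewrite Cmod_opp, Cmod_div, Cmod_mult by (apply Cmult_neq_0; auto).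
  apply Rmult_lt_reg_r with (Cmod (f x) * Cmod a)%R; [nra|].
  unfold Rdiv; rewrite Rmult_assoc, Rinv_l, Rmult_1_r by nra.
  eapply Rlt_le_trans; [exact H|].
  eapply Rle_trans; [exact Hd2|].
  assert (0 < eps * Cmod a)%R by nra. nra.
Qed.

(** ** Complex-valued functions of a real variable *)

Lemma cder_iff (f : R -> C) (x : R) (l : C) :
  cder f x l <->
  is_derive (fun s => Re (f s)) x (Re l) /\ is_derive (fun s => Im (f s)) x (Im l).
Proof.
  split.
  - intros H; split.
    + exact (filterdiff_comp' f fst x _ _ H
               (filterdiff_linear _ (is_linear_fst (U := R_NormedModule) (V := R_NormedModule)))).
    + exact (filterdiff_comp' f snd x _ _ H
               (filterdiff_linear _ (is_linear_snd (U := R_NormedModule) (V := R_NormedModule)))).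
  - intros [H1 H2].
    apply (is_derive_scal_l (V := C_R_NormedModule)) with (k := RtoC 1) in H1.
    apply (is_derive_scal_l (V := C_R_NormedModule)) with (k := Ci) in H2.
    pose proof (is_derive_plus _ _ _ _ _ H1 H2) as H.
    replace l with (plus (scal (Re l) (RtoC 1 : C_R_NormedModule)) (scal (Im l) (Ci : C_R_NormedModule))).
    + eapply is_derive_ext; [|exact H].
      intros t; apply C_eq; unfold Re, Im; cbn; ring.
    + apply C_eq; unfold Re, Im; cbn; ring.
Qed.

Lemma cder_const (c : C) (x : R) : cder (fun _ => c) x 0.
Proof. apply (is_derive_const (V := C_R_NormedModule)). Qed.

Lemma cder_id (x : R) : cder (fun s => RtoC s) x 1.
Proof.
  apply cder_iff; cbn; split; [apply (is_derive_id (K:=R_AbsRing))|apply (is_derive_const (V:=R_NormedModule))].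
Qed.

Lemma cder_plus (f g : R -> C) (x : R) (a b : C) :
  cder f x a -> cder g x b -> cder (fun s => f s + g s) x (a + b).
Proof. apply (is_derive_plus (V := C_R_NormedModule)). Qed.

Lemma cder_mult (f g : R -> C) (x : R) (a b : C) :
  cder f x a -> cder g x b -> cder (fun s => f s * g s) x (a * g x + f x * b).
Proof.
  rewrite !cder_iff; intros [F1 F2] [G1 G2]; split.
  - eapply is_derive_ext with
      (f := fun s => (Re (f s) * Re (g s) - Im (f s) * Im (g s))%R); [intros; now cbn|].
    replace (Re (a * g x + f x * b))
      with ((Re a * Re (g x) + Re (f x) * Re b) - (Im a * Im (g x) + Im (f x) * Im b))%R
      by (unfold Re, Im; cbn; ring).
    apply (is_derive_minus (V := R_NormedModule)); apply (is_derive_mult (K := R_AbsRing));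
      auto; exact Rmult_comm.
  - eapply is_derive_ext with
      (f := fun s => (Re (f s) * Im (g s) + Im (f s) * Re (g s))%R); [intros; now cbn|].
    replace (Im (a * g x + f x * b))
      with ((Re a * Im (g x) + Re (f x) * Im b) + (Im a * Re (g x) + Im (f x) * Re b))%R
      by (unfold Re, Im; cbn; ring).
    apply (is_derive_plus (V := R_NormedModule)); apply (is_derive_mult (K := R_AbsRing));
      auto; exact Rmult_comm.
Qed.

Lemma cder_Cexp (f : R -> C) (x : R) (a : C) :
  cder f x a -> cder (fun s => Cexp (f s)) x (a * Cexp (f x)).
Proof.
  rewrite !cder_iff; intros [F1 F2].
  assert (E1 := is_derive_comp exp (fun s => Re (f s)) x _ _ (is_derive_exp _) F1).
  assert (E2 := is_derive_comp cos (fun s => Im (f s)) x _ _ (is_derive_cos _) F2).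
  assert (E3 := is_derive_comp sin (fun s => Im (f s)) x _ _ (is_derive_sin _) F2).
  split.
  - pose proof (is_derive_mult (K := R_AbsRing) _ _ _ _ _ E1 E2 Rmult_comm) as E.
    eapply is_derive_ext; [|replace (Re (a * Cexp (f x))) with
      (plus (mult (scal (Re a) (exp (Re (f x)))) (cos (Im (f x))))
            (mult (exp (Re (f x))) (scal (Im a) (- sin (Im (f x))))))%R; [exact E|]].
    + intros; reflexivity.
    + cbn; unfold plus, mult, scal; cbn; unfold mult; unfold Re, Im; cbn; ring.
  - pose proof (is_derive_mult (K := R_AbsRing) _ _ _ _ _ E1 E3 Rmult_comm) as E.
    eapply is_derive_ext; [|replace (Im (a * Cexp (f x))) with
      (plus (mult (scal (Re a) (exp (Re (f x)))) (sin (Im (f x))))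
            (mult (exp (Re (f x))) (scal (Im a) (cos (Im (f x))))))%R; [exact E|]].
    + intros; reflexivity.
    + cbn; unfold plus, mult, scal; cbn; unfold mult; unfold Re, Im; cbn; ring.
Qed.

Lemma cder_inv (f : R -> C) (x : R) (a : C) :
  f x <> 0 -> cder f x a -> cder (fun s => / f s) x (- (a * / f x * / f x)).
Proof.
  intros Hnz; rewrite !cder_iff; intros [F1 F2].
  assert (Hq : ((Re (f x) ^ 2 + Im (f x) ^ 2) <> 0)%R).
  { intro E. apply Hnz. apply C_eq; cbn; nra. }
  assert (G : forall (p q : R -> R) (p' q' : R), is_derive p x p' -> is_derive q x q' ->
    (p x ^ 2 + q x ^ 2 <> 0)%R ->
    is_derive (fun s => p s / (p s ^ 2 + q s ^ 2))%R x
      ((p' * (q x ^ 2 - p x ^ 2) - 2 * p x * q x * q') / (p x ^ 2 + q x ^ 2) ^ 2)%R /\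
    is_derive (fun s => - q s / (p s ^ 2 + q s ^ 2))%R x
      ((q' * (q x ^ 2 - p x ^ 2) + 2 * p x * q x * p') / (p x ^ 2 + q x ^ 2) ^ 2)%R).
  { intros p q p' q' Hp Hq' Hne.
    assert (Ep : Derive (fun s : R => p s) x = p') by (apply is_derive_unique; exact Hp).
    assert (Eq : Derive (fun s : R => q s) x = q') by (apply is_derive_unique; exact Hq').
    split; auto_derive;
      try (repeat split; try (eexists; eassumption); assumption);
      rewrite Ep, Eq;
      field; intro E; apply Hne; rewrite <- E; ring. }
  destruct (G _ _ _ _ F1 F2 Hq) as [G1 G2].
  split.
  - replace (Re _) with ((Re a * (Im (f x) ^ 2 - Re (f x) ^ 2)
      - 2 * Re (f x) * Im (f x) * Im a) / (Re (f x) ^ 2 + Im (f x) ^ 2) ^ 2)%R; [exact G1|].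
    unfold Re, Im in *; cbn in *; field; intro E; apply Hq; rewrite <- E; ring.
  - replace (Im _) with ((Im a * (Im (f x) ^ 2 - Re (f x) ^ 2)
      + 2 * Re (f x) * Im (f x) * Re a) / (Re (f x) ^ 2 + Im (f x) ^ 2) ^ 2)%R; [exact G2|].
    unfold Re, Im in *; cbn in *; field; intro E; apply Hq; rewrite <- E; ring.
Qed.

Lemma cder_eq (f : R -> C) (x : R) (a b : C) : cder f x a -> a = b -> cder f x b.
Proof. intros; subst; assumption. Qed.

Lemma cder_ext_near (f g : R -> C) (x d : R) (l : C) :
  (0 < d)%R -> (forall s, (Rabs (s - x) < d)%R -> f s = g s) -> cder f x l -> cder g x l.
Proof.
  intros Hd H; apply is_derive_ext_loc.
  exists (mkposreal d Hd); intros y Hy; apply H, Hy.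
Qed.

Lemma cder_continuous (f : R -> C) (x : R) (l : C) :
  cder f x l -> continuous (U := C_UniformSpace) f x.
Proof.
  intros H; apply (ex_derive_continuous (V := C_R_NormedModule)); eexists; exact H.
Qed.

(** A quadratic remainder survives integration in a parameter, so this criterion, fed by Taylor's
    formula, later stands in for dominated convergence when differentiating under the integral
    sign. *)
Lemma cder_of_quadratic (f : R -> C) (x d M : R) (l : C) :
  (0 < d)%R ->
  (forall s, (Rabs (s - x) < d)%R ->
     (Cmod (f s - f x - RtoC (s - x) * l) <= M * (s - x) ^ 2)%R) ->
  cder f x l.
Proof.
  intros Hd H.
  assert (G : forall (p : C -> R), (forall z, (Rabs (p z) <= Cmod z)%R) ->
    (forall a b, p (a - b) = (p a - p b)%R) -> (forall r a, p (RtoC r * a) = (r * p a)%R) ->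
    is_derive (fun s => p (f s)) x (p l)).
  { intros p P1 P2 P3. apply is_derive_Reals; intros eps He.
    assert (He' : (0 < Rmin d (eps / (Rabs M + 1)))%R).
    { apply Rmin_pos; [assumption|]. apply Rdiv_lt_0_compat; [lra|].
      pose proof (Rabs_pos M); lra. }
    exists (mkposreal _ He'); cbn; intros h Hh Hhd.
    assert (H1 := Rlt_le_trans _ _ _ Hhd (Rmin_l _ _)).
    assert (H2 := Rlt_le_trans _ _ _ Hhd (Rmin_r _ _)).
    specialize (H (x + h)%R); replace (x + h - x)%R with h in H by ring.
    specialize (H H1).
    pose proof (P1 (f (x + h)%R - f x - RtoC h * l)) as HP.
    rewrite !P2, P3 in HP.
    replace ((p (f (x + h)%R) - p (f x)) / h - p l)%R
      with ((p (f (x + h)%R) - p (f x) - h * p l) / h)%R by (field; assumption).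
    unfold Rdiv; rewrite Rabs_mult, Rabs_inv.
    assert (Hp := Rabs_pos_lt h Hh).
    apply Rmult_lt_reg_r with (Rabs h); [assumption|].
    rewrite Rmult_assoc, Rinv_l, Rmult_1_r by lra.
    eapply Rle_lt_trans; [exact (Rle_trans _ _ _ HP H)|].
    rewrite <- (pow2_abs h).
    pose proof (Rabs_pos M); pose proof (Rle_abs M).
    apply Rle_lt_trans with (Rabs M * Rabs h * Rabs h)%R; [nra|].
    apply Rmult_lt_compat_r; [assumption|].
    assert (Rabs h * (Rabs M + 1) < eps)%R.
    { apply Rmult_lt_reg_r with (/ (Rabs M + 1))%R; [apply Rinv_0_lt_compat; lra|].
      rewrite Rmult_assoc, Rinv_r by lra. rewrite Rmult_1_r; exact H2. }
    nra. }
  apply cder_iff; split; apply G; intros.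
  - apply Re_le_Cmod.
  - reflexivity.
  - unfold Re, Im; cbn; ring.
  - apply Im_le_Cmod.
  - reflexivity.
  - unfold Re, Im; cbn; ring.
Qed.

(** The real mean value theorem is applied to the real and the imaginary part, each contributing
    [M]; this is the factor 2. Derivatives are asked for in the open interval only, since functions
    on the half-line need not be differentiable at 0. *)
Lemma mean_value_C_open (f f' : R -> C) (a b M : R) :
  (forall s, (Rmin a b < s < Rmax a b)%R -> cder f s (f' s)) ->
  (forall s, (Rmin a b <= s <= Rmax a b)%R -> continuous (U := C_UniformSpace) f s) ->
  (forall s, (Rmin a b <= s <= Rmax a b)%R -> (Cmod (f' s) <= M)%R) ->
  (Cmod (f b - f a) <= 2 * M * Rabs (b - a))%R.
Proof.
  intros Hd Hc HM.
  assert (G : forall (p : C -> R), (forall z, (Rabs (p z) <= Cmod z)%R) ->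
     (forall z, continuous (T := C_UniformSpace) (U := R_UniformSpace) p z) ->
     (forall s, (Rmin a b < s < Rmax a b)%R -> is_derive (fun s => p (f s)) s (p (f' s))) ->
     (Rabs (p (f b) - p (f a)) <= M * Rabs (b - a))%R).
  { intros p P1 Pc P2.
    destruct (MVT_gen (fun s => p (f s)) a b (fun s => p (f' s))) as (c & Hcc & E).
    - intros s Hs; apply P2; lra.
    - intros s Hs; apply continuity_pt_filterlim.
      apply (continuous_comp (V := C_UniformSpace) f p); [apply Hc, Hs|apply Pc].
    - rewrite E, Rabs_mult; apply Rmult_le_compat_r; [apply Rabs_pos|].
      eapply Rle_trans; [apply P1|apply HM, Hcc]. }
  eapply Rle_trans; [apply Cmod_le_Re_Im|].
  change (Re (f b - f a)) with (Re (f b) - Re (f a))%R.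
  change (Im (f b - f a)) with (Im (f b) - Im (f a))%R.
  pose proof (G Re Re_le_Cmod (fun z => continuous_fst (U := R_UniformSpace) (V := R_UniformSpace) _ _)
    (fun s H => proj1 (proj1 (cder_iff _ _ _) (Hd s H)))).
  pose proof (G Im Im_le_Cmod (fun z => continuous_snd (U := R_UniformSpace) (V := R_UniformSpace) _ _)
    (fun s H => proj2 (proj1 (cder_iff _ _ _) (Hd s H)))).
  lra.
Qed.

Lemma mean_value_C (f f' : R -> C) (a b M : R) :
  (forall s, (Rmin a b <= s <= Rmax a b)%R -> cder f s (f' s)) ->
  (forall s, (Rmin a b <= s <= Rmax a b)%R -> (Cmod (f' s) <= M)%R) ->
  (Cmod (f b - f a) <= 2 * M * Rabs (b - a))%R.
Proof.
  intros Hd HM; apply mean_value_C_open with (f' := f'); auto.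
  - intros s Hs; apply Hd; lra.
  - intros s Hs; eapply cder_continuous, Hd, Hs.
Qed.

(** The mean value inequality for [f s - (s - a) f1 a], whose derivative [f1 s - f1 a] is bounded by
    the same inequality: two factors 2 make the 4. *)
Lemma taylor_C (f f1 f2 : R -> C) (a b M : R) :
  (forall s, (Rmin a b <= s <= Rmax a b)%R -> cder f s (f1 s)) ->
  (forall s, (Rmin a b <= s <= Rmax a b)%R -> cder f1 s (f2 s)) ->
  (forall s, (Rmin a b <= s <= Rmax a b)%R -> (Cmod (f2 s) <= M)%R) ->
  (Cmod (f b - f a - RtoC (b - a) * f1 a) <= 4 * M * (b - a) ^ 2)%R.
Proof.
  intros H1 H2 HM.
  assert (Hs : forall s, (Rmin a b <= s <= Rmax a b)%R ->
    (Rmin a s >= Rmin a b /\ Rmax a s <= Rmax a b /\ Rabs (s - a) <= Rabs (b - a))%R).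
  { intros s; unfold Rmin, Rmax, Rabs; repeat destruct Rle_dec; repeat destruct Rcase_abs; lra. }
  assert (HM0 : (0 <= M)%R).
  { eapply Rle_trans; [apply Cmod_ge_0|apply (HM a)].
    split; [apply Rmin_l|apply Rmax_l]. }
  replace (f b - f a - RtoC (b - a) * f1 a)
    with ((f b - RtoC (b - a) * f1 a) - (f a - RtoC (a - a) * f1 a))
    by (rewrite Rminus_diag; ring).
  eapply Rle_trans.
  - apply mean_value_C with (f := fun s => f s - RtoC (s - a) * f1 a)
      (f' := fun s => f1 s - f1 a) (M := (2 * M * Rabs (b - a))%R).
    + intros s Hsab.
      apply cder_ext_near with (f := fun s => f s + ((RtoC s + - RtoC a) * - f1 a)) (d := 1%R);
        [lra| |].
      { intros; rewrite RtoC_minus; ring. }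
      eapply cder_eq.
      * apply cder_plus; [apply H1, Hsab|].
        apply cder_mult; [|apply cder_const].
        apply cder_plus; [apply cder_id|apply cder_const].
      * cbv beta; ring.
    + intros s Hsab; destruct (Hs s Hsab) as (S1 & S2 & S3).
      eapply Rle_trans.
      * apply mean_value_C with (f' := f2) (M := M); intros; [apply H2|apply HM]; lra.
      * apply Rmult_le_compat_l; lra.
  - rewrite <- (pow2_abs (b - a)). right; ring.
Qed.

(** ** The exponential *)

Lemma Cexp_0 : Cexp 0 = 1.
Proof. unfold Cexp; cbn; rewrite exp_0, cos_0, sin_0; apply C_eq; cbn; ring. Qed.

Lemma Cexp_plus (z w : C) : Cexp (z + w) = Cexp z * Cexp w.
Proof.
  unfold Cexp; apply C_eq; unfold Re, Im; cbn; rewrite exp_plus;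
    [rewrite cos_plus|rewrite sin_plus]; ring.
Qed.

Lemma Cmod_Cexp (z : C) : Cmod (Cexp z) = exp (Re z).
Proof.
  unfold Cmod, Cexp; cbn [fst snd].
  replace ((exp (Re z) * cos (Im z)) ^ 2 + (exp (Re z) * sin (Im z)) ^ 2)%R
    with ((exp (Re z)) ^ 2 * (Rsqr (sin (Im z)) + Rsqr (cos (Im z))))%R
    by (unfold Rsqr; ring).
  rewrite sin2_cos2, Rmult_1_r.
  apply sqrt_pow2; left; apply exp_pos.
Qed.

Lemma exp_le_1 (x : R) : (x <= 0)%R -> (exp x <= 1)%R.
Proof.
  intros [H|H]; [rewrite <- exp_0; left; now apply exp_increasing|subst; rewrite exp_0; lra].
Qed.

Lemma exp_le (x y : R) : (x <= y)%R -> (exp x <= exp y)%R.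
Proof. intros [H|H]; [left; now apply exp_increasing|subst; lra]. Qed.

Lemma Cexp_minus_1 (z : C) : (Re z <= 0)%R -> (Cmod (Cexp z - 1) <= 2 * Cmod z)%R.
Proof.
  intros Hz.
  replace (Cexp z - 1) with (Cexp (RtoC 1 * z) - Cexp (RtoC 0 * z))
    by (rewrite Cmult_0_l, Cmult_1_l, Cexp_0; reflexivity).
  replace (2 * Cmod z)%R with (2 * Cmod z * Rabs (1 - 0))%R
    by (rewrite Rminus_0_r, Rabs_R1; ring).
  apply (mean_value_C (fun s : R => Cexp (RtoC s * z)) (fun s : R => z * Cexp (RtoC s * z))).
  - intros s _; eapply cder_eq.
    + apply cder_Cexp, cder_mult; [apply cder_id|apply cder_const].
    + cbv beta; ring.
  - intros s Hs; rewrite Rmin_left, Rmax_right in Hs by lra.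
    rewrite Cmod_mult, Cmod_Cexp.
    pose proof (Cmod_ge_0 z).
    assert (exp (Re (RtoC s * z)) <= 1)%R by (apply exp_le_1; cbn; unfold Re in Hz; nra).
    nra.
Qed.

Lemma Cexp_lipschitz (z w : C) :
  (Re z <= 0)%R -> (Re w <= 0)%R -> (Cmod (Cexp z - Cexp w) <= 2 * Cmod (z - w))%R.
Proof.
  (* The exponential with the larger real part is factored out, so that the remaining exponent
     [z - w] has nonpositive real part and [Cexp_minus_1] applies. *)
  assert (G : forall z w : C, (Re z <= Re w)%R -> (Re w <= 0)%R ->
    (Cmod (Cexp z - Cexp w) <= 2 * Cmod (z - w))%R).
  { intros a b Hab Hb.
    replace (Cexp a - Cexp b) with (Cexp b * (Cexp (a - b) - 1)).
    - rewrite Cmod_mult, Cmod_Cexp.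
      assert (H1 : (Cmod (Cexp (a - b) - 1) <= 2 * Cmod (a - b))%R)
        by (apply Cexp_minus_1; cbn; unfold Re in *; lra).
      pose proof (exp_le_1 _ Hb); pose proof (exp_pos (Re b)).
      pose proof (Cmod_ge_0 (Cexp (a - b) - 1)); nra.
    - replace (Cexp a) with (Cexp (b + (a - b))) by (f_equal; ring).
      rewrite Cexp_plus; ring. }
  intros Hz Hw; destruct (Rle_dec (Re z) (Re w)) as [H|H]; [now apply G|].
  replace (Cexp z - Cexp w) with (- (Cexp w - Cexp z)) by ring.
  replace (z - w) with (- (w - z)) by ring.
  rewrite !Cmod_opp; apply G; lra.
Qed.

Lemma pow_le_fact_exp (k : nat) (y : R) : (0 <= y)%R -> (y ^ k <= INR (fact k) * exp y)%R.
Proof.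
  revert y; induction k as [|k IH]; intros y Hy.
  - cbn; rewrite Rmult_1_l. pose proof (exp_ineq1_le y); lra.
  - (* [y^(k+1) - (k+1)! e^y] is nonpositive at 0 and nonincreasing *)
    destruct (MVT_gen (fun s => INR (fact (S k)) * exp s - s ^ S k)%R 0 y
      (fun s => INR (fact (S k)) * exp s - INR (S k) * s ^ k)%R) as (c & Hc & E).
    + intros s _; auto_derive; [trivial|]. change (match k with 0%nat => 1 | S _ => INR k + 1 end)%R with (INR (S k)).
      change (fact k + k * fact k)%nat with (fact (S k)); ring.
    + intros s _; apply continuity_pt_filterlim.
      refine (ex_derive_continuous (V := R_NormedModule)
        (fun s => INR (fact (S k)) * exp s - s ^ S k)%R s _); auto_derive; trivial.
    + rewrite Rmin_left, Rmax_right in Hc by lra.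
      specialize (IH c (proj1 Hc)).
      rewrite exp_0, pow_i in E by lia.
      assert (Hf : (0 <= INR (fact (S k)))%R) by apply pos_INR.
      assert (Hp : (0 <= INR (fact (S k)) * exp c - INR (S k) * c ^ k)%R).
      { change (fact (S k)) with (S k * fact k)%nat; rewrite mult_INR.
        pose proof (pos_INR (S k)); nra. }
      assert (0 <= (INR (fact (S k)) * exp c - INR (S k) * c ^ k) * (y - 0))%R by nra.
      nra.
Qed.

Lemma pow_exp_bound (K : nat) (d : R) :
  (0 < d)%R -> exists B : R, (0 <= B)%R /\
  forall r, (0 <= r)%R -> ((1 + r) ^ K * exp (- (d * r)) <= B)%R.
Proof.
  intros Hd.
  (* The witness is what [pow_le_fact_exp] gives at [d * (1 + r)] after dividing by
     [d ^ K * exp (d * r)]. *)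
  exists (INR (fact K) * (/ d) ^ K * exp d)%R; split.
  - pose proof (pos_INR (fact K)); pose proof (exp_pos d).
    assert (0 < (/ d) ^ K)%R by now apply pow_lt, Rinv_0_lt_compat.
    apply Rmult_le_pos; nra.
  - intros r Hr.
    assert (Hy : (0 <= d * (1 + r))%R) by nra.
    pose proof (pow_le_fact_exp K _ Hy) as HP.
    rewrite Rpow_mult_distr in HP.
    assert (Hdk : (0 < d ^ K)%R) by now apply pow_lt.
    assert (Hdk' : (0 < (/ d) ^ K)%R) by now apply pow_lt, Rinv_0_lt_compat.
    assert (E1 : ((/ d) ^ K * d ^ K = 1)%R).
    { rewrite <- Rpow_mult_distr, Rinv_l, pow1; lra. }
    replace (exp (d * (1 + r))) with (exp d * exp (d * r))%R in HP
      by (rewrite <- exp_plus; f_equal; ring).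
    apply Rmult_le_reg_r with (exp (d * r)); [apply exp_pos|].
    rewrite Rmult_assoc, <- exp_plus, Rplus_opp_l, exp_0, Rmult_1_r.
    apply Rmult_le_reg_l with (d ^ K)%R; [assumption|].
    eapply Rle_trans; [exact HP|].
    right.
    transitivity (((/ d) ^ K * d ^ K) * (INR (fact K) * (exp d * exp (d * r))))%R;
      [rewrite E1; ring|ring].
Qed.

(** ** Continuity and integrals on the half-line *)

(** Continuity relative to the closed half-line, hence one-sided at 0: the data are controlled for
    positive arguments and through their right limit at 0, and values at negative arguments are
    arbitrary. *)
Definition hcont (f : R -> C) : Prop :=
  continuous_on (T := R_UniformSpace) (U := C_UniformSpace) (fun r => (0 <= r)%R) f.

Lemma continuous_on_C {T : UniformSpace} (D : T -> Prop) (f : T -> C) :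
  continuous_on (U := C_UniformSpace) D f <->
  forall x, D x -> forall eps : R, (0 < eps)%R ->
    within D (locally x) (fun y => (Cmod (f y - f x) < eps)%R).
Proof.
  split; intros H x Hx; specialize (H x Hx);
    apply (filterlim_C (within D (locally x)) f (f x)); exact H.
Qed.

Lemma continuous_within_C {T : UniformSpace} (D : T -> Prop) (f : T -> C) (x : T) :
  continuous (U := C_UniformSpace) f x ->
  filterlim f (within D (locally x)) (locally (f x)).
Proof.
  intros H P HP; specialize (H P HP); unfold filtermap, within in *.
  revert H; apply filter_imp; auto.
Qed.

Lemma continuous_on_Cplus {T : UniformSpace} (D : T -> Prop) (f g : T -> C) :
  continuous_on (U := C_UniformSpace) D f -> continuous_on (U := C_UniformSpace) D g ->
  continuous_on (U := C_UniformSpace) D (fun x => f x + g x).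
Proof.
  intros Hf Hg x Hx; apply filterlim_Cplus; [apply within_filter, locally_filter|apply Hf, Hx|apply Hg, Hx].
Qed.

Lemma continuous_on_Cmult {T : UniformSpace} (D : T -> Prop) (f g : T -> C) :
  continuous_on (U := C_UniformSpace) D f -> continuous_on (U := C_UniformSpace) D g ->
  continuous_on (U := C_UniformSpace) D (fun x => f x * g x).
Proof.
  intros Hf Hg x Hx; apply filterlim_Cmult; [apply within_filter, locally_filter|apply Hf, Hx|apply Hg, Hx].
Qed.

Lemma continuous_on_Cinv {T : UniformSpace} (D : T -> Prop) (f : T -> C) :
  (forall x, D x -> f x <> 0) ->
  continuous_on (U := C_UniformSpace) D f ->
  continuous_on (U := C_UniformSpace) D (fun x => / f x).
Proof.
  intros Hnz Hf x Hx; apply filterlim_Cinv;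
    [apply within_filter, locally_filter|apply Hnz, Hx|apply Hf, Hx].
Qed.

Lemma continuous_on_const_C {T : UniformSpace} (D : T -> Prop) (c : C) :
  continuous_on (T := T) (U := C_UniformSpace) D (fun _ => c).
Proof. intros x Hx; apply filterlim_const. Qed.

Lemma continuous_on_pow_C {T : UniformSpace} (D : T -> Prop) (f : T -> C) (n : nat) :
  continuous_on (U := C_UniformSpace) D f ->
  continuous_on (U := C_UniformSpace) D (fun x => f x ^ n).
Proof.
  intros Hf; induction n as [|n IH]; cbn.
  - apply continuous_on_const_C.
  - now apply continuous_on_Cmult.
Qed.

Lemma continuous_on_subset {T : UniformSpace} (D E : T -> Prop) (f : T -> C) :
  (forall x, E x -> D x) ->
  continuous_on (U := C_UniformSpace) D f -> continuous_on (U := C_UniformSpace) E f.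
Proof.
  rewrite !continuous_on_C; intros HED H x Hx eps He.
  generalize (H x (HED x Hx) eps He); unfold within; apply filter_imp; auto.
Qed.

Lemma hcont_const (c : C) : hcont (fun _ => c).
Proof. apply continuous_on_const_C. Qed.

Lemma hcont_plus (f g : R -> C) : hcont f -> hcont g -> hcont (fun r => f r + g r).
Proof. apply continuous_on_Cplus. Qed.

Lemma hcont_mult (f g : R -> C) : hcont f -> hcont g -> hcont (fun r => f r * g r).
Proof. apply continuous_on_Cmult. Qed.

Lemma hcont_iff (f : R -> C) :
  hcont f <-> forall r, (0 <= r)%R -> forall eps, (0 < eps)%R -> exists d, (0 < d)%R /\
    forall s, (0 <= s)%R -> (Rabs (s - r) < d)%R -> (Cmod (f s - f r) < eps)%R.
Proof.
  unfold hcont; rewrite continuous_on_C; split; intros H r Hr eps He.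
  - destruct (H r Hr eps He) as [d Hd]; exists d; split; [apply cond_pos|].
    intros s Hs Hsr; apply (Hd s Hsr Hs).
  - destruct (H r Hr eps He) as (d & Hd & HH); exists (mkposreal d Hd).
    intros s Hs Hs0; apply HH; assumption.
Qed.

Lemma hcont_lipschitz (f : R -> C) (L : R) :
  (forall r s, (0 <= r)%R -> (0 <= s)%R -> (Cmod (f s - f r) <= L * Rabs (s - r))%R) -> hcont f.
Proof.
  intros H; apply hcont_iff; intros r Hr eps He.
  exists (eps / (Rabs L + 1))%R.
  pose proof (Rabs_pos L); pose proof (Rle_abs L).
  assert (Hq : (0 < eps / (Rabs L + 1))%R) by (apply Rdiv_lt_0_compat; lra).
  split; [assumption|]; intros s Hs Hsr.
  eapply Rle_lt_trans; [apply H; assumption|].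
  assert (E : (eps / (Rabs L + 1) * (Rabs L + 1) = eps)%R) by (field; lra).
  pose proof (Rabs_pos (s - r)); nra.
Qed.

Lemma hcont_id : hcont (fun r => RtoC r).
Proof.
  apply hcont_lipschitz with 1%R; intros r s _ _.
  rewrite <- RtoC_minus, Cmod_R; lra.
Qed.

Lemma hcont_cder (f f' : R -> C) :
  (forall r, (0 <= r)%R -> cder f r (f' r)) -> hcont f.
Proof.
  intros H r Hr; apply continuous_within_C, (cder_continuous f r (f' r)), H, Hr.
Qed.

Lemma hcont_of_right_limit (f f' : R -> C) :
  (forall r, (0 < r)%R -> cder f r (f' r)) ->
  filterlim f (at_right 0) (locally (f 0%R)) -> hcont f.
Proof.
  intros H1 H2 r [Hr|<-].
  - apply continuous_within_C, (cder_continuous f r (f' r)), H1, Hr.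
  - apply filterlim_C; [apply within_filter, locally_filter|]; intros eps He.
    apply (filterlim_C (at_right 0)) with (eps := eps) in H2; [|assumption].
    revert H2; unfold at_right, within; apply filter_imp.
    intros x Hx [Hx0|<-]; [now apply Hx|].
    replace (f 0%R - f 0%R) with (RtoC 0) by ring; rewrite Cmod_0; assumption.
Qed.

(** Precomposing with [Rmax 0] yields a function continuous on all of R that agrees with [f] on the
    half-line, to which two-sided theorems on integrals and derivatives apply. *)
Lemma hcont_clamp (f : R -> C) (r : R) :
  hcont f -> continuous (U := C_UniformSpace) (fun s => f (Rmax 0 s)) r.
Proof.
  intros H; apply filterlim_C; [apply locally_filter|]; intros eps He.
  destruct (proj1 (hcont_iff f) H (Rmax 0 r) (Rmax_l _ _) eps He) as (d & Hd & HH).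
  exists (mkposreal d Hd); intros s Hs; apply HH; [apply Rmax_l|].
  eapply Rle_lt_trans; [|exact Hs].
  unfold abs, minus, plus, opp; cbn.
  unfold Rmax, Rabs; repeat destruct Rle_dec; repeat destruct Rcase_abs; lra.
Qed.

Lemma hcont_ex_RInt (f : R -> C) (a b : R) :
  hcont f -> (0 <= a)%R -> (0 <= b)%R -> ex_RInt (V := C_R_CompleteNormedModule) f a b.
Proof.
  intros H Ha Hb.
  apply ex_RInt_ext with (f := fun s => f (Rmax 0 s)).
  - intros x Hx; f_equal; apply Rmax_right.
    unfold Rmin in Hx; destruct Rle_dec; lra.
  - apply (ex_RInt_continuous (V := C_R_CompleteNormedModule)); intros z _; now apply hcont_clamp.
Qed.

Lemma cder_CInt (f : R -> C) (t : R) :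
  hcont f -> (0 < t)%R -> cder (fun s => CInt f 0 s) t (f t).
Proof.
  intros Hf Ht.
  unfold cder; replace (f t) with (f (Rmax 0 t)) by (f_equal; apply Rmax_right; lra).
  apply (is_derive_RInt (V := C_R_NormedModule)) with (a := 0%R) (f := fun s => f (Rmax 0 s)).
  - exists (mkposreal t Ht); intros s Hs.
    assert (Hs' : (Rabs (s - t) < t)%R) by exact Hs.
    apply Rabs_def2 in Hs'.
    assert (E := RInt_correct (V := C_R_CompleteNormedModule) f 0 s (hcont_ex_RInt f 0 s Hf (Rle_refl _) ltac:(lra))).
    eapply is_RInt_ext; [|exact E].
    intros x Hx; rewrite Rmin_left in Hx by lra; cbn; f_equal; symmetry; apply Rmax_right; lra.
  - now apply hcont_clamp.
Qed.

Lemma hcont_CInt (f : R -> C) : hcont f -> hcont (fun s => CInt f 0 s).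
Proof.
  intros Hf; apply hcont_iff.
  assert (H : forall r, (0 <= r)%R -> continuous (U := C_UniformSpace)
    (fun s => RInt (V := C_R_CompleteNormedModule) (fun s => f (Rmax 0 s)) 0 s) r).
  { intros r Hr; apply (cder_continuous _ r (f (Rmax 0 r))).
    apply (is_derive_RInt (V := C_R_NormedModule)) with (a := 0%R) (f := fun s => f (Rmax 0 s)).
    - exists (mkposreal 1 Rlt_0_1); intros s _.
      apply (RInt_correct (V := C_R_CompleteNormedModule)), (ex_RInt_continuous (V := C_R_CompleteNormedModule)).
      intros z _; now apply hcont_clamp.
    - now apply hcont_clamp. }
  assert (E : forall s, (0 <= s)%R ->
    RInt (V := C_R_CompleteNormedModule) (fun s => f (Rmax 0 s)) 0 s = CInt f 0 s).
  { intros s Hs; apply (RInt_ext (V := C_R_CompleteNormedModule)); intros x Hx.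
    rewrite Rmin_left in Hx by lra; f_equal; apply Rmax_right; lra. }
  intros r Hr eps He.
  destruct (proj1 (filterlim_C (locally r) _ _) (H r Hr) eps He) as [d Hd].
  exists d; split; [apply cond_pos|]; intros s Hs Hsr.
  rewrite <- !E by assumption; apply Hd; exact Hsr.
Qed.

Lemma half_line_FTC (f f' : R -> C) (b : R) :
  hcont f -> hcont f' -> (forall r, (0 < r)%R -> cder f r (f' r)) -> (0 <= b)%R ->
  CInt f' 0 b = f b - f 0%R.
Proof.
  intros Hf Hf' Hd Hb.
  (* [F] has derivative 0 on the open half-line and is continuous up to 0, so the mean value
     inequality with bound 0 makes it constant. *)
  pose (F := fun s : R => CInt f' 0 s + - (1) * f s).
  assert (HF : hcont F).
  { apply hcont_plus; [now apply hcont_CInt|].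
    apply hcont_mult; [apply hcont_const|assumption]. }
  assert (E : (Cmod (F (Rmax 0 b) - F (Rmax 0 0)) <= 2 * 0 * Rabs (b - 0))%R).
  { apply (mean_value_C_open (fun s => F (Rmax 0 s)) (fun _ => 0)).
    - rewrite Rmin_left, Rmax_right by lra; intros s Hs.
      apply cder_ext_near with (f := F) (d := s); [lra| |].
      + intros y Hy; apply Rabs_def2 in Hy; f_equal; symmetry; apply Rmax_right; lra.
      + eapply cder_eq.
        * apply cder_plus; [apply cder_CInt; [assumption|lra]|].
          apply cder_mult; [apply cder_const|apply Hd; lra].
        * cbv beta; ring.
    - intros s _; now apply hcont_clamp.
    - intros s _; rewrite Cmod_0; lra. }
  rewrite (Rmax_right 0 b), (Rmax_right 0 0) in E by lra.
  assert (E0 : F b - F 0%R = 0).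
  { apply Cmod_eq_0; apply Rle_antisym; [lra|apply Cmod_ge_0]. }
  unfold F in E0.
  assert (Z : CInt f' 0 0 = 0) by apply (RInt_point (V := C_R_CompleteNormedModule)).
  rewrite Z in E0.
  replace (CInt f' 0 b) with
    ((CInt f' 0 b + - (1) * f b - (0 + - (1) * f 0%R)) + (f b - f 0%R)) by ring.
  rewrite E0; ring.
Qed.

(** Integrals are taken in C as a real module, where a complex factor is not a scalar; it is moved
    out component by component. *)
Lemma is_RInt_Cmult (f : R -> C) (a b : R) (c l : C) :
  is_RInt (V := C_R_NormedModule) f a b l ->
  is_RInt (V := C_R_NormedModule) (fun r => c * f r) a b (c * l).
Proof.
  intros H.
  pose proof (is_RInt_fct_extend_fst (U := R_NormedModule) (V := R_NormedModule) _ _ _ _ H) as H1.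
  pose proof (is_RInt_fct_extend_snd (U := R_NormedModule) (V := R_NormedModule) _ _ _ _ H) as H2.
  rewrite (surjective_pairing (c * l)).
  apply (is_RInt_fct_extend_pair (U := R_NormedModule) (V := R_NormedModule)).
  - exact (is_RInt_minus _ _ _ _ _ _ (is_RInt_scal _ _ _ (fst c) _ H1) (is_RInt_scal _ _ _ (snd c) _ H2)).
  - exact (is_RInt_plus _ _ _ _ _ _ (is_RInt_scal _ _ _ (fst c) _ H2) (is_RInt_scal _ _ _ (snd c) _ H1)).
Qed.

Lemma CInt_Cmult (f : R -> C) (a b : R) (c : C) :
  ex_RInt (V := C_R_CompleteNormedModule) f a b ->
  CInt (fun r => c * f r) a b = c * CInt f a b.
Proof.
  intros H; apply (is_RInt_unique (V := C_R_CompleteNormedModule)).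
  apply is_RInt_Cmult; exact (RInt_correct (V := C_R_CompleteNormedModule) f a b H).
Qed.

Lemma CInt_norm_le (f : R -> C) (g : R -> R) (a b l : R) :
  hcont f -> (0 <= a <= b)%R ->
  (forall r, (a <= r <= b)%R -> (Cmod (f r) <= g r)%R) -> is_RInt g a b l ->
  (Cmod (CInt f a b) <= l)%R.
Proof.
  intros Hf Hab Hg Hl; rewrite Cmod_norm.
  apply (norm_RInt_le (V := C_R_NormedModule) f g a b); try lra; try assumption.
  - intros x Hx; eapply Rle_trans; [right; symmetry; apply (Cmod_norm (f x))|now apply Hg].
  - apply (RInt_correct (V := C_R_CompleteNormedModule)), hcont_ex_RInt; [assumption|lra|lra].
Qed.

(** [CInt_half_line] is a total function, so convergence has to be carried separately. Continuity is
    included because it makes every finite integral exist. *)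
Definition hint (f : R -> C) (l : C) : Prop :=
  hcont f /\ filterlim (fun b => CInt f 0 b) (Rbar_locally p_infty) (locally l).

Lemma eventually_p_infty (b0 : R) (P : R -> Prop) :
  (forall b, (b0 <= b)%R -> P b) -> Rbar_locally p_infty P.
Proof. intros H; exists b0; intros x Hx; apply H; lra. Qed.

(** Agreement on the open half-line suffices, so an integrand built from data with an arbitrary
    value at 0 may be replaced by its continuous version. *)
Lemma hint_is_RInt_gen (f g : R -> C) (l : C) :
  hint g l -> (forall r, (0 < r)%R -> f r = g r) ->
  is_RInt_gen (V := C_R_NormedModule) f (at_point 0%R) (Rbar_locally p_infty) l.
Proof.
  intros [Hg Hl] E P HP; specialize (Hl P HP); unfold filtermap in Hl.
  econstructor 1 with (Q := fun a => a = 0%R) (R := fun b => (0 <= b)%R /\ P (CInt g 0 b)).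
  - reflexivity.
  - apply filter_and; [|assumption]. now apply (eventually_p_infty 0).
  - intros a b -> [Hb HPb]; exists (CInt g 0 b); split; [|assumption].
    eapply is_RInt_ext; [|apply (RInt_correct (V := C_R_CompleteNormedModule) g 0 b);
      apply hcont_ex_RInt; [assumption|lra|lra]].
    cbn; intros x Hx; rewrite Rmin_left in Hx by lra; symmetry; apply E; lra.
Qed.

Lemma hint_CInt_half_line (f g : R -> C) (l : C) :
  hint g l -> (forall r, (0 < r)%R -> f r = g r) -> CInt_half_line f = l.
Proof.
  intros Hg E; exact (is_RInt_gen_unique (V := C_R_CompleteNormedModule) (Fa := at_point 0%R)
    (Fb := Rbar_locally p_infty) f l (hint_is_RInt_gen f g l Hg E)).
Qed.

Lemma hint_plus (f g : R -> C) (a b : C) :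
  hint f a -> hint g b -> hint (fun r => f r + g r) (a + b).
Proof.
  intros [Hf Ha] [Hg Hb]; split; [now apply hcont_plus|].
  eapply filterlim_ext_loc; [|exact (filterlim_Cplus _ _ _ _ _ Ha Hb)].
  apply (eventually_p_infty 0); intros x Hx; symmetry.
  apply (RInt_plus (V := C_R_CompleteNormedModule)); apply hcont_ex_RInt; auto; lra.
Qed.

Lemma hint_Cmult (f : R -> C) (c a : C) : hint f a -> hint (fun r => c * f r) (c * a).
Proof.
  intros [Hf Ha]; split; [apply hcont_mult; [apply hcont_const|assumption]|].
  eapply filterlim_ext_loc; [|exact (filterlim_Cmult _ _ _ _ _ (filterlim_const c) Ha)].
  apply (eventually_p_infty 0); intros x Hx; symmetry.
  apply CInt_Cmult, hcont_ex_RInt; auto; lra.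
Qed.

Lemma filterlim_Cmod_le (F : R -> C) (l : C) (b0 K : R) :
  filterlim F (Rbar_locally p_infty) (locally l) ->
  (forall b, (b0 <= b)%R -> (Cmod (F b) <= K)%R) -> (Cmod l <= K)%R.
Proof.
  intros HF HK; apply le_epsilon; intros eps He.
  destruct (filter_ex _ (filter_and _ _ (proj1 (filterlim_C _ _ _) HF eps He)
    (eventually_p_infty b0 _ HK))) as (b & H1 & H2).
  pose proof (Cmod_triangle (F b) (- (F b - l))) as H3; rewrite Cmod_opp in H3.
  replace (F b + - (F b - l)) with l in H3 by ring; lra.
Qed.

(** Absolutely convergent integrands, dominated by a multiple of [(1 + r)^-2]. *)
Definition dominated (f : R -> C) (B : R) : Prop :=
  hcont f /\ forall r, (0 <= r)%R -> (Cmod (f r) * (1 + r) ^ 2 <= B)%R.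

Lemma is_RInt_inv_sq (B a b : R) :
  (0 <= a <= b)%R -> is_RInt (fun r => B / (1 + r) ^ 2)%R a b (B / (1 + a) - B / (1 + b))%R.
Proof.
  intros H.
  replace (B / (1 + a) - B / (1 + b))%R with (minus (- (B / (1 + b)))%R (- (B / (1 + a)))%R)
    by (unfold minus, plus, opp; cbn; ring).
  apply (is_RInt_derive (V := R_CompleteNormedModule) (fun r => - (B / (1 + r)))%R);
    rewrite Rmin_left, Rmax_right by lra; intros x Hx.
  - auto_derive; [lra|field; lra].
  - refine (ex_derive_continuous (V := R_NormedModule) (fun r => B / (1 + r) ^ 2)%R x _).
    auto_derive. repeat split; try nra.
Qed.

Lemma dominated_CInt (f : R -> C) (B a b : R) :
  dominated f B -> (0 <= a <= b)%R -> (Cmod (CInt f a b) <= B / (1 + a) - B / (1 + b))%R.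
Proof.
  intros [Hc Hf] H; apply CInt_norm_le with (g := fun r => (B / (1 + r) ^ 2)%R); auto.
  - intros r Hr; apply Rmult_le_reg_r with ((1 + r) ^ 2)%R; [apply pow_lt; lra|].
    unfold Rdiv; rewrite Rmult_assoc, Rinv_l, Rmult_1_r by (apply pow_nonzero; lra).
    apply Hf; lra.
  - now apply is_RInt_inv_sq.
Qed.

Lemma CInt_Chasles (f : R -> C) (a b c : R) :
  hcont f -> (0 <= a)%R -> (0 <= b)%R -> (0 <= c)%R -> CInt f a b + CInt f b c = CInt f a c.
Proof.
  intros; apply (RInt_Chasles (V := C_R_CompleteNormedModule)); now apply hcont_ex_RInt.
Qed.

Lemma dominated_pos (f : R -> C) (B : R) : dominated f B -> (0 <= B)%R.
Proof.
  intros [_ H]; specialize (H 0%R (Rle_refl _)); pose proof (Cmod_ge_0 (f 0%R)); nra.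
Qed.

Lemma dominated_hint (f : R -> C) (B : R) : dominated f B -> hint f (CInt_half_line f).
Proof.
  intros Hf; pose proof (proj1 Hf) as Hc; pose proof (dominated_pos f B Hf) as HB.
  assert (Hex : exists l, filterlim (fun b => CInt f 0 b) (Rbar_locally p_infty) (locally (l : C))).
  { apply (filterlim_locally_cauchy (U := C_R_CompleteNormedModule)); intros eps.
    assert (He := cond_pos eps).
    assert (Hq : (0 <= B / eps)%R) by (apply Rdiv_le_0_compat; lra).
    (* The tail beyond [u] is at most [B / (1 + u)], which is below [eps] once [u] exceeds
       [B / eps]. *)
    assert (G : forall u v, (B / eps < u)%R -> (u <= v)%R ->
      (Cmod (CInt f 0 v - CInt f 0 u) < eps)%R).
    { intros u v Hu Huv.
      rewrite <- (CInt_Chasles f 0 u v) by (auto; lra).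
      replace (CInt f 0 u + CInt f u v - CInt f 0 u) with (CInt f u v) by ring.
      eapply Rle_lt_trans; [apply (dominated_CInt f B); [assumption|lra]|].
      assert (0 <= B / (1 + v))%R by (apply Rdiv_le_0_compat; lra).
      assert (B / (1 + u) < eps)%R; [|lra].
      apply Rmult_lt_reg_r with (1 + u)%R; [lra|].
      unfold Rdiv at 1; rewrite Rmult_assoc, Rinv_l, Rmult_1_r by lra.
      assert (E : (B / eps * eps = B)%R) by (field; lra). nra. }
    exists (fun b => (B / eps < b)%R); split.
    - exists (B / eps)%R; auto.
    - intros u v Hu Hv; apply C_NormedModule_mixin_compat1.
      change (Cmod (CInt f 0 v - CInt f 0 u) < eps)%R.
      destruct (Rle_dec u v) as [H|H]; [now apply G|].
      rewrite <- Cmod_opp; replace (- (CInt f 0 v - CInt f 0 u)) with (CInt f 0 u - CInt f 0 v) by ring.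
      apply G; lra. }
  destruct Hex as [l Hl].
  rewrite (hint_CInt_half_line f f l); [|split; assumption|reflexivity].
  split; assumption.
Qed.

Lemma CInt_half_line_ext (f g : R -> C) (B : R) :
  dominated g B -> (forall r, (0 < r)%R -> f r = g r) -> CInt_half_line f = CInt_half_line g.
Proof. intros Hg E; apply hint_CInt_half_line with (g := g); [eapply dominated_hint, Hg|assumption]. Qed.

(** The supremum bound is used up to [rho] and the tail bound beyond it. The case [rho = 0] gives
    the absolute bound; a large [rho] gives continuity in parameters. *)
Lemma CInt_half_line_cut (f : R -> C) (B e rho : R) :
  dominated f B -> (0 <= rho)%R -> (forall r, (0 <= r <= rho)%R -> (Cmod (f r) <= e)%R) ->
  (Cmod (CInt_half_line f) <= e * rho + B / (1 + rho))%R.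
Proof.
  intros Hf Hrho He; pose proof (proj1 Hf) as Hc; pose proof (dominated_pos f B Hf) as HB.
  apply filterlim_Cmod_le with (F := fun b => CInt f 0 b) (b0 := rho).
  - apply (dominated_hint f B Hf).
  - intros b Hb; rewrite <- (CInt_Chasles f 0 rho b) by (auto; lra).
    eapply Rle_trans; [apply Cmod_triangle|]; apply Rplus_le_compat.
    + apply CInt_norm_le with (g := fun _ => e); auto; [lra|].
      replace (e * rho)%R with (scal (rho - 0)%R e) by (unfold scal; cbn; unfold mult; cbn; ring).
      apply (is_RInt_const (V := R_NormedModule)).
    + eapply Rle_trans; [apply (dominated_CInt f B); [assumption|lra]|].
      assert (0 <= B / (1 + b))%R by (apply Rdiv_le_0_compat; lra). lra.
Qed.

Lemma CInt_half_line_bound (f : R -> C) (B : R) :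
  dominated f B -> (Cmod (CInt_half_line f) <= B)%R.
Proof.
  intros Hf; pose proof (CInt_half_line_cut f B (Cmod (f 0%R)) 0 Hf (Rle_refl _)) as H.
  replace (Cmod (f 0%R) * 0 + B / (1 + 0))%R with B in H by field.
  apply H; intros r Hr; replace r with 0%R by lra; lra.
Qed.

Lemma CInt_half_line_plus (f g : R -> C) (A B : R) :
  dominated f A -> dominated g B ->
  CInt_half_line (fun r => f r + g r) = CInt_half_line f + CInt_half_line g.
Proof.
  intros Hf Hg; apply hint_CInt_half_line with (g := fun r => f r + g r); [|reflexivity].
  apply hint_plus; eapply dominated_hint; eassumption.
Qed.

Lemma CInt_half_line_Cmult (f : R -> C) (c : C) (B : R) :
  dominated f B -> CInt_half_line (fun r => c * f r) = c * CInt_half_line f.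
Proof.
  intros Hf; apply hint_CInt_half_line with (g := fun r => c * f r); [|reflexivity].
  apply hint_Cmult; eapply dominated_hint; eassumption.
Qed.

Lemma dominated_plus (f g : R -> C) (A B : R) :
  dominated f A -> dominated g B -> dominated (fun r => f r + g r) (A + B).
Proof.
  intros [Hf1 Hf2] [Hg1 Hg2]; split; [now apply hcont_plus|].
  intros r Hr; specialize (Hf2 r Hr); specialize (Hg2 r Hr).
  pose proof (Cmod_triangle (f r) (g r)).
  assert (0 <= (1 + r) ^ 2)%R by (apply pow_le; lra). nra.
Qed.

Lemma dominated_Cmult (f : R -> C) (c : C) (B : R) :
  dominated f B -> dominated (fun r => c * f r) (Cmod c * B).
Proof.
  intros [Hf1 Hf2]; split; [apply hcont_mult; [apply hcont_const|assumption]|].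
  intros r Hr; specialize (Hf2 r Hr); rewrite Cmod_mult, Rmult_assoc.
  apply Rmult_le_compat_l; [apply Cmod_ge_0|assumption].
Qed.

Lemma CInt_half_line_FTC (f f' : R -> C) (A B : R) :
  hcont f -> (forall r, (0 < r)%R -> cder f r (f' r)) ->
  (forall r, (0 <= r)%R -> (Cmod (f r) * (1 + r) <= A)%R) -> dominated f' B ->
  CInt_half_line f' = - f 0%R.
Proof.
  intros Hf Hd HA HB.
  apply hint_CInt_half_line with (g := f'); [|reflexivity]; split; [apply HB|].
  assert (HA0 : (0 <= A)%R).
  { pose proof (HA 0%R (Rle_refl _)); pose proof (Cmod_ge_0 (f 0%R)); nra. }
  apply filterlim_C; [apply Rbar_locally_filter|]; intros eps He.
  assert (Hq : (0 <= A / eps)%R) by (apply Rdiv_le_0_compat; lra).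
  apply (eventually_p_infty (A / eps)); intros b Hb.
  rewrite (half_line_FTC f f' b) by (auto; try apply HB; lra).
  replace (f b - f 0%R - - f 0%R) with (f b) by ring.
  specialize (HA b ltac:(lra)).
  assert (E : (A / eps * eps = A)%R) by (field; lra).
  pose proof (Cmod_ge_0 (f b)).
  apply Rmult_lt_reg_r with (1 + b)%R; [lra|].
  eapply Rle_lt_trans; [exact HA|]. nra.
Qed.

(** The Taylor remainder of the integrand in the parameter is at most [4 M (s - s0)^2 (1 + r)^-2],
    uniformly in [r]. Integrating it leaves a quadratic remainder for the integral. The price is a
    bound on a second parameter derivative. *)
Lemma cder_CInt_half_line (F F1 F2 : R -> R -> C) (s0 d M : R) :
  (0 < d)%R ->
  (forall s, (Rabs (s - s0) < d)%R -> exists B, dominated (F s) B) ->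
  (exists B, dominated (F1 s0) B) ->
  (forall s r, (Rabs (s - s0) < d)%R -> (0 <= r)%R -> cder (fun s => F s r) s (F1 s r)) ->
  (forall s r, (Rabs (s - s0) < d)%R -> (0 <= r)%R -> cder (fun s => F1 s r) s (F2 s r)) ->
  (forall s r, (Rabs (s - s0) < d)%R -> (0 <= r)%R -> (Cmod (F2 s r) * (1 + r) ^ 2 <= M)%R) ->
  cder (fun s => CInt_half_line (F s)) s0 (CInt_half_line (F1 s0)).
Proof.
  intros Hd HF [B1 HF1] H1 H2 HM.
  apply cder_of_quadratic with (d := d) (M := (4 * M)%R); [assumption|]; intros s Hs.
  destruct (HF s Hs) as [Bs Hbs].
  destruct (HF s0) as [B0 Hb0]; [rewrite Rminus_diag, Rabs_R0; assumption|].
  pose (G := fun r => F s r + - (1) * F s0 r + - RtoC (s - s0) * F1 s0 r).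
  assert (HG : exists B, dominated G B).
  { eexists; apply dominated_plus; [apply dominated_plus|]; [eassumption| |];
      apply dominated_Cmult; eassumption. }
  destruct HG as [BG HG].
  assert (E : CInt_half_line G = CInt_half_line (F s) - CInt_half_line (F s0)
    - RtoC (s - s0) * CInt_half_line (F1 s0)).
  { unfold G; erewrite CInt_half_line_plus; [erewrite CInt_half_line_plus|..];
      [|eassumption|eapply dominated_Cmult; eassumption| |eapply dominated_Cmult; eassumption].
    - erewrite !CInt_half_line_Cmult by eassumption; ring.
    - apply dominated_plus; [eassumption|apply dominated_Cmult; eassumption]. }
  rewrite <- E; apply CInt_half_line_bound; split; [apply HG|]; intros r Hr.
  assert (Hp : (0 < (1 + r) ^ 2)%R) by (apply pow_lt; lra).
  assert (Hseg : forall y, (Rmin s0 s <= y <= Rmax s0 s)%R -> (Rabs (y - s0) < d)%R).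
  { intros y; revert Hs; unfold Rmin, Rmax, Rabs; repeat destruct Rle_dec;
      repeat destruct Rcase_abs; lra. }
  pose proof (taylor_C (fun s => F s r) (fun s => F1 s r) (fun s => F2 s r) s0 s (M / (1 + r) ^ 2)
    (fun y Hy => H1 y r (Hseg y Hy) Hr) (fun y Hy => H2 y r (Hseg y Hy) Hr)) as T.
  replace (G r) with (F s r - F s0 r - RtoC (s - s0) * F1 s0 r) by (unfold G; ring).
  apply Rmult_le_reg_r with (/ (1 + r) ^ 2)%R; [now apply Rinv_0_lt_compat|].
  rewrite Rmult_assoc, Rinv_r, Rmult_1_r by lra.
  eapply Rle_trans; [apply T|right; field; lra].
  intros y Hy; apply Rmult_le_reg_r with ((1 + r) ^ 2)%R; [assumption|].
  unfold Rdiv; rewrite Rmult_assoc, Rinv_l, Rmult_1_r by lra.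
  apply HM; [now apply Hseg|assumption].
Qed.

(** ** The heat exponential along a ray *)

(** On the ray [lambda = i kappa r], [Ek kappa x t r = exp (i lambda x - lambda^2 t)]. *)
Definition Ek (kappa : C) (x t r : R) : C :=
  Cexp (kappa * kappa * RtoC (t * r ^ 2) - kappa * RtoC (x * r)).

(** With [lambda = i kappa r] the sign conditions read Im lambda >= 0 and Re (lambda^2) >= 0: both
    exponential factors are bounded by 1 in the closed quadrant. *)
Definition ray (kappa : C) : Prop :=
  Cmod kappa = 1%R /\ (0 <= Re kappa)%R /\ (Re (kappa * kappa) <= 0)%R.

(** An exponential rate of decay of [Ek] in [r], valid up to the factor [exp t]. It combines both
    mechanisms: it is positive for x > 0 if Re kappa > 0, and for t > 0 if Re (kappa^2) < 0. *)
Definition rate (kappa : C) (x t : R) : R := (Re kappa * x - Re (kappa * kappa) * t)%R.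

Lemma Ek_exponent (kappa : C) (x t r : R) :
  Re (kappa * kappa * RtoC (t * r ^ 2) - kappa * RtoC (x * r)) =
  (Re (kappa * kappa) * (t * r ^ 2) - Re kappa * (x * r))%R.
Proof. unfold Re, Im; cbn; ring. Qed.

Lemma Cmod_Ek (kappa : C) (x t r : R) :
  Cmod (Ek kappa x t r) = exp (Re (kappa * kappa) * (t * r ^ 2) - Re kappa * (x * r)).
Proof. unfold Ek; rewrite Cmod_Cexp, Ek_exponent; reflexivity. Qed.

Lemma ray_Re (kappa : C) : ray kappa -> (Re kappa <= 1 /\ -1 <= Re (kappa * kappa))%R.
Proof.
  intros (H1 & _ & _); split.
  - rewrite <- H1; eapply Rle_trans; [apply Rle_abs|apply Re_le_Cmod].
  - pose proof (Re_le_Cmod (kappa * kappa)) as H; rewrite Cmod_mult, H1, Rmult_1_l in H.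
    apply Rabs_le_between in H; lra.
Qed.

Lemma Ek_exponent_le_0 (kappa : C) (x t r : R) :
  ray kappa -> (0 <= x)%R -> (0 <= t)%R -> (0 <= r)%R ->
  (Re (kappa * kappa) * (t * r ^ 2) - Re kappa * (x * r) <= 0)%R.
Proof.
  intros (_ & H1 & H2) Hx Ht Hr.
  assert (0 <= t * r ^ 2)%R by (apply Rmult_le_pos; nra).
  assert (0 <= x * r)%R by nra. nra.
Qed.

Lemma Cmod_Ek_le_1 (kappa : C) (x t r : R) :
  ray kappa -> (0 <= x)%R -> (0 <= t)%R -> (0 <= r)%R -> (Cmod (Ek kappa x t r) <= 1)%R.
Proof. intros; rewrite Cmod_Ek; apply exp_le_1, Ek_exponent_le_0; assumption. Qed.

Lemma Cmod_Ek_decay (kappa : C) (x t r : R) :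
  ray kappa -> (0 <= x)%R -> (0 <= t)%R -> (0 <= r)%R ->
  (Cmod (Ek kappa x t r) <= exp t * exp (- (rate kappa x t * r)))%R.
Proof.
  intros Hk Hx Ht Hr; rewrite Cmod_Ek, <- exp_plus; apply exp_le; unfold rate.
  destruct (ray_Re kappa Hk) as [_ H1]; destruct Hk as (_ & _ & H2).
  (* Gaussian decay is weakened to exponential decay by [r^2 >= r - 1]; the constant term is
     absorbed in [exp t] because Re (kappa^2) >= -1. *)
  assert (H : (0 <= t * (r ^ 2 - r + 1))%R) by (apply Rmult_le_pos; [assumption|nra]).
  nra.
Qed.

Lemma Ek_lipschitz (kappa : C) (x t x' t' r : R) :
  ray kappa -> (0 <= x)%R -> (0 <= t)%R -> (0 <= x')%R -> (0 <= t')%R -> (0 <= r)%R ->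
  (Cmod (Ek kappa x t r - Ek kappa x' t' r) <=
     2 * (Rabs (x - x') + Rabs (t - t')) * (1 + r) ^ 2)%R.
Proof.
  intros Hk Hx Ht Hx' Ht' Hr; unfold Ek.
  eapply Rle_trans; [apply Cexp_lipschitz; rewrite Ek_exponent; now apply Ek_exponent_le_0|].
  replace (kappa * kappa * RtoC (t * r ^ 2) - kappa * RtoC (x * r) -
     (kappa * kappa * RtoC (t' * r ^ 2) - kappa * RtoC (x' * r)))
    with (kappa * kappa * RtoC ((t - t') * r ^ 2) + - (kappa * RtoC ((x - x') * r)))
    by (apply C_eq; unfold Re, Im; cbn; ring).
  rewrite Rmult_assoc; apply Rmult_le_compat_l; [lra|].
  eapply Rle_trans; [apply Cmod_triangle|].
  rewrite Cmod_opp, !Cmod_mult, !Cmod_R, (proj1 Hk), !Rabs_mult.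
  rewrite (Rabs_pos_eq r), (Rabs_pos_eq (r ^ 2)) by nra.
  pose proof (Rabs_pos (x - x')); pose proof (Rabs_pos (t - t')). nra.
Qed.

Lemma cder_RtoC_affine (a b : R) (s : R) : cder (fun s => RtoC (s * a + b)) s (RtoC a).
Proof.
  apply cder_ext_near with (f := fun s => RtoC s * RtoC a + RtoC b) (d := 1%R); [lra| |].
  - intros y _; rewrite RtoC_plus, RtoC_mult; reflexivity.
  - eapply cder_eq; [apply cder_plus; [apply cder_mult; [apply cder_id|]|]; apply cder_const|].
    cbv beta; ring.
Qed.

Lemma cder_Ek_x (kappa : C) (x t r : R) :
  cder (fun x => Ek kappa x t r) x (- (kappa * RtoC r) * Ek kappa x t r).
Proof.
  eapply cder_eq.
  - apply cder_Cexp.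
    apply cder_ext_near with (d := 1%R)
      (f := fun s => kappa * kappa * RtoC (t * r ^ 2) + - kappa * RtoC (s * r + 0)); [lra| |].
    + intros s _; rewrite Rplus_0_r; ring.
    + apply cder_plus; [apply cder_const|apply cder_mult; [apply cder_const|apply cder_RtoC_affine]].
  - unfold Ek; cbv beta; ring.
Qed.

Lemma cder_Ek_t (kappa : C) (x t r : R) :
  cder (fun t => Ek kappa x t r) t ((kappa * RtoC r) ^ 2 * Ek kappa x t r).
Proof.
  eapply cder_eq.
  - apply cder_Cexp.
    apply cder_ext_near with (d := 1%R)
      (f := fun s => kappa * kappa * RtoC (s * r ^ 2 + 0) + - kappa * RtoC (x * r)); [lra| |].
    + intros s _; rewrite Rplus_0_r; ring.
    + apply cder_plus; [|apply cder_const].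
      apply cder_mult; [apply cder_const|apply cder_RtoC_affine].
  - unfold Ek; cbv beta; cbn [Cpow]; rewrite RtoC_mult.
    replace (RtoC (r ^ 2)) with (RtoC r * RtoC r) by (rewrite <- RtoC_mult; f_equal; ring).
    ring.
Qed.

Lemma cder_Ek_r (kappa : C) (x t r : R) :
  cder (fun r => Ek kappa x t r) r
    ((2 * (kappa * kappa) * RtoC t * RtoC r - kappa * RtoC x) * Ek kappa x t r).
Proof.
  eapply cder_eq.
  - apply cder_Cexp.
    apply cder_ext_near with (d := 1%R)
      (f := fun s => kappa * kappa * RtoC t * (RtoC s * RtoC s) + - kappa * RtoC x * RtoC s); [lra| |].
    + intros s _; rewrite !RtoC_mult.
      replace (RtoC (s ^ 2)) with (RtoC s * RtoC s) by (rewrite <- RtoC_mult; f_equal; ring). ring.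
    + apply cder_plus.
      * apply cder_mult; [apply cder_const|apply cder_mult; apply cder_id].
      * apply cder_mult; [apply cder_const|apply cder_id].
  - unfold Ek; cbv beta; rewrite !RtoC_mult.
    replace (RtoC (r ^ 2)) with (RtoC r * RtoC r) by (rewrite <- RtoC_mult; f_equal; ring). ring.
Qed.

Lemma hcont_Ek (kappa : C) (x t : R) : hcont (Ek kappa x t).
Proof. apply hcont_cder with (1 := fun r _ => cder_Ek_r kappa x t r). Qed.

(** ** Amplitudes *)

Definition poly_growth (a : R -> C) (N : nat) (B : R) : Prop :=
  hcont a /\ forall r, (0 <= r)%R -> (Cmod (a r) <= B * (1 + r) ^ N)%R.

Lemma pow_1_le (r : R) (n : nat) : (0 <= r)%R -> (1 <= (1 + r) ^ n)%R.
Proof. intros; apply pow_R1_Rle; lra. Qed.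

Lemma poly_growth_pos (a : R -> C) (N : nat) (B : R) : poly_growth a N B -> (0 <= B)%R.
Proof.
  intros [_ H]; specialize (H 0%R (Rle_refl _)).
  rewrite Rplus_0_r, pow1, Rmult_1_r in H; eapply Rle_trans; [apply Cmod_ge_0|exact H].
Qed.

Lemma poly_growth_mul (f a : R -> C) (M N : nat) (A B : R) :
  poly_growth f M A -> poly_growth a N B -> poly_growth (fun r => f r * a r) (M + N) (A * B).
Proof.
  intros Hf Ha; pose proof (poly_growth_pos _ _ _ Hf); pose proof (poly_growth_pos _ _ _ Ha).
  destruct Hf as [Hf1 Hf2], Ha as [Ha1 Ha2]; split; [now apply hcont_mult|].
  intros r Hr; rewrite Cmod_mult, pow_add.
  replace (A * B * ((1 + r) ^ M * (1 + r) ^ N))%R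
    with ((A * (1 + r) ^ M) * (B * (1 + r) ^ N))%R by ring.
  apply Rmult_le_compat; auto using Cmod_ge_0.
Qed.

Lemma poly_growth_r (k : C) : Cmod k = 1%R -> poly_growth (fun r => k * RtoC r) 1 1.
Proof.
  intros Hk; split; [apply hcont_mult; [apply hcont_const|apply hcont_id]|].
  intros r Hr; rewrite Cmod_mult, Hk, Cmod_R, Rabs_pos_eq by assumption; lra.
Qed.

Lemma poly_growth_pow (k : C) (n : nat) :
  Cmod k = 1%R -> poly_growth (fun r => (k * RtoC r) ^ n) n 1.
Proof.
  intros Hk; induction n as [|n IH].
  - split; [exact (hcont_const 1)|].
    intros r Hr; cbn; rewrite Cmod_1; lra.
  - replace 1%R with (1 * 1)%R by ring.
    exact (poly_growth_mul _ _ _ _ _ _ (poly_growth_r k Hk) IH).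
Qed.

(** [symbol d N m a]: [a] is a symbol of order [N - m], with estimates on [d] derivatives. *)
Fixpoint symbol (d N m : nat) (a : R -> C) : Prop :=
  hcont a /\
  (exists B, forall r, (0 <= r)%R -> (Cmod (a r) * (1 + r) ^ m <= B * (1 + r) ^ N)%R) /\
  match d with
  | O => True
  | S d' => exists a', (forall r, (0 < r)%R -> cder a r (a' r)) /\ symbol d' N (S m) a'
  end.

Lemma symbol_hcont (d N m : nat) (a : R -> C) : symbol d N m a -> hcont a.
Proof. destruct d; intros H; apply H. Qed.

Lemma symbol_bound (d N m : nat) (a : R -> C) : symbol d N m a ->
  exists B, forall r, (0 <= r)%R -> (Cmod (a r) * (1 + r) ^ m <= B * (1 + r) ^ N)%R.
Proof. destruct d; intros H; apply H. Qed.

Lemma symbol_pred (d N m : nat) (a : R -> C) : symbol (S d) N m a -> symbol d N m a.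
Proof.
  revert m a; induction d as [|d IH]; intros m a (H1 & H2 & a' & H3 & H4).
  - now repeat split.
  - split; [assumption|split; [assumption|]]; exists a'; split; [assumption|]; now apply IH.
Qed.

(** The order is unchanged. The shift aligns the two natural numbers that encode it, as is needed to
    add [a] and [r a'] in the derivative of [r a]. *)
Lemma symbol_shift (d N m : nat) (a : R -> C) : symbol d N m a -> symbol d (S N) (S m) a.
Proof.
  revert m a; induction d as [|d IH]; intros m a (H1 & [B H2] & H3);
    (split; [assumption|]); (split; [exists B; intros r Hr; specialize (H2 r Hr); cbn [pow]; nra|]).
  - trivial.
  - destruct H3 as (a' & H3 & H4); exists a'; split; auto.
Qed.

Lemma symbol_plus (d N m : nat) (a b : R -> C) :
  symbol d N m a -> symbol d N m b -> symbol d N m (fun r => a r + b r).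
Proof.
  revert m a b; induction d as [|d IH]; intros m a b (A1 & [A A2] & A3) (B1 & [B B2] & B3);
    (split; [now apply hcont_plus|]);
    (split; [exists (A + B)%R; intros r Hr; specialize (A2 r Hr); specialize (B2 r Hr);
      pose proof (Cmod_triangle (a r) (b r)); pose proof (pow_1_le r m Hr); nra|]).
  - trivial.
  - destruct A3 as (a' & A3 & A4), B3 as (b' & B3 & B4).
    exists (fun r => a' r + b' r); split; [|now apply IH].
    intros r Hr; apply cder_plus; auto.
Qed.

Lemma symbol_Cmult (d N m : nat) (a : R -> C) (c : C) :
  symbol d N m a -> symbol d N m (fun r => c * a r).
Proof.
  revert m a; induction d as [|d IH]; intros m a (A1 & [A A2] & A3);
    (split; [apply hcont_mult; [apply hcont_const|assumption]|]);
    (split; [exists (Cmod c * A)%R; intros r Hr; specialize (A2 r Hr); rewrite Cmod_mult;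
      pose proof (Cmod_ge_0 c); nra|]).
  - trivial.
  - destruct A3 as (a' & A3 & A4); exists (fun r => c * a' r); split; [|now apply IH].
    intros r Hr; eapply cder_eq; [apply cder_mult; [apply cder_const|apply A3, Hr]|cbv beta; ring].
Qed.

Lemma symbol_0 (d N m : nat) : symbol d N m (fun _ => 0).
Proof.
  revert m; induction d as [|d IH]; intros m; (split; [apply hcont_const|]);
    (split; [exists 0%R; intros; rewrite Cmod_0; lra|]); [trivial|].
  exists (fun _ => 0); split; [intros; apply cder_const|apply IH].
Qed.

Lemma symbol_const (d : nat) (c : C) : symbol d 0 0 (fun _ => c).
Proof.
  assert (H : symbol 0 0 0 (fun _ => c)).
  { split; [apply hcont_const|split; [|trivial]].
    exists (Cmod c); intros; lra. }
  destruct d as [|d]; [assumption|].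
  split; [apply H|split; [apply H|]]; exists (fun _ => 0); split;
    [intros; apply cder_const|apply symbol_0].
Qed.

Lemma symbol_mul_r (d N m : nat) (a : R -> C) :
  symbol d N m a -> symbol d (S N) m (fun r => RtoC r * a r).
Proof.
  revert m a; induction d as [|d IH]; intros m a Ha; pose proof Ha as (A1 & [A A2] & A3);
    (split; [apply hcont_mult; [apply hcont_id|assumption]|]);
    (split; [exists A; intros r Hr; specialize (A2 r Hr); rewrite Cmod_mult, Cmod_R, Rabs_pos_eq by assumption;
      pose proof (Cmod_ge_0 (a r)); pose proof (pow_1_le r m Hr);
      assert (0 <= Cmod (a r) * (1 + r) ^ m)%R by nra; cbn [pow]; nra|]).
  - trivial.
  - destruct A3 as (a' & A3 & A4); exists (fun r => a r + RtoC r * a' r); split.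
    + intros r Hr; eapply cder_eq; [apply cder_mult; [apply cder_id|apply A3, Hr]|cbv beta; ring].
    + apply symbol_plus; [apply symbol_shift, symbol_pred, Ha|now apply IH].
Qed.

Lemma symbol_pow (d n : nat) (k : C) : symbol d n 0 (fun r => (k * RtoC r) ^ n).
Proof.
  induction n as [|n IH]; [exact (symbol_const d 1)|].
  replace (fun r : R => (k * RtoC r) ^ S n) with (fun r : R => k * (RtoC r * (k * RtoC r) ^ n))
    by (apply functional_extensionality; intros r; cbn; ring).
  now apply symbol_Cmult, symbol_mul_r.
Qed.

Lemma symbol_mul_pow (d N m n : nat) (k : C) (a : R -> C) :
  symbol d N m a -> symbol d (n + N) m (fun r => (k * RtoC r) ^ n * a r).
Proof.
  intros Ha; induction n as [|n IH].
  - replace (fun r : R => (k * RtoC r) ^ 0 * a r) with a; [assumption|].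
    apply functional_extensionality; intros r; cbn; ring.
  - replace (fun r : R => (k * RtoC r) ^ S n * a r)
      with (fun r : R => k * (RtoC r * ((k * RtoC r) ^ n * a r)))
      by (apply functional_extensionality; intros r; cbn; ring).
    now apply symbol_Cmult, symbol_mul_r.
Qed.

(** Since Re kappa >= 0, the square of the modulus, [1 + 2 r Re kappa + r^2], is at least [1 + r^2].
    Thus dividing by [1 + kappa r] lowers the order by one and creates no singularity at [r = 0]. *)
Lemma ray_denominator (kappa : C) (r : R) :
  ray kappa -> (0 <= r)%R -> ((1 + r) / 2 <= Cmod (1 + kappa * RtoC r))%R.
Proof.
  intros (H1 & H2 & _) Hr.
  assert (E : (Re kappa ^ 2 + Im kappa ^ 2 = 1)%R).
  { assert (H := H1); unfold Cmod in H; apply (f_equal (fun z => z ^ 2)%R) in H.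
    rewrite pow2_sqrt in H by nra. unfold Re, Im; lra. }
  unfold Cmod; apply Rsqr_incr_0_var; [|apply sqrt_pos].
  rewrite Rsqr_sqrt by nra; unfold Rsqr, Re, Im in *; cbn in *.
  assert (0 <= r * fst kappa)%R by now apply Rmult_le_pos.
  assert (E2 : (r * r * (fst kappa * fst kappa + snd kappa * snd kappa) = r * r)%R).
  { replace (fst kappa * fst kappa + snd kappa * snd kappa)%R with 1%R by lra. ring. }
  nra.
Qed.

Lemma ray_denominator_neq_0 (kappa : C) (r : R) :
  ray kappa -> (0 <= r)%R -> 1 + kappa * RtoC r <> 0.
Proof.
  intros Hk Hr E; pose proof (ray_denominator kappa r Hk Hr) as H.
  rewrite E, Cmod_0 in H; lra.
Qed.

Lemma ray_denominator_inv (kappa : C) (r : R) :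
  ray kappa -> (0 <= r)%R -> (Cmod (/ (1 + kappa * RtoC r)) * (1 + r) <= 2)%R.
Proof.
  intros Hk Hr; pose proof (ray_denominator kappa r Hk Hr) as H.
  rewrite Cmod_inv by now apply ray_denominator_neq_0.
  apply Rmult_le_reg_l with (Cmod (1 + kappa * RtoC r)); [lra|].
  rewrite <- Rmult_assoc, Rinv_r by lra; lra.
Qed.

Lemma hcont_ray_denominator_inv (kappa : C) : ray kappa -> hcont (fun r => / (1 + kappa * RtoC r)).
Proof.
  intros Hk; apply continuous_on_Cinv; [intros r Hr; now apply ray_denominator_neq_0|].
  apply hcont_plus; [apply hcont_const|].
  apply hcont_mult; [apply hcont_const|apply hcont_id].
Qed.

Lemma symbol_div (d N m : nat) (kappa : C) (a : R -> C) : ray kappa ->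
  symbol d N m a -> symbol d N (S m) (fun r => / (1 + kappa * RtoC r) * a r).
Proof.
  intros Hk; revert m a; induction d as [|d IH]; intros m a Ha; pose proof Ha as (A1 & [A A2] & A3);
    (split; [apply hcont_mult; [now apply hcont_ray_denominator_inv|assumption]|]);
    (split; [exists (2 * A)%R; intros r Hr; specialize (A2 r Hr); rewrite Cmod_mult;
      pose proof (ray_denominator_inv kappa r Hk Hr) as HD; cbn [pow];
      pose proof (Cmod_ge_0 (a r)); pose proof (pow_1_le r m Hr);
      replace (Cmod (/ (1 + kappa * RtoC r)) * Cmod (a r) * ((1 + r) * (1 + r) ^ m))%R
        with ((Cmod (/ (1 + kappa * RtoC r)) * (1 + r)) * (Cmod (a r) * (1 + r) ^ m))%R by ring;
      assert (0 <= Cmod (a r) * (1 + r) ^ m)%R by nra; nra|]).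
  - trivial.
  - destruct A3 as (a' & A3 & A4).
    exists (fun r => - kappa * (/ (1 + kappa * RtoC r) * (/ (1 + kappa * RtoC r) * a r))
                     + / (1 + kappa * RtoC r) * a' r); split.
    + intros r Hr; eapply cder_eq.
      * apply cder_mult; [|apply A3, Hr].
        apply (cder_inv (fun r => 1 + kappa * RtoC r)); [apply ray_denominator_neq_0; [assumption|lra]|].
        apply cder_plus; [apply cder_const|apply cder_mult; [apply cder_const|apply cder_id]].
      * cbv beta; ring.
    + apply symbol_plus; [|now apply IH].
      apply symbol_Cmult, IH, IH, symbol_pred, Ha.
Qed.

Lemma symbol_poly_growth (d N m : nat) (a : R -> C) :
  symbol d N m a -> exists B, poly_growth a N B.
Proof.
  intros Ha; destruct (symbol_bound _ _ _ _ Ha) as [B HB]; exists B; split.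
  - eapply symbol_hcont, Ha.
  - intros r Hr; eapply Rle_trans; [|apply HB, Hr].
    pose proof (Cmod_ge_0 (a r)); pose proof (pow_1_le r m Hr); nra.
Qed.

(** ** Ray integrals *)

Notation cont_on := (continuous_on (T := prod_UniformSpace R_UniformSpace R_UniformSpace)
  (U := C_UniformSpace)).

Notation near D p := (within D (locally (p : prod_UniformSpace R_UniformSpace R_UniformSpace))).

Lemma near_of_box (D P : R * R -> Prop) (p : R * R) (d : R) :
  (0 < d)%R ->
  (forall x t, D (x, t) -> (Rabs (x - fst p) < d)%R -> (Rabs (t - snd p) < d)%R -> P (x, t)) ->
  near D p P.
Proof.
  intros Hd H; exists (mkposreal d Hd); intros [x t] [H1 H2] HD; apply H; assumption.
Qed.

Lemma near_point (D P : R * R -> Prop) (p : R * R) : D p -> near D p P -> P p.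
Proof. intros HD H; exact (locally_singleton p _ H HD). Qed.

Lemma near_forall (D P : R * R -> Prop) (p : R * R) : (forall q, D q -> P q) -> near D p P.
Proof.
  intros H; apply near_of_box with (d := 1%R); [lra|]; intros; now apply H.
Qed.

Lemma near_and (D P Q : R * R -> Prop) (p : R * R) :
  near D p P -> near D p Q -> near D p (fun q => P q /\ Q q).
Proof. intros HP HQ; apply filter_and; assumption. Qed.

Lemma near_imp (D P Q : R * R -> Prop) (p : R * R) :
  (forall q, D q -> P q -> Q q) -> near D p P -> near D p Q.
Proof. intros H; unfold within; apply filter_imp; auto. Qed.

(** Domination uniform near [p0] controls the tail. On a bounded range of [r] pointwise closeness
    suffices, and it may degrade polynomially in [r]. *)
Lemma CInt_half_line_continuous_on (D : R * R -> Prop) (F : R * R -> R -> C) :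
  (forall p0, D p0 -> exists B K,
     near D p0 (fun p => dominated (F p) B) /\
     forall e, (0 < e)%R -> near D p0 (fun p => forall r, (0 <= r)%R ->
        (Cmod (F p r - F p0 r) <= e * (1 + r) ^ K)%R)) ->
  cont_on D (fun p => CInt_half_line (F p)).
Proof.
  intros H; apply continuous_on_C; intros p0 Hp0 eps He.
  destruct (H p0 Hp0) as (B & K & HB & HK).
  assert (HB0 := near_point _ _ _ Hp0 HB).
  assert (HBpos := dominated_pos _ _ HB0).
  (* The difference of the two integrands is dominated with constant [2 B], so its tail beyond [rho]
     is at most [eps / 2]; the [e] below makes the part up to [rho] contribute [eps / 4]. *)
  set (rho := (4 * B / eps + 1)%R).
  assert (Hrho : (1 <= rho)%R).
  { unfold rho; assert (0 <= 4 * B / eps)%R by (apply Rdiv_le_0_compat; lra). lra. }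
  assert (Hpow : (1 <= (1 + rho) ^ K)%R) by (apply pow_1_le; lra).
  set (e := (eps / (4 * rho * (1 + rho) ^ K))%R).
  assert (He' : (0 < e)%R) by (apply Rdiv_lt_0_compat; [assumption|nra]).
  generalize (near_and _ _ _ _ HB (HK e He')); apply near_imp.
  intros p _ [Hp HpK].
  assert (HG : dominated (fun r => F p r + - (1) * F p0 r) (B + Cmod (- (1)) * B))
    by (apply dominated_plus; [assumption|now apply dominated_Cmult]).
  rewrite Cmod_m1, Rmult_1_l in HG.
  replace (CInt_half_line (F p) - CInt_half_line (F p0))
    with (CInt_half_line (fun r => F p r + - (1) * F p0 r)).
  2:{ rewrite (CInt_half_line_plus (F p) (fun r => - (1) * F p0 r) _ _ Hp (dominated_Cmult _ _ _ HB0)).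
      rewrite (CInt_half_line_Cmult _ _ _ HB0); ring. }
  eapply Rle_lt_trans.
  - apply (CInt_half_line_cut _ _ (e * (1 + rho) ^ K) rho HG); [lra|].
    intros r Hr; replace (F p r + - (1) * F p0 r) with (F p r - F p0 r) by ring.
    eapply Rle_trans; [apply HpK; lra|].
    apply Rmult_le_compat_l; [lra|]; apply pow_incr; lra.
  - replace (e * (1 + rho) ^ K * rho)%R with (eps / 4)%R by (unfold e; field; repeat split; apply Rgt_not_eq; lra).
    assert ((B + B) / (1 + rho) <= eps / 2)%R; [|lra].
    apply Rmult_le_reg_r with (1 + rho)%R; [lra|].
    unfold Rdiv at 1; rewrite Rmult_assoc, Rinv_l, Rmult_1_r by lra.
    assert (E : (4 * B / eps * eps = 4 * B)%R) by (field; lra).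
    unfold rho; nra.
Qed.

Definition closed_quadrant (p : R * R) : Prop := (0 <= fst p)%R /\ (0 <= snd p)%R.

(** The amplitude may depend on [t], as is needed for weights [t^p] and for transforms over the time
    interval from 0 to [t]. Domination is asked of the product with [Ek], so the amplitude alone may
    grow. *)
Lemma Ek_integral_continuous_on (kappa : C) (D : R * R -> Prop) (a : R -> R -> C) :
  ray kappa -> (forall p, D p -> closed_quadrant p) ->
  (forall t, (0 <= t)%R -> hcont (a t)) ->
  (forall p0, D p0 -> exists B N A,
     near D p0 (fun p => forall r, (0 <= r)%R ->
       (Cmod (Ek kappa (fst p) (snd p) r) * Cmod (a (snd p) r) * (1 + r) ^ 2 <= B)%R) /\
     (forall r, (0 <= r)%R -> (Cmod (a (snd p0) r) <= A * (1 + r) ^ N)%R) /\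
     forall e, (0 < e)%R -> near D p0 (fun p => forall r, (0 <= r)%R ->
        (Cmod (a (snd p) r - a (snd p0) r) <= e * (1 + r) ^ N)%R)) ->
  cont_on D (fun p => CInt_half_line (fun r => Ek kappa (fst p) (snd p) r * a (snd p) r)).
Proof.
  intros Hk HD Hc H.
  apply CInt_half_line_continuous_on with
    (F := fun p r => Ek kappa (fst p) (snd p) r * a (snd p) r).
  intros p0 Hp0; destruct (H p0 Hp0) as (B & N & A & HB & HA & He).
  (* The two extra powers of [1 + r] pay for [Ek_lipschitz], whose constant grows quadratically in
     [r]. *)
  exists B, (2 + N)%nat; split.
  - revert HB; apply near_imp; intros p Hp HpB; split.
    + apply hcont_mult; [apply hcont_Ek|apply Hc, HD, Hp].
    + intros r Hr; rewrite Cmod_mult; apply HpB, Hr.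
  - intros e He0.
    assert (HA0 : (0 <= A)%R).
    { specialize (HA 0%R (Rle_refl _)); rewrite Rplus_0_r, pow1, Rmult_1_r in HA.
      eapply Rle_trans; [apply Cmod_ge_0|exact HA]. }
    set (d := (e / (8 * (A + 1)))%R).
    assert (Hd : (0 < d)%R) by (apply Rdiv_lt_0_compat; lra).
    assert (Hd' : (d * (8 * (A + 1)) = e)%R) by (unfold d; field; lra).
    assert (HE : near D p0 (fun p => (Rabs (fst p - fst p0) < d /\ Rabs (snd p - snd p0) < d)%R))
      by (apply near_of_box with (d := d); [assumption|]; cbn; auto).
    generalize (near_and _ _ _ _ HE (He (e / 2)%R ltac:(lra))); apply near_imp.
    intros p Hp [[H1 H2] H3] r Hr.
    destruct (HD p Hp), (HD p0 Hp0).
    replace (Ek kappa (fst p) (snd p) r * a (snd p) r - Ek kappa (fst p0) (snd p0) r * a (snd p0) r)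
      with (Ek kappa (fst p) (snd p) r * (a (snd p) r - a (snd p0) r) +
            (Ek kappa (fst p) (snd p) r - Ek kappa (fst p0) (snd p0) r) * a (snd p0) r) by ring.
    eapply Rle_trans; [apply Cmod_triangle|]; rewrite !Cmod_mult, pow_add.
    pose proof (Cmod_Ek_le_1 kappa (fst p) (snd p) r Hk ltac:(assumption) ltac:(assumption) Hr) as E1.
    pose proof (Ek_lipschitz kappa (fst p) (snd p) (fst p0) (snd p0) r Hk ltac:(assumption)
      ltac:(assumption) ltac:(assumption) ltac:(assumption) Hr) as E2.
    specialize (HA r Hr); specialize (H3 r Hr).
    pose proof (pow_1_le r 2 Hr) as P2; pose proof (pow_1_le r N Hr) as PN.
    apply Rle_trans with (1 * (e / 2 * (1 + r) ^ N) + (4 * d * (1 + r) ^ 2) * (A * (1 + r) ^ N))%R.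
    + apply Rplus_le_compat; apply Rmult_le_compat; auto using Cmod_ge_0.
      eapply Rle_trans; [exact E2|]. apply Rmult_le_compat_r; lra.
    + assert (0 <= e * (1 + r) ^ N)%R by nra.
      assert (e / 2 * (1 + r) ^ N <= e / 2 * ((1 + r) ^ 2 * (1 + r) ^ N))%R.
      { apply Rmult_le_compat_l; [lra|]. nra. }
      assert (4 * d * A <= e / 2)%R by nra.
      assert (0 <= (1 + r) ^ 2 * (1 + r) ^ N)%R by nra.
      nra.
Qed.

Lemma rate_near (kappa : C) (x t x0 t0 d : R) :
  ray kappa -> (Rabs (x - x0) <= d)%R -> (Rabs (t - t0) <= d)%R ->
  (rate kappa x0 t0 - 2 * d <= rate kappa x t)%R.
Proof.
  intros Hk Hx Ht; unfold rate.
  destruct (ray_Re kappa Hk) as [H1 H2]; destruct Hk as (_ & H3 & H4).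
  apply Rabs_le_between in Hx; apply Rabs_le_between in Ht. nra.
Qed.

(** The order of quantifiers is the point: one [B] serves all times up to [T] and all points with
    rate at least [q], which gives domination locally uniform in [x] and [t]. *)
Lemma Ek_rate_bound (kappa : C) (N : nat) (A T q : R) :
  ray kappa -> (0 < q)%R -> exists B, forall x t r a,
    (0 <= x)%R -> (0 <= t <= T)%R -> (q <= rate kappa x t)%R -> (0 <= r)%R ->
    (Cmod a <= A * (1 + r) ^ N)%R -> (Cmod (Ek kappa x t r) * Cmod a * (1 + r) ^ 2 <= B)%R.
Proof.
  intros Hk Hq; destruct (pow_exp_bound (2 + N) q Hq) as (B & HB0 & HB).
  exists (exp T * Rabs A * B)%R; intros x t r a Hx Ht Hrate Hr Ha.
  specialize (HB r Hr); rewrite pow_add in HB.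
  pose proof (Cmod_Ek_decay kappa x t r Hk Hx (proj1 Ht) Hr) as E.
  assert (E' : (Cmod (Ek kappa x t r) <= exp T * exp (- (q * r)))%R).
  { eapply Rle_trans; [exact E|].
    apply Rmult_le_compat; try (left; apply exp_pos); apply exp_le; nra. }
  pose proof (pow_1_le r N Hr); pose proof (pow_1_le r 2 Hr); pose proof (Rle_abs A).
  assert (Ha' : (Cmod a <= Rabs A * (1 + r) ^ N)%R) by nra.
  apply Rle_trans with ((exp T * exp (- (q * r))) * (Rabs A * (1 + r) ^ N) * (1 + r) ^ 2)%R.
  - apply Rmult_le_compat_r; [lra|]; apply Rmult_le_compat; auto using Cmod_ge_0.
  - replace (exp T * exp (- (q * r)) * (Rabs A * (1 + r) ^ N) * (1 + r) ^ 2)%R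
      with (exp T * Rabs A * ((1 + r) ^ 2 * (1 + r) ^ N * exp (- (q * r))))%R by ring.
    apply Rmult_le_compat_l; [|assumption].
    apply Rmult_le_pos; [left; apply exp_pos|apply Rabs_pos].
Qed.

Lemma Ek_dominated (kappa : C) (a : R -> C) (N : nat) (A x t : R) :
  ray kappa -> poly_growth a N A -> (0 <= x)%R -> (0 <= t)%R -> (0 < rate kappa x t)%R ->
  exists B, dominated (fun r => Ek kappa x t r * a r) B.
Proof.
  intros Hk [Ha1 Ha2] Hx Ht Hr.
  destruct (Ek_rate_bound kappa N A t (rate kappa x t) Hk Hr) as [B HB].
  exists B; split; [apply hcont_mult; [apply hcont_Ek|assumption]|].
  intros r Hr0; rewrite Cmod_mult; apply HB; auto; lra.
Qed.

Definition J (kappa : C) (a : R -> C) (x t : R) : C :=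
  CInt_half_line (fun r => Ek kappa x t r * a r).

Lemma J_plus (kappa : C) (a b : R -> C) (M N : nat) (A B x t : R) :
  ray kappa -> poly_growth a M A -> poly_growth b N B ->
  (0 <= x)%R -> (0 <= t)%R -> (0 < rate kappa x t)%R ->
  J kappa (fun r => a r + b r) x t = J kappa a x t + J kappa b x t.
Proof.
  intros Hk Ha Hb Hx Ht Hr; unfold J.
  destruct (Ek_dominated kappa a M A x t) as [A' HA']; auto.
  destruct (Ek_dominated kappa b N B x t) as [B' HB']; auto.
  rewrite <- (CInt_half_line_plus _ _ A' B') by assumption.
  f_equal; apply functional_extensionality; intros r; ring.
Qed.

Lemma J_Cmult (kappa c : C) (a : R -> C) (N : nat) (A x t : R) :
  ray kappa -> poly_growth a N A -> (0 <= x)%R -> (0 <= t)%R -> (0 < rate kappa x t)%R ->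
  J kappa (fun r => c * a r) x t = c * J kappa a x t.
Proof.
  intros Hk Ha Hx Ht Hr; unfold J.
  destruct (Ek_dominated kappa a N A x t) as [A' HA']; auto.
  rewrite <- (CInt_half_line_Cmult _ c A') by assumption.
  f_equal; apply functional_extensionality; intros r; ring.
Qed.

(** This is the integral of the derivative of [Ek a] along the ray. Solved for the first term it
    gives division by [t], solved for the second it gives division by [x]. *)
Lemma J_by_parts (kappa : C) (a a' : R -> C) (M N : nat) (A B x t : R) :
  ray kappa -> poly_growth a M A -> poly_growth a' N B ->
  (forall r, (0 < r)%R -> cder a r (a' r)) ->
  (0 <= x)%R -> (0 <= t)%R -> (0 < rate kappa x t)%R ->
  2 * (kappa * kappa) * RtoC t * J kappa (fun r => RtoC r * a r) x t
    - kappa * RtoC x * J kappa a x t + J kappa a' x t = - a 0%R.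
Proof.
  intros Hk Ha Ha' Hd Hx Ht Hr.
  assert (Hra : poly_growth (fun r => RtoC r * a r) (1 + M) (1 * A)).
  { apply (poly_growth_mul (fun r => RtoC r)); [|assumption].
    split; [apply hcont_id|]; intros r Hr0; rewrite Cmod_R, Rabs_pos_eq by assumption; lra. }
  destruct (Ek_dominated kappa a M A x t) as [BA HA]; auto.
  destruct (Ek_dominated kappa _ _ _ x t Hk Hra) as [BR HR]; auto.
  destruct (Ek_dominated kappa a' N B x t) as [BA' HA']; auto.
  unfold J.
  set (c1 := 2 * (kappa * kappa) * RtoC t); set (c2 := - (kappa * RtoC x)).
  assert (HG := dominated_plus _ _ _ _ (dominated_plus _ _ _ _ (dominated_Cmult _ c1 _ HR)
    (dominated_Cmult _ c2 _ HA)) HA').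
  transitivity (CInt_half_line (fun r => c1 * (Ek kappa x t r * (RtoC r * a r))
    + c2 * (Ek kappa x t r * a r) + Ek kappa x t r * a' r)).
  - rewrite (CInt_half_line_plus _ _ _ _ (dominated_plus _ _ _ _ (dominated_Cmult _ c1 _ HR)
      (dominated_Cmult _ c2 _ HA)) HA').
    rewrite (CInt_half_line_plus _ _ _ _ (dominated_Cmult _ c1 _ HR) (dominated_Cmult _ c2 _ HA)).
    rewrite (CInt_half_line_Cmult _ c1 _ HR), (CInt_half_line_Cmult _ c2 _ HA); unfold c2; ring.
  - replace (- a 0%R) with (- (Ek kappa x t 0 * a 0%R)).
    2:{ unfold Ek; replace (kappa * kappa * RtoC (t * 0 ^ 2) - kappa * RtoC (x * 0)) with (RtoC 0).
        - rewrite Cexp_0; ring.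
        - replace (t * 0 ^ 2)%R with 0%R by ring; rewrite Rmult_0_r; ring. }
    refine (CInt_half_line_FTC (fun r => Ek kappa x t r * a r) _ BA _ _ _ _ HG).
    + apply hcont_mult; [apply hcont_Ek|apply Ha].
    + intros r Hr0; eapply cder_eq; [apply cder_mult; [apply cder_Ek_r|apply Hd, Hr0]|].
      unfold c1, c2; cbv beta; ring.
    + intros r Hr0; destruct HA as [_ HA]; specialize (HA r Hr0).
      pose proof (Cmod_ge_0 (Ek kappa x t r * a r)). nra.
Qed.

Lemma J_continuous_on (kappa : C) (a : R -> C) (N : nat) (A : R) (D : R * R -> Prop) :
  ray kappa -> poly_growth a N A ->
  (forall p, D p -> closed_quadrant p /\ (0 < rate kappa (fst p) (snd p))%R) ->
  cont_on D (fun p => J kappa a (fst p) (snd p)).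
Proof.
  intros Hk Ha HD; unfold J.
  apply Ek_integral_continuous_on with (a := fun _ => a); auto.
  - intros p Hp; now apply HD.
  - intros; apply Ha.
  - intros [x0 t0] Hp0; destruct (HD _ Hp0) as [[Hx0 Ht0] Hr0]; cbn in Hx0, Ht0, Hr0.
    destruct (Ek_rate_bound kappa N A (t0 + 1) (rate kappa x0 t0 / 2) Hk) as [B HB]; [lra|].
    exists B, N, A; split; [|split].
    (* A displacement [d] of both coordinates costs at most [2 d] of the rate, so a quarter of the
       rate leaves at least half of it. *)
    + apply near_of_box with (d := Rmin 1 (rate kappa x0 t0 / 4)); [apply Rmin_pos; lra|].
      cbn; intros x t Hp H1 H2 r Hr; destruct (HD _ Hp) as [[Hx Ht] _]; cbn in Hx, Ht.
      pose proof (Rmin_l 1 (rate kappa x0 t0 / 4)); pose proof (Rmin_r 1 (rate kappa x0 t0 / 4)).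
      apply HB; auto.
      * apply Rabs_def2 in H2; lra.
      * pose proof (rate_near kappa x t x0 t0 (rate kappa x0 t0 / 4) Hk); lra.
      * now apply Ha.
    + intros; now apply Ha.
    + intros e He; apply near_forall; intros p _ r Hr.
      replace (a r - a r) with (RtoC 0) by ring; rewrite Cmod_0.
      pose proof (pow_1_le r N Hr); nra.
Qed.

Lemma cder_J_x (kappa : C) (a : R -> C) (N : nat) (A x t : R) :
  ray kappa -> poly_growth a N A -> (0 < x)%R -> (0 <= t)%R -> (0 < rate kappa x t)%R ->
  cder (fun x => J kappa a x t) x (J kappa (fun r => - (kappa * RtoC r) * a r) x t).
Proof.
  intros Hk Ha Hx Ht Hr; unfold J.
  assert (Hkr : poly_growth (fun r => - kappa * RtoC r) 1 1)
    by (apply poly_growth_r; rewrite Cmod_opp; apply Hk).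
  assert (Ha1 := poly_growth_mul _ _ _ _ _ _ Hkr Ha).
  assert (Ha2 := poly_growth_mul _ _ _ _ _ _ Hkr Ha1).
  destruct (Ek_rate_bound kappa (1 + (1 + N)) (1 * (1 * A)) t (rate kappa x t / 2) Hk) as [B HB]; [lra|].
  set (d := Rmin (x / 2) (rate kappa x t / 4)).
  assert (Hd : (0 < d)%R) by (apply Rmin_pos; lra).
  assert (Hd1 : (d <= x / 2)%R) by apply Rmin_l.
  assert (Hd2 : (d <= rate kappa x t / 4)%R) by apply Rmin_r.
  assert (Hs : forall s, (Rabs (s - x) < d)%R -> (0 <= s /\ rate kappa x t / 2 <= rate kappa s t)%R).
  { intros s Hs; pose proof (rate_near kappa s t x t (rate kappa x t / 4) Hk) as Hn.
    rewrite Rminus_diag, Rabs_R0 in Hn.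
    specialize (Hn ltac:(lra) ltac:(lra)); apply Rabs_def2 in Hs; lra. }
  assert (E1 : forall s, (fun r => Ek kappa s t r * (- (kappa * RtoC r) * a r)) =
    (fun r => Ek kappa s t r * (- kappa * RtoC r * a r)))
    by (intros s; apply functional_extensionality; intros r; ring).
  apply cder_CInt_half_line with (d := d) (M := B)
    (F := fun x r => Ek kappa x t r * a r)
    (F1 := fun x r => Ek kappa x t r * (- (kappa * RtoC r) * a r))
    (F2 := fun x r => Ek kappa x t r * (- kappa * RtoC r * (- kappa * RtoC r * a r))).
  - assumption.
  - intros s Hsd; destruct (Hs s Hsd); eapply Ek_dominated; eauto; lra.
  - rewrite E1; eapply Ek_dominated; eauto; lra.
  - intros s r Hsd Hr0; eapply cder_eq; [apply cder_mult; [apply cder_Ek_x|apply cder_const]|].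
    cbv beta; ring.
  - intros s r Hsd Hr0; eapply cder_eq; [apply cder_mult; [apply cder_Ek_x|apply cder_const]|].
    cbv beta; ring.
  - intros s r Hsd Hr0; rewrite Cmod_mult; destruct (Hs s Hsd); apply HB; auto; [lra|].
    apply Ha2; assumption.
Qed.

Lemma cder_J_t (kappa : C) (a : R -> C) (N : nat) (A x t : R) :
  ray kappa -> poly_growth a N A -> (0 <= x)%R -> (0 < t)%R -> (0 < rate kappa x t)%R ->
  cder (fun t => J kappa a x t) t (J kappa (fun r => (kappa * RtoC r) ^ 2 * a r) x t).
Proof.
  intros Hk Ha Hx Ht Hr; unfold J.
  assert (Ha1 := poly_growth_mul _ _ _ _ _ _ (poly_growth_pow kappa 2 (proj1 Hk)) Ha).
  assert (Ha2 := poly_growth_mul _ _ _ _ _ _ (poly_growth_pow kappa 2 (proj1 Hk)) Ha1).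
  destruct (Ek_rate_bound kappa (2 + (2 + N)) (1 * (1 * A)) (2 * t) (rate kappa x t / 2) Hk) as [B HB]; [lra|].
  set (d := Rmin (t / 2) (rate kappa x t / 4)).
  assert (Hd : (0 < d)%R) by (apply Rmin_pos; lra).
  assert (Hd1 : (d <= t / 2)%R) by apply Rmin_l.
  assert (Hd2 : (d <= rate kappa x t / 4)%R) by apply Rmin_r.
  assert (Hs : forall s, (Rabs (s - t) < d)%R ->
    (0 <= s <= 2 * t /\ rate kappa x t / 2 <= rate kappa x s)%R).
  { intros s Hs; pose proof (rate_near kappa x s x t (rate kappa x t / 4) Hk) as Hn.
    rewrite Rminus_diag, Rabs_R0 in Hn.
    specialize (Hn ltac:(lra) ltac:(lra)); apply Rabs_def2 in Hs; lra. }
  apply cder_CInt_half_line with (d := d) (M := B)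
    (F := fun t r => Ek kappa x t r * a r)
    (F1 := fun t r => Ek kappa x t r * ((kappa * RtoC r) ^ 2 * a r))
    (F2 := fun t r => Ek kappa x t r * ((kappa * RtoC r) ^ 2 * ((kappa * RtoC r) ^ 2 * a r))).
  - assumption.
  - intros s Hsd; destruct (Hs s Hsd); eapply Ek_dominated; eauto; lra.
  - eapply Ek_dominated; eauto; lra.
  - intros s r Hsd Hr0; eapply cder_eq; [apply cder_mult; [apply cder_Ek_t|apply cder_const]|].
    cbv beta; ring.
  - intros s r Hsd Hr0; eapply cder_eq; [apply cder_mult; [apply cder_Ek_t|apply cder_const]|].
    cbv beta; ring.
  - intros s r Hsd Hr0; rewrite Cmod_mult; destruct (Hs s Hsd); apply HB; auto.
    apply Ha2; assumption.
Qed.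

(** ** Extension to the boundary *)

(** Agreement is demanded in the open quadrant only. On the boundary the extension decides the
    value, since the integral defining [f] may diverge there. *)
Definition extends_to (D : R * R -> Prop) (f : R -> R -> C) : Prop :=
  exists U : R * R -> C, cont_on D U /\
    forall x t, (0 < x)%R -> (0 < t)%R -> U (x, t) = f x t.

(** This set and the next one cover the punctured quadrant; each contains one of the two edges
    without the corner. *)
Definition t_positive (p : R * R) : Prop := (0 <= fst p)%R /\ (0 < snd p)%R.
Definition x_positive (p : R * R) : Prop := (0 < fst p)%R /\ (0 <= snd p)%R.

Lemma extends_to_eq (D : R * R -> Prop) (f g : R -> R -> C) :
  (forall x t, (0 < x)%R -> (0 < t)%R -> g x t = f x t) -> extends_to D f -> extends_to D g.
Proof. intros E (U & H1 & H2); exists U; split; [assumption|]; intros; rewrite E; auto. Qed.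

Lemma extends_to_plus (D : R * R -> Prop) (f g : R -> R -> C) :
  extends_to D f -> extends_to D g -> extends_to D (fun x t => f x t + g x t).
Proof.
  intros (U & H1 & H2) (V & H3 & H4); exists (fun p => U p + V p); split.
  - now apply continuous_on_Cplus.
  - intros; rewrite H2, H4; auto.
Qed.

Lemma extends_to_mult (D : R * R -> Prop) (f g : R -> R -> C) :
  extends_to D f -> extends_to D g -> extends_to D (fun x t => f x t * g x t).
Proof.
  intros (U & H1 & H2) (V & H3 & H4); exists (fun p => U p * V p); split.
  - now apply continuous_on_Cmult.
  - intros; rewrite H2, H4; auto.
Qed.

Lemma extends_to_Cmult (D : R * R -> Prop) (c : C) (f : R -> R -> C) :
  extends_to D f -> extends_to D (fun x t => c * f x t).
Proof.
  intros (U & H1 & H2); exists (fun p => c * U p); split.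
  - apply continuous_on_Cmult; [apply continuous_on_const_C|assumption].
  - intros; rewrite H2; auto.
Qed.

Lemma extends_to_const (D : R * R -> Prop) (c : C) : extends_to D (fun _ _ => c).
Proof. exists (fun _ => c); split; [apply continuous_on_const_C|reflexivity]. Qed.

Lemma extends_to_x (D : R * R -> Prop) (g : R -> C) :
  (forall p, D p -> closed_quadrant p) -> hcont g -> extends_to D (fun x _ => g x).
Proof.
  intros HD Hg; exists (fun p => g (fst p)); split; [|reflexivity].
  apply continuous_on_C; intros p Hp eps He.
  destruct (proj1 (hcont_iff g) Hg (fst p) (proj1 (HD p Hp)) eps He) as (d & Hd & H).
  apply near_of_box with (d := d); [assumption|]; cbn; intros x t Hxt H1 _.
  apply H; [|assumption]. apply (HD _ Hxt).
Qed.

Lemma extends_to_t (D : R * R -> Prop) (g : R -> C) :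
  (forall p, D p -> closed_quadrant p) -> hcont g -> extends_to D (fun _ t => g t).
Proof.
  intros HD Hg; exists (fun p => g (snd p)); split; [|reflexivity].
  apply continuous_on_C; intros p Hp eps He.
  destruct (proj1 (hcont_iff g) Hg (snd p) (proj2 (HD p Hp)) eps He) as (d & Hd & H).
  apply near_of_box with (d := d); [assumption|]; cbn; intros x t Hxt _ H1.
  apply H; [|assumption]. apply (HD _ Hxt).
Qed.

Lemma t_positive_closed (p : R * R) : t_positive p -> closed_quadrant p.
Proof. unfold t_positive, closed_quadrant; lra. Qed.

Lemma x_positive_closed (p : R * R) : x_positive p -> closed_quadrant p.
Proof. unfold x_positive, closed_quadrant; lra. Qed.

Lemma punctured_closed (p : R * R) : punctured_quadrant p -> closed_quadrant p.
Proof. intros (H1 & H2 & _); split; assumption. Qed.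

Lemma extends_to_inv_x (c : C) : c <> 0 -> extends_to x_positive (fun x _ => / (c * RtoC x)).
Proof.
  intros Hc; exists (fun p => / (c * RtoC (fst p))); split; [|reflexivity].
  apply continuous_on_Cinv.
  - intros p Hp; apply Cmult_neq_0; [assumption|].
    intro E0; apply RtoC_inj in E0; destruct Hp; lra.
  - apply continuous_on_Cmult; [apply continuous_on_const_C|].
    apply continuous_on_C; intros p Hp eps He; apply near_of_box with (d := eps); [assumption|].
    cbn; intros x t _ H1 _; rewrite <- RtoC_minus, Cmod_R; assumption.
Qed.

Lemma extends_to_inv_t (c : C) : c <> 0 -> extends_to t_positive (fun _ t => / (c * RtoC t)).
Proof.
  intros Hc; exists (fun p => / (c * RtoC (snd p))); split; [|reflexivity].
  apply continuous_on_Cinv.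
  - intros p Hp; apply Cmult_neq_0; [assumption|].
    intro E0; apply RtoC_inj in E0; destruct Hp; lra.
  - apply continuous_on_Cmult; [apply continuous_on_const_C|].
    apply continuous_on_C; intros p Hp eps He; apply near_of_box with (d := eps); [assumption|].
    cbn; intros x t _ _ H1; rewrite <- RtoC_minus, Cmod_R; assumption.
Qed.

(** The two domains are relatively open and meet exactly in the open quadrant, where both extensions
    equal [f]. They therefore agree on the overlap, and continuity is local. *)
Lemma extends_to_glue (f : R -> R -> C) :
  extends_to t_positive f -> extends_to x_positive f -> extends_to punctured_quadrant f.
Proof.
  intros (U & HU & EU) (V & HV & EV).
  set (W := fun p : R * R => if Rlt_dec 0 (fst p) then V p else U p).
  assert (WV : forall p, x_positive p -> W p = V p).
  { intros p [Hp _]; unfold W; destruct Rlt_dec; [reflexivity|contradiction]. }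
  assert (WU : forall p, t_positive p -> W p = U p).
  { intros [x t] [_ Ht]; unfold W; destruct Rlt_dec as [Hx|]; [|reflexivity].
    cbn in Hx, Ht; rewrite EU, EV; auto. }
  exists W; split.
  - apply continuous_on_C; intros [x0 t0] (H1 & H2 & H3) eps He; cbn [fst snd] in H1, H2.
    destruct (Rlt_dec 0 x0) as [Hx0|Hx0].
    + assert (H0 : x_positive (x0, t0)) by (split; assumption).
      destruct (proj1 (continuous_on_C _ _) HV (x0, t0) H0 eps He) as [d Hd].
      apply near_of_box with (d := Rmin d x0); [apply Rmin_pos; [apply cond_pos|assumption]|].
      cbn; intros x t (Px & Pt & _) Hx Ht; cbn in Px, Pt.
      pose proof (Rmin_l d x0) as M1; pose proof (Rmin_r d x0).
      assert (Hxx : (0 < x)%R) by (apply Rabs_def2 in Hx; lra).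
      assert (Hxt : x_positive (x, t)) by (split; assumption).
      rewrite !WV by assumption.
      apply (Hd (x, t)); [split; [exact (Rlt_le_trans _ _ _ Hx M1)|exact (Rlt_le_trans _ _ _ Ht M1)]|].
      assumption.
    + assert (Ht0 : (0 < t0)%R).
      { destruct H2 as [H2|<-]; [assumption|]; exfalso; apply H3; f_equal; lra. }
      assert (H0 : t_positive (x0, t0)) by (split; assumption).
      destruct (proj1 (continuous_on_C _ _) HU (x0, t0) H0 eps He) as [d Hd].
      apply near_of_box with (d := Rmin d t0); [apply Rmin_pos; [apply cond_pos|assumption]|].
      cbn; intros x t (Px & Pt & _) Hx Ht; cbn in Px, Pt.
      pose proof (Rmin_l d t0) as M1; pose proof (Rmin_r d t0).
      assert (Htt : (0 < t)%R) by (apply Rabs_def2 in Ht; lra).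
      assert (Hxt : t_positive (x, t)) by (split; assumption).
      rewrite !WU by assumption.
      apply (Hd (x, t)); [split; [exact (Rlt_le_trans _ _ _ Hx M1)|exact (Rlt_le_trans _ _ _ Ht M1)]|].
      assumption.
  - intros x t Hx Ht; rewrite WV; [now apply EV|split; cbn; lra].
Qed.

(** * Ray integrals of symbols up to both edges *)

(** Because [Ek] is bounded by 1, order -2 is integrable uniformly in the closed quadrant, even at
    the corner. This ends the induction on the order for slanted rays. *)
Lemma J_order_minus_2 (kappa : C) (a : R -> C) (N m : nat) (D : R * R -> Prop) :
  ray kappa -> symbol 0 N m a -> (N + 2 <= m)%nat ->
  (forall p, D p -> closed_quadrant p) ->
  cont_on D (fun p => J kappa a (fst p) (snd p)).
Proof.
  intros Hk Ha Hm HD; destruct (symbol_poly_growth _ _ _ _ Ha) as [A HA].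
  destruct (symbol_bound _ _ _ _ Ha) as [B HB].
  unfold J; apply Ek_integral_continuous_on with (a := fun _ => a); auto.
  - intros; apply HA.
  - intros p0 Hp0; exists (Rabs B), N, A; split; [|split].
    + apply near_forall; intros p Hp r Hr; destruct (HD p Hp).
      pose proof (Cmod_Ek_le_1 kappa (fst p) (snd p) r Hk ltac:(assumption) ltac:(assumption) Hr).
      specialize (HB r Hr).
      replace m with (2 + N + (m - 2 - N))%nat in HB by lia; rewrite !pow_add in HB.
      pose proof (pow_1_le r 2 Hr); pose proof (pow_1_le r N Hr); pose proof (pow_1_le r (m - 2 - N) Hr).
      pose proof (Cmod_ge_0 (a r)); pose proof (Cmod_ge_0 (Ek kappa (fst p) (snd p) r)).
      assert (E : (Cmod (a r) * (1 + r) ^ 2 <= Rabs B)%R).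
      { apply Rmult_le_reg_r with ((1 + r) ^ N)%R; [lra|].
        pose proof (Rle_abs B).
        assert (0 <= Cmod (a r) * (1 + r) ^ 2 * (1 + r) ^ N)%R
          by (repeat apply Rmult_le_pos; lra).
        nra. }
      assert (0 <= Cmod (a r) * (1 + r) ^ 2)%R by nra. nra.
    + intros; now apply HA.
    + intros e He; apply near_forall; intros p _ r Hr.
      replace (a r - a r) with (RtoC 0) by ring; rewrite Cmod_0.
      pose proof (pow_1_le r N Hr); nra.
Qed.

Lemma rate_pos_x (kappa : C) (x t : R) :
  ray kappa -> (0 < Re kappa)%R -> (0 < x)%R -> (0 <= t)%R -> (0 < rate kappa x t)%R.
Proof.
  intros (_ & _ & H2) H Hx Ht; unfold rate.
  assert (0 < Re kappa * x)%R by now apply Rmult_lt_0_compat.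
  assert (0 <= - Re (kappa * kappa) * t)%R by (apply Rmult_le_pos; lra). lra.
Qed.

Lemma rate_pos_t (kappa : C) (x t : R) :
  ray kappa -> (Re (kappa * kappa) < 0)%R -> (0 <= x)%R -> (0 < t)%R -> (0 < rate kappa x t)%R.
Proof.
  intros (_ & H2 & _) H Hx Ht; unfold rate.
  assert (0 < - Re (kappa * kappa) * t)%R by (apply Rmult_lt_0_compat; lra).
  assert (0 <= Re kappa * x)%R by now apply Rmult_le_pos. lra.
Qed.

Lemma ray_neq_0 (kappa : C) : ray kappa -> kappa <> 0.
Proof. intros (H & _) ->; rewrite Cmod_0 in H; lra. Qed.

(** With [b = a / (1 + kappa r)], so that [kappa r b = a - b], integrating [(Ek b)'] expresses
    [t * J a] by integrals of symbols of lower order. *)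
Lemma J_lower_order (kappa : C) (a b b' : R -> C) (L M N : nat) (A B B' x t : R) :
  ray kappa -> poly_growth a L A -> poly_growth b M B -> poly_growth b' N B' ->
  (forall r, (0 < r)%R -> cder b r (b' r)) ->
  (forall r, (0 < r)%R -> b r = / (1 + kappa * RtoC r) * a r) ->
  (0 <= x)%R -> (0 < t)%R -> (0 < rate kappa x t)%R ->
  J kappa a x t = J kappa b x t +
    / (2 * kappa * RtoC t) * (kappa * RtoC x * J kappa b x t + - (1) * J kappa b' x t + - b 0%R).
Proof.
  intros Hk Ha Hb Hb' Hd E Hx Ht Hr.
  assert (P := J_by_parts kappa b b' M N B B' x t Hk Hb Hb' Hd Hx (Rlt_le _ _ Ht) Hr).
  assert (Hnb : poly_growth (fun r => - (1) * b r) (0 + M) (1 * B)).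
  { apply (poly_growth_mul (fun _ => - (1))); [|assumption].
    split; [apply hcont_const|]; intros; rewrite Cmod_m1; cbn; lra. }
  assert (Hrb : poly_growth (fun r => RtoC r * b r) (1 + M) (1 * B)).
  { apply (poly_growth_mul (fun r => RtoC r)); [|assumption].
    split; [apply hcont_id|]; intros r Hr0; rewrite Cmod_R, Rabs_pos_eq by assumption; lra. }
  assert (E1 : kappa * J kappa (fun r => RtoC r * b r) x t = J kappa a x t + - (1) * J kappa b x t).
  { rewrite <- (J_Cmult kappa kappa _ _ _ x t Hk Hrb), <- (J_Cmult kappa _ b M B x t Hk Hb) by lra.
    rewrite <- (J_plus kappa a _ L _ A _ x t Hk Ha Hnb) by lra.
    assert (Hab : hcont (fun r => a r + - (1) * b r)) by (apply hcont_plus; [apply Ha|apply Hnb]).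
    destruct (Ek_dominated kappa _ _ _ x t Hk Ha) as [C1 HC1]; try lra.
    destruct (Ek_dominated kappa _ _ _ x t Hk Hnb) as [C2 HC2]; try lra.
    assert (HC := dominated_plus _ _ _ _ HC1 HC2).
    unfold J; rewrite (CInt_half_line_ext _ _ _ HC).
    - f_equal; apply functional_extensionality; intros r; ring.
    - intros r Hr0; rewrite (E r Hr0); field; apply ray_denominator_neq_0; [assumption|lra]. }
  assert (Ht0 : RtoC t <> 0) by (intro F; apply RtoC_inj in F; lra).
  assert (Hk0 := ray_neq_0 kappa Hk).
  assert (H2 : RtoC 2 <> 0) by (intro F; apply RtoC_inj in F; lra).
  replace (- b 0%R) with (2 * kappa * RtoC t * (J kappa a x t + - (1) * J kappa b x t)
    - kappa * RtoC x * J kappa b x t + J kappa b' x t).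
  - field; auto.
  - rewrite <- P, <- E1; ring.
Qed.

(** Each use of [J_lower_order] spends one derivative of the symbol and raises [m] by at least one,
    so [m + d] does not fall. When [d] reaches 0 the order is at most -2. The coefficients [x] and
    [1 / t] are continuous on [t_positive]. *)
Lemma J_extends_t_positive (kappa : C) (d N m : nat) (a : R -> C) :
  ray kappa -> (0 < Re kappa)%R -> symbol d N m a -> (N + 2 <= m + d)%nat ->
  extends_to t_positive (J kappa a).
Proof.
  intros Hk Hk0; revert m a.
  cut (forall d', (d' <= d)%nat -> forall m a, symbol d' N m a -> (N + 2 <= m + d')%nat ->
    extends_to t_positive (J kappa a)); [intros H m a; apply (H d (Nat.le_refl d))|].
  induction d' as [d' IH] using lt_wf_ind; intros Hd' m a Ha Hm.
  destruct d' as [|d'].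
  - exists (fun p => J kappa a (fst p) (snd p)); split; [|reflexivity].
    apply J_order_minus_2 with (N := N) (m := m); auto using t_positive_closed; lia.
  - assert (Hb := symbol_div _ _ _ kappa _ Hk Ha).
    set (b := fun r => / (1 + kappa * RtoC r) * a r) in Hb.
    destruct Hb as (Hb1 & Hb2 & b' & Hbd & Hb').
    assert (Hb : symbol d' N (S m) b).
    { apply symbol_div, symbol_pred; assumption. }
    destruct (symbol_poly_growth _ _ _ _ Ha) as [A PA].
    destruct (symbol_poly_growth _ _ _ _ Hb) as [B PB].
    destruct (symbol_poly_growth _ _ _ _ Hb') as [B' PB'].
    assert (Xb : extends_to t_positive (J kappa b)) by (apply (IH d') with (m := S m); [lia|lia|assumption|lia]).
    assert (Xb' : extends_to t_positive (J kappa b'))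
      by (apply (IH d') with (m := S (S m)); [lia|lia|assumption|lia]).
    apply extends_to_eq with (f := fun x t => J kappa b x t + / (2 * kappa * RtoC t) *
       (kappa * RtoC x * J kappa b x t + - (1) * J kappa b' x t + - b 0%R)).
    + intros x t Hx Ht; apply J_lower_order with (L := N) (M := N) (N := N) (A := A) (B := B) (B' := B');
        auto; try lra; apply rate_pos_x; auto; lra.
    + assert (Hk1 := ray_neq_0 kappa Hk).
      assert (H2 : RtoC 2 <> 0) by (intro F; apply RtoC_inj in F; lra).
      apply extends_to_plus; [assumption|].
      apply extends_to_mult; [apply extends_to_inv_t, Cmult_neq_0; assumption|].
      apply extends_to_plus; [|apply extends_to_const].
      apply extends_to_plus; [|now apply extends_to_Cmult].
      apply extends_to_mult; [|assumption].
      apply extends_to_Cmult, (extends_to_x _ _ t_positive_closed hcont_id).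
Qed.

(** Each factor [t] gains two orders of decay, since [t^p (1 + r)^(2p) |Ek|] is bounded. *)
Lemma Ek_t_pow_bound (kappa : C) (p : nat) (T : R) :
  ray kappa -> Re (kappa * kappa) = (-1)%R -> exists B, forall x t r,
    (0 <= x)%R -> (0 <= t <= T)%R -> (0 <= r)%R ->
    (t ^ p * (1 + r) ^ (2 * p) * Cmod (Ek kappa x t r) <= B)%R.
Proof.
  intros (_ & Hk & _) Hk2; exists (2 ^ p * INR (fact p) * exp T)%R; intros x t r Hx Ht Hr.
  assert (Hy : (0 <= t * (1 + r ^ 2))%R) by (apply Rmult_le_pos; nra).
  pose proof (pow_le_fact_exp p _ Hy) as HP.
  assert (E1 : (t ^ p * (1 + r) ^ (2 * p) <= 2 ^ p * (t * (1 + r ^ 2)) ^ p)%R).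
  { rewrite pow_mult, <- !Rpow_mult_distr; apply pow_incr; split.
    - apply Rmult_le_pos; [lra|apply pow2_ge_0].
    - replace (2 * (t * (1 + r ^ 2)))%R with (t * (2 * (1 + r ^ 2)))%R by ring.
      apply Rmult_le_compat_l; [lra|]. pose proof (pow2_ge_0 (1 - r)); nra. }
  assert (E2 : (Cmod (Ek kappa x t r) <= exp (- (t * r ^ 2)))%R).
  { rewrite Cmod_Ek, Hk2; apply exp_le. assert (0 <= Re kappa * (x * r))%R
      by (apply Rmult_le_pos; nra). lra. }
  assert (E3 : (exp (t * (1 + r ^ 2)) * exp (- (t * r ^ 2)) <= exp T)%R).
  { rewrite <- exp_plus; apply exp_le; lra. }
  pose proof (pos_INR (fact p)).
  assert (0 < 2 ^ p)%R by (apply pow_lt; lra).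
  assert (0 <= t ^ p * (1 + r) ^ (2 * p))%R by (apply Rmult_le_pos; apply pow_le; lra).
  eapply Rle_trans.
  - apply Rmult_le_compat; [assumption|apply Cmod_ge_0| |exact E2].
    eapply Rle_trans; [exact E1|apply Rmult_le_compat_l; [lra|exact HP]].
  - replace (2 ^ p * (INR (fact p) * exp (t * (1 + r ^ 2))) * exp (- (t * r ^ 2)))%R
      with (2 ^ p * INR (fact p) * (exp (t * (1 + r ^ 2)) * exp (- (t * r ^ 2))))%R by ring.
    apply Rmult_le_compat_l; [nra|assumption].
Qed.

(** The weight [t^p] stays inside the integral: at t = 0 the integral of [Ek a] alone need not
    converge, whereas the weighted integrand is dominated uniformly down to t = 0. *)
Lemma t_pow_J_continuous_on (kappa : C) (a : R -> C) (N m p : nat) :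
  ray kappa -> Re (kappa * kappa) = (-1)%R -> symbol 0 N m a -> (N + 2 <= m + 2 * p)%nat ->
  cont_on closed_quadrant
    (fun q => CInt_half_line (fun r => Ek kappa (fst q) (snd q) r * (RtoC (snd q) ^ p * a r))).
Proof.
  intros Hk Hk2 Ha Hm.
  destruct (symbol_poly_growth _ _ _ _ Ha) as [A HA].
  destruct (symbol_bound _ _ _ _ Ha) as [B HB].
  assert (HA0 := poly_growth_pos _ _ _ HA).
  apply Ek_integral_continuous_on with (a := fun t r => RtoC t ^ p * a r); auto.
  - intros t Ht; apply hcont_mult; [apply hcont_const|apply HA].
  - intros [x0 t0] [Hx0 Ht0]; cbn in Hx0, Ht0.
    destruct (Ek_t_pow_bound kappa p (t0 + 1) Hk Hk2) as [E HE].
    exists (E * Rabs B)%R, N, (t0 ^ p * A)%R; cbn [fst snd]; split; [|split].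
    + apply near_of_box with (d := 1%R); [lra|]; cbn [fst snd]; intros x t [Hx Ht] _ Htt r Hr.
      cbn in Hx, Ht; apply Rabs_def2 in Htt.
      specialize (HE x t r Hx ltac:(lra) Hr); specialize (HB r Hr).
      rewrite Cmod_mult, Cmod_pow, Cmod_R, Rabs_pos_eq by assumption.
      assert (HB' : (Cmod (a r) * (1 + r) ^ 2 <= Rabs B * (1 + r) ^ (2 * p))%R).
      { apply Rmult_le_reg_r with ((1 + r) ^ m)%R; [pose proof (pow_1_le r m Hr); lra|].
        replace (Cmod (a r) * (1 + r) ^ 2 * (1 + r) ^ m)%R
          with ((Cmod (a r) * (1 + r) ^ m) * (1 + r) ^ 2)%R by ring.
        apply Rle_trans with (Rabs B * (1 + r) ^ N * (1 + r) ^ 2)%R.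
        - apply Rmult_le_compat_r; [apply pow2_ge_0|].
          eapply Rle_trans; [exact HB|]; pose proof (Rle_abs B); pose proof (pow_1_le r N Hr); nra.
        - rewrite !Rmult_assoc, <- !pow_add; apply Rmult_le_compat_l; [apply Rabs_pos|].
          apply Rle_pow; [lra|lia]. }
      assert (Ht' : (0 <= t ^ p)%R) by now apply pow_le.
      replace (Cmod (Ek kappa x t r) * (t ^ p * Cmod (a r)) * (1 + r) ^ 2)%R
        with (t ^ p * Cmod (Ek kappa x t r) * (Cmod (a r) * (1 + r) ^ 2))%R by ring.
      apply Rle_trans with (t ^ p * Cmod (Ek kappa x t r) * (Rabs B * (1 + r) ^ (2 * p)))%R.
      * apply Rmult_le_compat_l; [apply Rmult_le_pos; auto using Cmod_ge_0|assumption].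
      * replace (t ^ p * Cmod (Ek kappa x t r) * (Rabs B * (1 + r) ^ (2 * p)))%R
          with ((t ^ p * (1 + r) ^ (2 * p) * Cmod (Ek kappa x t r)) * Rabs B)%R by ring.
        apply Rmult_le_compat_r; [apply Rabs_pos|assumption].
    + intros r Hr; rewrite Cmod_mult, Cmod_pow, Cmod_R, Rabs_pos_eq, Rmult_assoc by assumption.
      apply Rmult_le_compat_l; [now apply pow_le|now apply HA].
    + intros e He.
      assert (Hp : cont_on closed_quadrant (fun q => RtoC (snd q) ^ p)).
      { apply (continuous_on_pow_C closed_quadrant (fun q => RtoC (snd q))).
        apply continuous_on_C; intros q Hq eps Heps; apply near_of_box with (d := eps); [assumption|].
        cbn; intros x t _ _ H1; rewrite <- RtoC_minus, Cmod_R; assumption. }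
      assert (Hq : (0 < e / (A + 1))%R) by (apply Rdiv_lt_0_compat; lra).
      generalize (proj1 (continuous_on_C _ _) Hp (x0, t0) (conj Hx0 Ht0) _ Hq); apply near_imp.
      intros [x t] _; cbn [fst snd]; intros Htp r Hr.
      replace (RtoC t ^ p * a r - RtoC t0 ^ p * a r) with ((RtoC t ^ p - RtoC t0 ^ p) * a r) by ring.
      rewrite Cmod_mult.
      pose proof (proj2 HA r Hr); pose proof (pow_1_le r N Hr).
      assert (EA : (e / (A + 1) * (A + 1) = e)%R) by (field; lra).
      apply Rle_trans with (e / (A + 1) * (A * (1 + r) ^ N))%R.
      * apply Rmult_le_compat; auto using Cmod_ge_0; lra.
      * rewrite <- Rmult_assoc; apply Rmult_le_compat_r; [lra|]; nra.
Qed.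

(** Solving [J_by_parts] for [x J a] produces [t J (r a)] and [J a']. The first has order one higher
    but an extra [t], worth two orders; the second has order one lower. Both gain one order for one
    derivative spent, which is why [p] and [N] vary in the induction. *)
Lemma t_pow_J_extends_x_positive (kappa : C) (d p N m : nat) (a : R -> C) :
  ray kappa -> Re (kappa * kappa) = (-1)%R ->
  symbol d N m a -> (N + 2 <= m + 2 * p + d)%nat ->
  extends_to x_positive (fun x t => RtoC t ^ p * J kappa a x t).
Proof.
  intros Hk Hk2; revert p N m a; induction d as [|d IH]; intros p N m a Ha Hm.
  - eexists; split.
    + eapply continuous_on_subset; [exact x_positive_closed|].
      apply (t_pow_J_continuous_on kappa a N m p); auto; lia.
    + intros x t Hx Ht; cbn [fst snd].
      destruct (symbol_poly_growth _ _ _ _ Ha) as [A HA].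
      destruct (Ek_dominated kappa a N A x t Hk HA) as [B HB]; [lra|lra|apply rate_pos_t; auto; lra|].
      unfold J; rewrite <- (CInt_half_line_Cmult _ _ B HB).
      f_equal; apply functional_extensionality; intros r; ring.
  - pose proof Ha as (Ha1 & _ & a' & Had & Ha').
    assert (Hr := symbol_mul_r _ _ _ _ Ha).
    destruct (symbol_poly_growth _ _ _ _ Ha) as [A PA].
    destruct (symbol_poly_growth _ _ _ _ Ha') as [A' PA'].
    assert (X1 := IH (S p) (S N) m _ (symbol_pred _ _ _ _ Hr) ltac:(lia)).
    assert (X2 := IH p N (S m) _ Ha' ltac:(lia)).
    assert (Hk0 := ray_neq_0 kappa Hk).
    apply extends_to_eq with (f := fun x t => / (kappa * RtoC x) *
      (2 * (kappa * kappa) * (RtoC t ^ S p * J kappa (fun r => RtoC r * a r) x t) +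
       RtoC t ^ p * J kappa a' x t + a 0%R * RtoC t ^ p)).
    + intros x t Hx Ht.
      assert (P := J_by_parts kappa a a' N N A A' x t Hk PA PA' Had (Rlt_le _ _ Hx) (Rlt_le _ _ Ht)
        ltac:(apply rate_pos_t; auto; lra)).
      assert (Hx0 : RtoC x <> 0) by (intro F; apply RtoC_inj in F; lra).
      replace (a 0%R) with (- (2 * (kappa * kappa) * RtoC t * J kappa (fun r => RtoC r * a r) x t
        - kappa * RtoC x * J kappa a x t + J kappa a' x t)) by (rewrite P; ring).
      cbn [Cpow]; field; auto.
    + apply extends_to_mult; [now apply extends_to_inv_x|].
      apply extends_to_plus; [apply extends_to_plus; [now apply extends_to_Cmult|assumption]|].
      apply extends_to_Cmult, (extends_to_t _ (fun t => RtoC t ^ p) x_positive_closed).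
      exact (continuous_on_pow_C _ _ p hcont_id).
Qed.

Lemma J_extends_slanted (kappa : C) (a : R -> C) (N m : nat) :
  ray kappa -> (0 < Re kappa)%R -> (forall d, symbol d N m a) ->
  extends_to punctured_quadrant (J kappa a).
Proof.
  intros Hk Hk0 Ha; apply extends_to_glue.
  (* Whatever [m] is, [N + 2] integrations by parts bring the order down to -2. *)
  - apply J_extends_t_positive with (d := (N + 2)%nat) (N := N) (m := m); auto; lia.
  - exists (fun p => J kappa a (fst p) (snd p)); split; [|reflexivity].
    destruct (symbol_poly_growth _ _ _ _ (Ha 0%nat)) as [A PA].
    apply J_continuous_on with (N := N) (A := A); auto.
    intros p [H1 H2]; split; [split; lra|]; now apply rate_pos_x.
Qed.

Lemma J_extends_real (kappa : C) (a : R -> C) (N m : nat) :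
  ray kappa -> Re (kappa * kappa) = (-1)%R -> (forall d, symbol d N m a) ->
  extends_to punctured_quadrant (J kappa a).
Proof.
  intros Hk Hk0 Ha; apply extends_to_glue.
  - exists (fun p => J kappa a (fst p) (snd p)); split; [|reflexivity].
    destruct (symbol_poly_growth _ _ _ _ (Ha 0%nat)) as [A PA].
    apply J_continuous_on with (N := N) (A := A); auto.
    intros p [H1 H2]; split; [split; lra|]; apply rate_pos_t; auto; lra.
  - eapply extends_to_eq; [|apply (t_pow_J_extends_x_positive kappa (N + 2) 0 N m a Hk Hk0 (Ha _)); lia].
    intros x t _ _; symmetry; apply Cmult_1_l.
Qed.

(** ** Transforms of Schwartz functions are symbols *)

(** At [t = 0] the ray integral [J mu v x 0] is [u0_hat v (- i mu x)]. *)

Definition rapid_decay (v : R -> C) : Prop :=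
  hcont v /\ forall M, exists B, forall y, (0 <= y)%R -> (Cmod (v y) * (1 + y) ^ M <= B)%R.

(** [schwartz d j v]: [d] derivatives of [v] decay rapidly and [v] vanishes to order [j] at 0. *)
Fixpoint schwartz (d j : nat) (v : R -> C) : Prop :=
  rapid_decay v /\ ((0 < j)%nat -> v 0%R = 0) /\
  match d with
  | O => True
  | S d' => exists v', (forall y, (0 < y)%R -> cder v y (v' y)) /\ schwartz d' (pred j) v'
  end.

Lemma schwartz_rapid_decay (d j : nat) (v : R -> C) : schwartz d j v -> rapid_decay v.
Proof. destruct d; intros H; apply H. Qed.

Lemma schwartz_le (d e i j : nat) (v : R -> C) :
  (d <= e)%nat -> (i <= j)%nat -> schwartz e j v -> schwartz d i v.
Proof.
  revert e i j v; induction d as [|d IH]; intros e i j v Hde Hij Hv.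
  - destruct e; destruct Hv as (H1 & H2 & _); (split; [assumption|]); split; auto;
      intros; apply H2; lia.
  - destruct e as [|e]; [lia|].
    destruct Hv as (H1 & H2 & v' & H3 & H4); split; [assumption|]; split; [intros; apply H2; lia|].
    exists v'; split; [assumption|]; apply (IH e (pred i) (pred j)); [lia|lia|assumption].
Qed.

Lemma rapid_decay_plus (v w : R -> C) :
  rapid_decay v -> rapid_decay w -> rapid_decay (fun y => v y + w y).
Proof.
  intros [V1 V2] [W1 W2]; split; [now apply hcont_plus|]; intros M.
  destruct (V2 M) as [A HA], (W2 M) as [B HB]; exists (A + B)%R; intros y Hy.
  specialize (HA y Hy); specialize (HB y Hy).
  pose proof (Cmod_triangle (v y) (w y)); pose proof (pow_1_le y M Hy); nra.
Qed.

Lemma rapid_decay_mul (f v : R -> C) (N : nat) (A : R) :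
  poly_growth f N A -> rapid_decay v -> rapid_decay (fun y => f y * v y).
Proof.
  intros Hf [V1 V2]; assert (HA := poly_growth_pos _ _ _ Hf); destruct Hf as [F1 F2].
  split; [now apply hcont_mult|]; intros M.
  destruct (V2 (N + M)%nat) as [B HB]; exists (A * B)%R; intros y Hy.
  specialize (HB y Hy); specialize (F2 y Hy); rewrite pow_add in HB.
  rewrite Cmod_mult; pose proof (pow_1_le y M Hy); pose proof (Cmod_ge_0 (v y)).
  apply Rle_trans with (A * (1 + y) ^ N * (Cmod (v y) * (1 + y) ^ M))%R.
  - rewrite Rmult_assoc; apply Rmult_le_compat_r; [apply Rmult_le_pos; lra|assumption].
  - replace (A * (1 + y) ^ N * (Cmod (v y) * (1 + y) ^ M))%R
      with (A * (Cmod (v y) * ((1 + y) ^ N * (1 + y) ^ M)))%R by ring.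
    now apply Rmult_le_compat_l.
Qed.

Lemma schwartz_plus (d j : nat) (v w : R -> C) :
  schwartz d j v -> schwartz d j w -> schwartz d j (fun y => v y + w y).
Proof.
  revert j v w; induction d as [|d IH]; intros j v w (V1 & V2 & V3) (W1 & W2 & W3);
    (split; [now apply rapid_decay_plus|]);
    (split; [intros Hj; rewrite (V2 Hj), (W2 Hj); ring|]).
  - trivial.
  - destruct V3 as (v' & V3 & V4), W3 as (w' & W3 & W4).
    exists (fun y => v' y + w' y); split; [|now apply IH].
    intros y Hy; apply cder_plus; auto.
Qed.

Lemma schwartz_mul (d j : nat) (k : C) (v : R -> C) :
  Cmod k = 1%R -> schwartz d j v -> schwartz d (S j) (fun y => k * RtoC y * v y).
Proof.
  intros Hk; revert j v; induction d as [|d IH]; intros j v Hv; pose proof Hv as (V1 & V2 & V3);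
    (split; [exact (rapid_decay_mul _ _ _ _ (poly_growth_r k Hk) V1)|]);
    (split; [intros _; ring|]).
  - trivial.
  - destruct V3 as (v' & V3 & V4).
    assert (Hcv : forall e i w, schwartz e i w -> schwartz e i (fun y => k * w y)).
    { induction e as [|e IHe]; intros i w (W1 & W2 & W3);
        (split; [apply (rapid_decay_mul (fun _ => k) w 0 1); [|assumption];
                 split; [apply hcont_const|]; intros; rewrite Hk; cbn; lra|]);
        (split; [intros Hi; rewrite (W2 Hi); ring|]); [trivial|].
      destruct W3 as (w' & W3 & W4); exists (fun y => k * w' y); split; [|now apply IHe].
      intros y Hy; eapply cder_eq; [apply cder_mult; [apply cder_const|apply W3, Hy]|cbv beta; ring]. }
    exists (fun y => k * v y + k * RtoC y * v' y); split.
    + intros y Hy; eapply cder_eq.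
      * apply cder_mult; [apply cder_mult; [apply cder_const|apply cder_id]|apply V3, Hy].
      * cbv beta; ring.
    + apply schwartz_plus.
      * apply Hcv, (schwartz_le d (S d) j j); [lia|lia|assumption].
      (* For [j = 0] the truncated predecessor makes [S (pred j)] equal to 1, so vanishing to this
         order has to be weakened rather than rewritten. *)
      * apply (schwartz_le d d j (S (pred j))); [lia|lia|]; now apply IH.
Qed.

Lemma rapid_decay_dominated (mu : C) (v : R -> C) :
  ray mu -> rapid_decay v -> exists B, forall x, (0 <= x)%R ->
  dominated (fun y => Ek mu x 0 y * v y) B.
Proof.
  intros Hm [V1 V2]; destruct (V2 2%nat) as [B HB]; exists B; intros x Hx; split.
  - apply hcont_mult; [apply hcont_Ek|assumption].
  - intros y Hy; rewrite Cmod_mult.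
    pose proof (Cmod_Ek_le_1 mu x 0 y Hm Hx (Rle_refl _) Hy); specialize (HB y Hy).
    pose proof (Cmod_ge_0 (v y)); pose proof (pow_1_le y 2 Hy).
    assert (0 <= Cmod (v y) * (1 + y) ^ 2)%R by nra. nra.
Qed.

Lemma transform_hcont (mu : C) (v : R -> C) :
  ray mu -> rapid_decay v -> hcont (fun x => J mu v x 0).
Proof.
  intros Hm Hv; destruct (rapid_decay_dominated mu v Hm Hv) as [B HB].
  (* Two powers pay for the Lipschitz constant of [Ek], two for integrability. *)
  destruct Hv as [V1 V2]; destruct (V2 4%nat) as [A HA].
  apply hcont_lipschitz with (L := (2 * A)%R); intros r s Hr Hs; unfold J.
  assert (HD := dominated_plus _ _ _ _ (HB s Hs) (dominated_Cmult _ (- (1)) _ (HB r Hr))).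
  replace (CInt_half_line (fun y => Ek mu s 0 y * v y) - CInt_half_line (fun y => Ek mu r 0 y * v y))
    with (CInt_half_line (fun y => Ek mu s 0 y * v y + - (1) * (Ek mu r 0 y * v y))).
  - apply CInt_half_line_bound; split; [apply HD|]; intros y Hy.
    replace (Ek mu s 0 y * v y + - (1) * (Ek mu r 0 y * v y))
      with ((Ek mu s 0 y - Ek mu r 0 y) * v y) by ring.
    rewrite Cmod_mult.
    pose proof (Ek_lipschitz mu s 0 r 0 y Hm Hs (Rle_refl _) Hr (Rle_refl _) Hy) as HL.
    rewrite Rminus_diag, Rabs_R0, Rplus_0_r in HL.
    specialize (HA y Hy); change 4%nat with (2 + 2)%nat in HA; rewrite pow_add in HA.
    pose proof (Cmod_ge_0 (v y)); pose proof (pow_1_le y 2 Hy); pose proof (Rabs_pos (s - r)).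
    apply Rle_trans with (2 * Rabs (s - r) * (1 + y) ^ 2 * Cmod (v y) * (1 + y) ^ 2)%R.
    + apply Rmult_le_compat_r; [lra|]; now apply Rmult_le_compat_r.
    + replace (2 * Rabs (s - r) * (1 + y) ^ 2 * Cmod (v y) * (1 + y) ^ 2)%R
        with (2 * Rabs (s - r) * (Cmod (v y) * ((1 + y) ^ 2 * (1 + y) ^ 2)))%R by ring.
      replace (2 * A * Rabs (s - r))%R with (2 * Rabs (s - r) * A)%R by ring.
      apply Rmult_le_compat_l; lra.
  - rewrite (CInt_half_line_plus _ _ _ _ (HB s Hs) (dominated_Cmult _ (- (1)) _ (HB r Hr))).
    rewrite (CInt_half_line_Cmult _ _ _ (HB r Hr)); ring.
Qed.

Lemma transform_by_parts (mu : C) (v v' : R -> C) (x : R) :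
  ray mu -> rapid_decay v -> rapid_decay v' -> (forall y, (0 < y)%R -> cder v y (v' y)) ->
  (0 <= x)%R -> mu * RtoC x * J mu v x 0 = v 0%R + J mu v' x 0.
Proof.
  intros Hm Hv Hv' Hd Hx.
  destruct (rapid_decay_dominated mu v Hm Hv) as [B HB]; specialize (HB x Hx).
  destruct (rapid_decay_dominated mu v' Hm Hv') as [B' HB']; specialize (HB' x Hx).
  assert (HD := dominated_plus _ _ _ _ (dominated_Cmult _ (- (mu * RtoC x)) _ HB) HB').
  assert (E : CInt_half_line (fun y => - (mu * RtoC x) * (Ek mu x 0 y * v y) + Ek mu x 0 y * v' y)
    = - v 0%R).
  { replace (- v 0%R) with (- (Ek mu x 0 0 * v 0%R)).
    2:{ unfold Ek; replace (mu * mu * RtoC (0 * 0 ^ 2) - mu * RtoC (x * 0)) with (RtoC 0)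
          by (rewrite Rmult_0_r, Rmult_0_l; ring).
        rewrite Cexp_0; ring. }
    refine (CInt_half_line_FTC (fun y => Ek mu x 0 y * v y) _ B _ _ _ _ HD).
    - apply hcont_mult; [apply hcont_Ek|apply Hv].
    - intros y Hy; eapply cder_eq; [apply cder_mult; [apply cder_Ek_r|apply Hd, Hy]|].
      cbv beta; ring.
    - intros y Hy; destruct HB as [_ HB]; specialize (HB y Hy).
      pose proof (Cmod_ge_0 (Ek mu x 0 y * v y)); nra. }
  rewrite (CInt_half_line_plus _ _ _ _ (dominated_Cmult _ (- (mu * RtoC x)) _ HB) HB') in E.
  rewrite (CInt_half_line_Cmult _ _ _ HB) in E; fold (J mu v x 0) (J mu v' x 0) in E.
  replace (v 0%R) with (- - v 0%R) by ring; rewrite <- E; ring.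
Qed.

(** Vanishing to order [j] at 0 removes the boundary terms of the first [j] integrations by parts.
    One more is possible with a boundary term that is merely bounded, hence the exponent [S j]. *)
Lemma transform_decay (mu : C) (j : nat) (v : R -> C) :
  ray mu -> schwartz (S j) j v ->
  exists B, forall x, (0 <= x)%R -> (Cmod (J mu v x 0) * (1 + x) ^ S j <= B)%R.
Proof.
  intros Hm; revert v; induction j as [|j IH]; intros v Hv;
    pose proof Hv as (V1 & V2 & v' & V3 & V4);
    assert (V1' := schwartz_rapid_decay _ _ _ V4).
  - destruct (rapid_decay_dominated mu v Hm V1) as [B HB].
    destruct (rapid_decay_dominated mu v' Hm V1') as [B' HB'].
    exists (B + (Cmod (v 0%R) + B'))%R; intros x Hx.
    pose proof (CInt_half_line_bound _ _ (HB x Hx)) as K1; fold (J mu v x 0) in K1.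
    pose proof (CInt_half_line_bound _ _ (HB' x Hx)) as K2; fold (J mu v' x 0) in K2.
    pose proof (f_equal Cmod (transform_by_parts mu v v' x Hm V1 V1' V3 Hx)) as E.
    rewrite !Cmod_mult, (proj1 Hm), Cmod_R, Rabs_pos_eq in E by assumption.
    pose proof (Cmod_triangle (v 0%R) (J mu v' x 0)); rewrite pow_1; lra.
  - assert (Hv0 : v 0%R = 0) by (apply V2; lia).
    destruct (IH v') as [B' HB']; [exact V4|].
    destruct (IH v) as [B HB]; [apply (schwartz_le _ (S (S j)) _ (S j)); [lia|lia|assumption]|].
    exists (B + B')%R; intros x Hx; specialize (HB x Hx); specialize (HB' x Hx).
    pose proof (f_equal Cmod (transform_by_parts mu v v' x Hm V1 V1' V3 Hx)) as E.
    rewrite Hv0, Cplus_0_l, !Cmod_mult, (proj1 Hm), Cmod_R, Rabs_pos_eq in E by assumption.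
    change ((1 + x) ^ S (S j))%R with ((1 + x) * (1 + x) ^ S j)%R.
    rewrite <- E in HB'; nra.
Qed.

Lemma cder_transform (mu : C) (v : R -> C) (x : R) :
  ray mu -> rapid_decay v -> (0 < x)%R ->
  cder (fun x => J mu v x 0) x (J mu (fun y => - mu * RtoC y * v y) x 0).
Proof.
  intros Hm Hv Hx; unfold J.
  assert (Hmu : poly_growth (fun r => - mu * RtoC r) 1 1)
    by (apply poly_growth_r; rewrite Cmod_opp; apply Hm).
  assert (Hv1 := rapid_decay_mul _ _ _ _ Hmu Hv).
  assert (Hv2 := rapid_decay_mul _ _ _ _ Hmu Hv1).
  destruct (rapid_decay_dominated mu _ Hm Hv) as [B HB].
  destruct (rapid_decay_dominated mu _ Hm Hv1) as [B1 HB1].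
  destruct (rapid_decay_dominated mu _ Hm Hv2) as [B2 HB2].
  assert (Hs : forall s, (Rabs (s - x) < x)%R -> (0 <= s)%R) by (intros s Hs; apply Rabs_def2 in Hs; lra).
  apply cder_CInt_half_line with (d := x) (M := B2)
    (F := fun x y => Ek mu x 0 y * v y)
    (F1 := fun x y => Ek mu x 0 y * (- mu * RtoC y * v y))
    (F2 := fun x y => Ek mu x 0 y * (- mu * RtoC y * (- mu * RtoC y * v y))).
  - assumption.
  - intros s Hsd; exists B; auto.
  - exists B1; apply HB1; lra.
  - intros s r Hsd Hr0; eapply cder_eq; [apply cder_mult; [apply cder_Ek_x|apply cder_const]|].
    cbv beta; ring.
  - intros s r Hsd Hr0; eapply cder_eq; [apply cder_mult; [apply cder_Ek_x|apply cder_const]|].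
    cbv beta; ring.
  - intros s r Hsd Hr0; apply (HB2 s); auto.
Qed.

(** A derivative of the transform multiplies [v] by [- mu y]. This adds a zero at 0, hence one more
    order of decay, which is exactly the gain per derivative that a symbol requires. *)
Lemma transform_symbol (mu : C) (d j : nat) (v : R -> C) :
  ray mu -> schwartz (d + S j) j v -> symbol d 0 (S j) (fun x => J mu v x 0).
Proof.
  intros Hm; revert j v; induction d as [|d IH]; intros j v Hv;
    assert (Hr := schwartz_rapid_decay _ _ _ Hv);
    (destruct (transform_decay mu j v Hm) as [B HB];
      [eapply schwartz_le; [| |exact Hv]; lia|]);
    (split; [now apply transform_hcont|]);
    (split; [exists B; intros r Hr0; cbn [pow]; rewrite Rmult_1_r; apply HB, Hr0|]).
  - trivial.
  - exists (fun x => J mu (fun y => - mu * RtoC y * v y) x 0); split.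
    + intros r Hr0; now apply cder_transform.
    + apply IH; replace (d + S (S j))%nat with (S d + S j)%nat by lia.
      apply schwartz_mul; [rewrite Cmod_opp; apply Hm|assumption].
Qed.

Lemma schwartz_half_line_tower (f : R -> C) (F : nat -> R -> C) :
  derivatives_half_line f F ->
  (forall M N : nat, exists B : R, forall x : R, (0 <= x)%R ->
      (Cmod (RtoC (x ^ M) * F N x) <= B)%R) ->
  forall d n, schwartz d 0 (F n).
Proof.
  intros (H0 & Hd & Hl) HB.
  assert (HF : forall n, rapid_decay (F n)).
  { intros n; split; [apply hcont_of_right_limit with (f' := F (S n)); [apply Hd|apply Hl]|].
    intros M; destruct (HB M n) as [B1 HB1], (HB 0%nat n) as [B0 HB0].
    exists (2 ^ M * (B0 + B1))%R; intros y Hy; specialize (HB1 y Hy); specialize (HB0 y Hy).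
    rewrite Cmod_mult, Cmod_R, Rabs_pos_eq in HB0, HB1 by now apply pow_le.
    cbn in HB0; rewrite Rmult_1_l in HB0.
    assert (HP : ((1 + y) ^ M <= 2 ^ M * (1 + y ^ M))%R).
    { assert (0 <= y ^ M)%R by now apply pow_le.
      assert (0 < 2 ^ M)%R by (apply pow_lt; lra).
      destruct (Rle_dec y 1).
      - apply Rle_trans with (2 ^ M)%R; [apply pow_incr; lra|nra].
      - apply Rle_trans with ((2 * y) ^ M)%R; [apply pow_incr; lra|].
        rewrite Rpow_mult_distr; nra. }
    assert (0 < 2 ^ M)%R by (apply pow_lt; lra).
    pose proof (Cmod_ge_0 (F n y)).
    apply Rle_trans with (Cmod (F n y) * (2 ^ M * (1 + y ^ M)))%R; [now apply Rmult_le_compat_l|].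
    replace (Cmod (F n y) * (2 ^ M * (1 + y ^ M)))%R
      with (2 ^ M * (Cmod (F n y) + y ^ M * Cmod (F n y)))%R by ring.
    apply Rmult_le_compat_l; lra. }
  induction d as [|d IH]; intros n; (split; [apply HF|split; [lia|]]); [trivial|].
  exists (F (S n)); split; [apply Hd|apply IH].
Qed.

(** ** Derivatives of all orders *)

(** The derivatives live on the open quadrant and the extension is claimed for each order
    separately, which makes sums and multiples immediate. A single family of extensions is chosen
    only in [smoothly_extends_extension]. *)
Definition smoothly_extends (u : R -> R -> C) : Prop :=
  exists D : nat -> nat -> R -> R -> C,
    (forall x t, (0 < x)%R -> (0 < t)%R -> D 0%nat 0%nat x t = u x t) /\
    (forall k l x t, (0 < x)%R -> (0 < t)%R ->
       cder (fun y => D k l y t) x (D (S k) l x t) /\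
       cder (fun s => D k l x s) t (D k (S l) x t)) /\
    (forall k l, extends_to punctured_quadrant (D k l)).

Lemma smoothly_extends_eq (u v : R -> R -> C) :
  (forall x t, (0 < x)%R -> (0 < t)%R -> v x t = u x t) -> smoothly_extends u -> smoothly_extends v.
Proof.
  intros E (D & H1 & H2); exists D; split; [|assumption].
  intros; rewrite H1, E; auto.
Qed.

Lemma smoothly_extends_plus (u v : R -> R -> C) :
  smoothly_extends u -> smoothly_extends v -> smoothly_extends (fun x t => u x t + v x t).
Proof.
  intros (D & D1 & D2 & D3) (E & E1 & E2 & E3).
  exists (fun k l x t => D k l x t + E k l x t); split; [|split].
  - intros; rewrite D1, E1; auto.
  - intros k l x t Hx Ht; destruct (D2 k l x t Hx Ht), (E2 k l x t Hx Ht).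
    split; apply cder_plus; assumption.
  - intros; now apply extends_to_plus.
Qed.

Lemma smoothly_extends_Cmult (c : C) (u : R -> R -> C) :
  smoothly_extends u -> smoothly_extends (fun x t => c * u x t).
Proof.
  intros (D & D1 & D2 & D3).
  exists (fun k l x t => c * D k l x t); split; [|split].
  - intros; rewrite D1; auto.
  - intros k l x t Hx Ht; destruct (D2 k l x t Hx Ht).
    split; (eapply cder_eq; [apply cder_mult; [apply cder_const|eassumption]|cbv beta; ring]).
  - intros; now apply extends_to_Cmult.
Qed.

Lemma smoothly_extends_extension (u : R -> R -> C) :
  smoothly_extends u -> smooth_extension_punctured_quadrant u.
Proof.
  intros (D & D1 & D2 & D3).
  set (U := fun k l => proj1_sig (constructive_indefinite_description _ (D3 k l))).
  assert (HU : forall k l, cont_on punctured_quadrant (U k l) /\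
    forall x t, (0 < x)%R -> (0 < t)%R -> U k l (x, t) = D k l x t)
    by (intros k l; unfold U; apply proj2_sig).
  exists U; split; [|split].
  - intros x t Hx Ht; rewrite (proj2 (HU _ _)), D1; auto.
  - intros k l x t Hx Ht; rewrite !(proj2 (HU _ _)) by assumption.
    destruct (D2 k l x t Hx Ht) as [H1 H2]; split.
    + apply cder_ext_near with (f := fun y => D k l y t) (d := x); [assumption| |assumption].
      intros s Hs; apply Rabs_def2 in Hs; symmetry; apply HU; lra.
    + apply cder_ext_near with (f := fun s => D k l x s) (d := t); [assumption| |assumption].
      intros s Hs; apply Rabs_def2 in Hs; symmetry; apply HU; lra.
  - intros k l; apply HU.
Qed.

Lemma J_smoothly_extends (kappa : C) (a : R -> C) (N m : nat) :
  ray kappa -> (0 < Re kappa \/ Re (kappa * kappa) = -1)%R -> (forall d, symbol d N m a) ->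
  smoothly_extends (J kappa a).
Proof.
  intros Hk Hk' Ha.
  assert (Hrate : forall x t, (0 < x)%R -> (0 < t)%R -> (0 < rate kappa x t)%R).
  { intros x t Hx Ht; destruct Hk' as [H|H].
    - apply rate_pos_x; auto; lra.
    - apply rate_pos_t; auto; lra. }
  assert (Hext : forall N' m' b, (forall d, symbol d N' m' b) -> extends_to punctured_quadrant (J kappa b)).
  { intros N' m' b Hb; destruct Hk' as [H|H].
    - now apply J_extends_slanted with (N := N') (m := m').
    - now apply J_extends_real with (N := N') (m := m'). }
  (* An [x]-derivative brings down [- kappa r] and a [t]-derivative [(kappa r)^2]; the latter is
     kept as two equal powers, so that [symbol_mul_pow] applies factor by factor. *)
  set (b := fun k l r => (- kappa * RtoC r) ^ k *
    ((kappa * RtoC r) ^ l * ((kappa * RtoC r) ^ l * a r))).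
  assert (Hb : forall k l d, symbol d (k + (l + (l + N))) m (b k l))
    by (intros; unfold b; now repeat apply symbol_mul_pow).
  exists (fun k l => J kappa (b k l)); split; [|split].
  - intros x t Hx Ht; f_equal; apply functional_extensionality; intros r; unfold b.
    change ((- kappa * RtoC r) ^ 0) with (RtoC 1); change ((kappa * RtoC r) ^ 0) with (RtoC 1); ring.
  - intros k l x t Hx Ht; destruct (symbol_poly_growth _ _ _ _ (Hb k l 0%nat)) as [B HB]; split.
    + eapply cder_eq; [apply (cder_J_x _ _ _ _ _ _ Hk HB); auto; lra|].
      f_equal; apply functional_extensionality; intros r; unfold b; cbn [Cpow]; ring.
    + eapply cder_eq; [apply (cder_J_t _ _ _ _ _ _ Hk HB); auto; lra|].
      f_equal; apply functional_extensionality; intros r; unfold b; cbn [Cpow]; ring.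
  - intros k l; eapply Hext, Hb.
Qed.

(** ** The boundary term *)

(** On Gamma [lambda^2] is imaginary, so [exp (lambda^2 tau)] has modulus 1 for either sign of
    [tau]. This keeps time transforms bounded uniformly along the ray. *)
Definition slanted (kappa : C) : Prop :=
  ray kappa /\ (0 < Re kappa)%R /\ Re (kappa * kappa) = 0%R.

(** [Ek kappa 0 (- tau) r] is [exp (lambda^2 tau)]. *)
Definition time_transform (kappa : C) (g : R -> C) (t r : R) : C :=
  CInt (fun tau => Ek kappa 0 (- tau) r * g tau) 0 t.

Lemma Cmod_Ek_0 (kappa : C) (s r : R) : slanted kappa -> Cmod (Ek kappa 0 s r) = 1%R.
Proof.
  intros (_ & _ & H); rewrite Cmod_Ek, H, !Rmult_0_l, Rmult_0_r, Rminus_0_r; apply exp_0.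
Qed.

Lemma Ek_mul (kappa : C) (x t r : R) : Ek kappa x t r * Ek kappa 0 (- t) r = Ek kappa x 0 r.
Proof.
  unfold Ek; rewrite <- Cexp_plus; f_equal; apply C_eq; unfold Re, Im; cbn; ring.
Qed.

Lemma Ek_0_0 (kappa : C) (r : R) : Ek kappa 0 0 r = 1.
Proof.
  unfold Ek; rewrite <- Cexp_0; f_equal; apply C_eq; unfold Re, Im; cbn; ring.
Qed.

Lemma cder_Ek_opp_t (kappa : C) (x s r : R) :
  cder (fun s => Ek kappa x (- s) r) s (- (kappa * RtoC r) ^ 2 * Ek kappa x (- s) r).
Proof.
  apply cder_eq with (scal (-1)%R ((kappa * RtoC r) ^ 2 * Ek kappa x (- s) r : C_R_NormedModule)).
  - apply (is_derive_comp (V := C_R_NormedModule) (fun s => Ek kappa x s r) Ropp).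
    + apply cder_Ek_t.
    + auto_derive; trivial.
  - apply C_eq; unfold Re, Im; cbn; ring.
Qed.

Lemma hcont_bounded (g : R -> C) (T : R) :
  hcont g -> exists B, (0 <= B)%R /\ forall s, (0 <= s <= T)%R -> (Cmod (g s) <= B)%R.
Proof.
  intros Hg; destruct (Rle_dec 0 T) as [HT|HT].
  - destruct (continuity_ab_maj (fun s => Cmod (g (Rmax 0 s))) 0 T HT) as (M & HM & _).
    + intros c _; apply continuity_pt_filterlim.
      apply (continuous_ext (fun s => norm (g (Rmax 0 s) : C_R_NormedModule)));
        [intros s; symmetry; apply Cmod_norm|].
      exact (filterlim_comp _ _ _ _ _ _ _ _ (hcont_clamp g c Hg)
        (filterlim_norm (V := C_R_NormedModule) (g (Rmax 0 c)))).
    + exists (Cmod (g (Rmax 0 M))); split; [apply Cmod_ge_0|].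
      intros s Hs; specialize (HM s Hs); cbn in HM; rewrite Rmax_right in HM by lra; exact HM.
  - exists 0%R; split; [lra|]; intros; lra.
Qed.

Lemma hcont_time_integrand (kappa : C) (g : R -> C) (r : R) :
  hcont g -> hcont (fun tau => Ek kappa 0 (- tau) r * g tau).
Proof.
  intros Hg; apply hcont_mult; [|assumption].
  apply hcont_cder with (1 := fun s _ => cder_Ek_opp_t kappa 0 s r).
Qed.

Lemma CInt_plus (f g : R -> C) (b : R) :
  hcont f -> hcont g -> (0 <= b)%R -> CInt (fun r => f r + g r) 0 b = CInt f 0 b + CInt g 0 b.
Proof.
  intros; apply (RInt_plus (V := C_R_CompleteNormedModule)); apply hcont_ex_RInt; auto; lra.
Qed.

Lemma CInt_bound (f : R -> C) (a b B : R) :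
  hcont f -> (0 <= a <= b)%R -> (forall r, (a <= r <= b)%R -> (Cmod (f r) <= B)%R) ->
  (Cmod (CInt f a b) <= (b - a) * B)%R.
Proof.
  intros Hf Hab HB; apply CInt_norm_le with (g := fun _ => B); auto.
  apply (is_RInt_const (V := R_NormedModule)).
Qed.

(** Here [(kappa r)^2] is [- lambda^2]. After multiplication by [Ek kappa x t r] the last term
    becomes [Ek kappa x 0 r * g t], the source of all integrals at time 0 below. *)
Lemma time_transform_by_parts (kappa : C) (g g' : R -> C) (t r : R) :
  hcont g -> hcont g' -> (forall s, (0 < s)%R -> cder g s (g' s)) -> (0 <= t)%R ->
  (kappa * RtoC r) ^ 2 * time_transform kappa g t r =
  time_transform kappa g' t r + g 0%R + - (Ek kappa 0 (- t) r * g t).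
Proof.
  intros Hg Hg' Hd Ht; unfold time_transform.
  assert (E : CInt (fun s => - (kappa * RtoC r) ^ 2 * (Ek kappa 0 (- s) r * g s)
      + Ek kappa 0 (- s) r * g' s) 0 t
    = Ek kappa 0 (- t) r * g t - Ek kappa 0 (- 0) r * g 0%R).
  { apply (half_line_FTC (fun s => Ek kappa 0 (- s) r * g s)); auto.
    - now apply hcont_time_integrand.
    - apply hcont_plus; [apply hcont_mult; [apply hcont_const|]|]; now apply hcont_time_integrand.
    - intros s Hs; eapply cder_eq; [apply cder_mult; [apply cder_Ek_opp_t|apply Hd, Hs]|].
      cbv beta; ring. }
  rewrite CInt_plus, CInt_Cmult in E; auto.
  - rewrite Ropp_0, Ek_0_0 in E.
    replace (Ek kappa 0 (- t) r * g t)
      with (Ek kappa 0 (- t) r * g t - 1 * g 0%R + g 0%R) by ring.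
    rewrite <- E; ring.
  - apply hcont_ex_RInt; [now apply hcont_time_integrand|lra|lra].
  - apply hcont_mult; [apply hcont_const|]; now apply hcont_time_integrand.
  - now apply hcont_time_integrand.
Qed.

Lemma time_transform_bound (kappa : C) (g : R -> C) (T : R) :
  slanted kappa -> hcont g -> exists B, (0 <= B)%R /\
  (forall t r, (0 <= t <= T)%R -> (Cmod (time_transform kappa g t r) <= B)%R) /\
  (forall s t r, (0 <= s <= T)%R -> (0 <= t <= T)%R ->
    (Cmod (time_transform kappa g t r - time_transform kappa g s r) <= B * Rabs (t - s))%R).
Proof.
  intros Hk Hg; destruct (hcont_bounded g T Hg) as (B & HB0 & HB).
  assert (HI : forall a b r, (0 <= a <= b)%R -> (b <= T)%R ->
    (Cmod (CInt (fun tau => (Ek kappa 0 (- tau) r * g tau)%C) a b) <= (b - a) * B)%R).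
  { intros a b r Hab HbT; apply CInt_bound; [now apply hcont_time_integrand|assumption|].
    intros s Hs; rewrite Cmod_mult, Cmod_Ek_0, Rmult_1_l by assumption; apply HB; lra. }
  assert (HL : forall s t r, (0 <= s <= t)%R -> (t <= T)%R ->
    (Cmod (time_transform kappa g t r - time_transform kappa g s r) <= (t - s) * B)%R).
  { intros s t r Hst HtT; unfold time_transform.
    rewrite <- (CInt_Chasles _ 0 s t (hcont_time_integrand kappa g r Hg)) by lra.
    match goal with |- (Cmod (?u + ?v - ?u) <= _)%R => replace (u + v - u) with v by ring end.
    now apply HI. }
  (* One constant serves both the bound [T B] and the Lipschitz constant [B]. *)
  exists (B * (1 + Rabs T))%R; pose proof (Rabs_pos T); pose proof (Rle_abs T); split; [nra|split].
  - intros t r Ht; eapply Rle_trans; [apply (HI 0%R t r); lra|]. nra.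
  - intros s t r Hs Ht; destruct (Rle_dec s t) as [Hst|Hst].
    + rewrite (Rabs_pos_eq (t - s)) by lra.
      eapply Rle_trans; [apply HL; lra|]. assert (0 <= (t - s) * B)%R by nra. nra.
    + rewrite Rabs_minus_sym, (Rabs_pos_eq (s - t)) by lra.
      rewrite <- Cmod_opp.
      replace (- (time_transform kappa g t r - time_transform kappa g s r))
        with (time_transform kappa g s r - time_transform kappa g t r) by ring.
      eapply Rle_trans; [apply HL; lra|]. assert (0 <= (s - t) * B)%R by nra. nra.
Qed.

Lemma time_transform_hcont (kappa : C) (g : R -> C) (t : R) :
  slanted kappa -> hcont g -> (0 <= t)%R -> hcont (time_transform kappa g t).
Proof.
  intros Hk Hg Ht; destruct (hcont_bounded g t Hg) as (B & HB0 & HB).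
  assert (HL : forall r s, (Cmod (time_transform kappa g t s - time_transform kappa g t r)
    <= 2 * t * t * B * Rabs (s ^ 2 - r ^ 2))%R).
  { intros r s; unfold time_transform.
    pose (G1 := fun tau => Ek kappa 0 (- tau) s * g tau).
    pose (G2 := fun tau => Ek kappa 0 (- tau) r * g tau).
    assert (H1 : hcont G1) by exact (hcont_time_integrand kappa g s Hg).
    assert (H2 : hcont G2) by exact (hcont_time_integrand kappa g r Hg).
    fold G1 G2; replace (CInt G1 0 t - CInt G2 0 t) with (CInt (fun u => G1 u + - (1) * G2 u) 0 t).
    2:{ rewrite CInt_plus, CInt_Cmult; auto; [ring| |].
        - apply hcont_ex_RInt; auto; lra.
        - apply hcont_mult; [apply hcont_const|assumption]. }
    eapply Rle_trans.
    - apply CInt_bound with (B := (2 * (t * Rabs (s ^ 2 - r ^ 2)) * B)%R); [|lra|].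
      + apply hcont_plus; [assumption|apply hcont_mult; [apply hcont_const|assumption]].
      + intros u Hu; unfold G1, G2.
        replace (Ek kappa 0 (- u) s * g u + - (1) * (Ek kappa 0 (- u) r * g u))
          with ((Ek kappa 0 (- u) s - Ek kappa 0 (- u) r) * g u) by ring.
        rewrite Cmod_mult; apply Rmult_le_compat; try apply Cmod_ge_0; [|apply HB; lra].
        unfold Ek; eapply Rle_trans.
        * apply Cexp_lipschitz; rewrite Ek_exponent, (proj2 (proj2 Hk)); lra.
        * replace (kappa * kappa * RtoC (- u * s ^ 2) - kappa * RtoC (0 * s) -
            (kappa * kappa * RtoC (- u * r ^ 2) - kappa * RtoC (0 * r)))
            with (kappa * kappa * RtoC (- u * (s ^ 2 - r ^ 2)))
            by (apply C_eq; unfold Re, Im; cbn; ring).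
          rewrite !Cmod_mult, (proj1 (proj1 Hk)), Cmod_R, Rabs_mult, Rabs_Ropp, Rabs_pos_eq by lra.
          pose proof (Rabs_pos (s ^ 2 - r ^ 2)); nra.
    - right; ring. }
  apply hcont_iff; intros r Hr eps He.
  (* The transform is Lipschitz in [r^2] only; [2 r + 1] bounds [s + r] for [s] within distance 1 of
     [r], and the last summand keeps [L] positive. *)
  set (L := (2 * t * t * B * (2 * r + 1) + 1)%R).
  assert (HtB : (0 <= 2 * t * t * B)%R) by (repeat apply Rmult_le_pos; lra).
  assert (HLp : (0 < L)%R) by (unfold L; nra).
  assert (Hq : (0 < eps / L)%R) by now apply Rdiv_lt_0_compat.
  exists (Rmin 1 (eps / L)); split; [apply Rmin_pos; lra|]; intros s Hs Hsr.
  pose proof (Rmin_l 1 (eps / L)); pose proof (Rmin_r 1 (eps / L)).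
  eapply Rle_lt_trans; [apply HL|].
  replace (s ^ 2 - r ^ 2)%R with ((s - r) * (s + r))%R by ring; rewrite Rabs_mult.
  assert (H3 : (Rabs (s + r) <= 2 * r + 1)%R).
  { rewrite Rabs_pos_eq by lra. assert (Rabs (s - r) < 1)%R by lra. apply Rabs_def2 in H1; lra. }
  assert (E : (eps / L * L = eps)%R) by (field; lra).
  pose proof (Rabs_pos (s - r)).
  apply Rle_lt_trans with (2 * t * t * B * (Rabs (s - r) * (2 * r + 1)))%R.
  - apply Rmult_le_compat_l; [assumption|]; apply Rmult_le_compat_l; assumption.
  - apply Rle_lt_trans with (Rabs (s - r) * (L - 1))%R; [unfold L; right; ring|]. nra.
Qed.

Lemma time_transform_poly_growth (kappa : C) (g : R -> C) (t : R) :
  slanted kappa -> hcont g -> (0 <= t)%R ->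
  exists B, poly_growth (time_transform kappa g t) 0 B.
Proof.
  intros Hk Hg Ht; destruct (time_transform_bound kappa g t Hk Hg) as (B & _ & HB & _).
  exists B; split; [now apply time_transform_hcont|].
  intros r _; cbn; rewrite Rmult_1_r; apply HB; lra.
Qed.

(** By parts in time, [r^2] times the time transform is bounded; hence absolute convergence up to [x = 0]. *)
Lemma J_time_transform_extends (kappa : C) (q : R -> C) (B : R) (g g' : R -> C) :
  slanted kappa -> poly_growth q 0 B -> hcont g -> hcont g' ->
  (forall s, (0 < s)%R -> cder g s (g' s)) ->
  extends_to punctured_quadrant (fun x t => J kappa (fun r => q r * time_transform kappa g t r) x t).
Proof.
  intros Hk Hq Hg Hg' Hd.
  exists (fun p => J kappa (fun r => q r * time_transform kappa g (snd p) r) (fst p) (snd p));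
    split; [|reflexivity].
  assert (HB := poly_growth_pos _ _ _ Hq).
  unfold J; apply Ek_integral_continuous_on
    with (a := fun t r => q r * time_transform kappa g t r).
  - apply Hk.
  - exact punctured_closed.
  - intros t Ht; apply hcont_mult; [apply Hq|now apply time_transform_hcont].
  - intros [x0 t0] Hp0; destruct (punctured_closed _ Hp0) as [Hx0 Ht0]; cbn in Hx0, Ht0.
    destruct (time_transform_bound kappa g (t0 + 1) Hk Hg) as (W & HW0 & HW & HWL).
    destruct (time_transform_bound kappa g' (t0 + 1) Hk Hg') as (W' & HW0' & HW' & _).
    destruct (hcont_bounded g (t0 + 1) Hg) as (G & HG0 & HG).
    assert (HQ : forall r, (0 <= r)%R -> (Cmod (q r) <= B)%R).
    { intros r Hr; pose proof (proj2 Hq r Hr) as H; cbn in H; lra. }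
    (* [W] bounds the time transform and [W' + G + G] bounds [r^2] times it, by parts in time. The
       factor 2 comes from [(1 + r)^2 <= 2 (1 + r^2)]. *)
    exists (B * (2 * (W + (W' + G + G))))%R, 0%nat, (B * W)%R; cbn [fst snd]; split; [|split].
    + apply near_of_box with (d := 1%R); [lra|]; cbn [fst snd]; intros x t Hp _ Htt r Hr.
      destruct (punctured_closed _ Hp) as [Hx Ht]; cbn in Hx, Ht; apply Rabs_def2 in Htt.
      pose proof (Cmod_Ek_le_1 kappa x t r (proj1 Hk) Hx Ht Hr) as HE.
      pose proof (Cmod_ge_0 (Ek kappa x t r)).
      set (w := time_transform kappa g t r).
      assert (Hw : (Cmod w <= W)%R) by (apply HW; lra).
      assert (Hw2 : (Cmod w * r ^ 2 <= W' + G + G)%R).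
      { replace (Cmod w * r ^ 2)%R with (Cmod ((kappa * RtoC r) ^ 2 * w)).
        - unfold w; rewrite (time_transform_by_parts kappa g g') by assumption.
          eapply Rle_trans; [apply Cmod_triangle|]; apply Rplus_le_compat.
          + eapply Rle_trans; [apply Cmod_triangle|]; apply Rplus_le_compat; [apply HW'|apply HG]; lra.
          + rewrite Cmod_opp, Cmod_mult, Cmod_Ek_0, Rmult_1_l by assumption; apply HG; lra.
        - rewrite Cmod_mult, Cmod_pow, Cmod_mult, (proj1 (proj1 Hk)), Cmod_R, Rabs_pos_eq by assumption.
          ring. }
      assert (Hw3 : (Cmod w * (1 + r) ^ 2 <= 2 * (W + (W' + G + G)))%R).
      { pose proof (Cmod_ge_0 w).
        apply Rle_trans with (Cmod w * (2 * (1 + r ^ 2)))%R; [|lra].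
        apply Rmult_le_compat_l; [assumption|]. pose proof (pow2_ge_0 (1 - r)); nra. }
      rewrite Cmod_mult.
      replace (Cmod (Ek kappa x t r) * (Cmod (q r) * Cmod w) * (1 + r) ^ 2)%R
        with (Cmod (Ek kappa x t r) * (Cmod (q r) * (Cmod w * (1 + r) ^ 2)))%R by ring.
      assert (0 <= Cmod w * (1 + r) ^ 2)%R by (apply Rmult_le_pos; [apply Cmod_ge_0|apply pow2_ge_0]).
      assert (HH : (Cmod (q r) * (Cmod w * (1 + r) ^ 2) <= B * (2 * (W + (W' + G + G))))%R)
        by (apply Rmult_le_compat; auto using Cmod_ge_0).
      assert (0 <= Cmod (q r) * (Cmod w * (1 + r) ^ 2))%R by (apply Rmult_le_pos; auto using Cmod_ge_0).
      nra.
    + intros r Hr; cbn; rewrite Rmult_1_r, Cmod_mult.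
      apply Rmult_le_compat; auto using Cmod_ge_0; apply HW; lra.
    + intros e He.
      assert (Hd' : (0 < e / (B * W + 1))%R) by (apply Rdiv_lt_0_compat; nra).
      apply near_of_box with (d := Rmin 1 (e / (B * W + 1))); [apply Rmin_pos; lra|].
      cbn [fst snd]; intros x t Hp _ Htt r Hr.
      destruct (punctured_closed _ Hp) as [Hx Ht]; cbn in Hx, Ht.
      pose proof (Rmin_l 1 (e / (B * W + 1))); pose proof (Rmin_r 1 (e / (B * W + 1))).
      assert (Ht1 : (t <= t0 + 1)%R) by (apply Rabs_def2 in Htt; lra).
      replace (q r * time_transform kappa g t r - q r * time_transform kappa g t0 r)
        with (q r * (time_transform kappa g t r - time_transform kappa g t0 r)) by ring.
      rewrite Cmod_mult; cbn; rewrite Rmult_1_r.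
      specialize (HWL t0 t r ltac:(lra) ltac:(lra)); specialize (HQ r Hr).
      assert (E : (e / (B * W + 1) * (B * W + 1) = e)%R) by (field; nra).
      pose proof (Rabs_pos (t - t0)).
      apply Rle_trans with (B * (W * Rabs (t - t0)))%R.
      * apply Rmult_le_compat; auto using Cmod_ge_0.
      * assert (0 <= B * W)%R by nra.
        replace (B * (W * Rabs (t - t0)))%R with ((B * W) * Rabs (t - t0))%R by ring. nra.
Qed.

(** * The boundary term with amplitude of degree n *)

Definition time_J (kappa : C) (n : nat) (g : R -> C) (x t : R) : C :=
  J kappa (fun r => (kappa * RtoC r) ^ n * time_transform kappa g t r) x t.

Lemma time_J_amplitude (kappa : C) (n : nat) (g : R -> C) (t : R) :
  slanted kappa -> hcont g -> (0 <= t)%R ->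
  exists B, poly_growth (fun r => (kappa * RtoC r) ^ n * time_transform kappa g t r) (n + 0) B.
Proof.
  intros Hk Hg Ht; destruct (time_transform_poly_growth kappa g t Hk Hg Ht) as [B HB].
  eexists; apply poly_growth_mul; [apply poly_growth_pow, Hk|exact HB].
Qed.

Lemma cder_time_J_x (kappa : C) (n : nat) (g : R -> C) (x t : R) :
  slanted kappa -> hcont g -> (0 < x)%R -> (0 <= t)%R ->
  cder (fun x => time_J kappa n g x t) x (- time_J kappa (S n) g x t).
Proof.
  intros Hk Hg Hx Ht; destruct (time_J_amplitude kappa n g t Hk Hg Ht) as [B HB].
  destruct (time_J_amplitude kappa (S n) g t Hk Hg Ht) as [B' HB'].
  assert (Hr := rate_pos_x kappa x t (proj1 Hk) (proj1 (proj2 Hk)) Hx Ht).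
  unfold time_J; eapply cder_eq; [apply (cder_J_x kappa _ _ _ _ _ (proj1 Hk) HB); auto|].
  replace (- J kappa (fun r => (kappa * RtoC r) ^ S n * time_transform kappa g t r) x t)
    with (- (1) * J kappa (fun r => (kappa * RtoC r) ^ S n * time_transform kappa g t r) x t) by ring.
  rewrite <- (J_Cmult kappa (- (1)) _ _ _ x t (proj1 Hk) HB') by (auto; lra).
  f_equal; apply functional_extensionality; intros r; cbn [Cpow]; ring.
Qed.

(** The moving endpoint of the time transform contributes [Ek kappa x t r * Ek kappa 0 (- t) r * g
    t], and the two exponentials combine to [Ek kappa x 0 r]. The derivative of [g] enters only
    through the second derivative needed for the Taylor remainder. *)
Lemma cder_time_J_t (kappa : C) (n : nat) (g g' : R -> C) (x t : R) :
  slanted kappa -> hcont g -> hcont g' -> (forall s, (0 < s)%R -> cder g s (g' s)) ->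
  (0 < x)%R -> (0 < t)%R ->
  cder (fun t => time_J kappa n g x t) t
    (time_J kappa (S (S n)) g x t + g t * J kappa (fun r => (kappa * RtoC r) ^ n) x 0).
Proof.
  intros Hk Hg Hg' Hd Hx Ht.
  assert (Hrate : forall s, (0 <= s)%R -> (0 < rate kappa x s)%R)
    by (intros; apply rate_pos_x; auto; apply Hk).
  assert (Hpow := fun m => poly_growth_pow kappa m (proj1 (proj1 Hk))).
  assert (Hex : forall m s, (0 <= s)%R ->
    exists B, dominated (fun r => Ek kappa x s r * ((kappa * RtoC r) ^ m * time_transform kappa g s r)) B).
  { intros m s Hs; destruct (time_J_amplitude kappa m g s Hk Hg Hs) as [B HB].
    eapply Ek_dominated; eauto; [apply Hk|lra]. }
  assert (Hex0 : forall m, exists B, dominated (fun r => Ek kappa x 0 r * (kappa * RtoC r) ^ m) B).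
  { intros m; eapply Ek_dominated; [apply Hk|apply Hpow|lra|lra|apply Hrate; lra]. }
  destruct (Hex (S (S n)) t ltac:(lra)) as [B1 HB1].
  destruct (Hex0 n) as [B2 HB2], (Hex0 (S (S n))) as [B3 HB3].
  assert (HF1 := dominated_plus _ _ _ _ HB1 (dominated_Cmult _ (g t) _ HB2)).
  unfold time_J at 2, J.
  rewrite <- (CInt_half_line_Cmult _ (g t) _ HB2).
  rewrite <- (CInt_half_line_plus _ _ _ _ HB1 (dominated_Cmult _ (g t) _ HB2)).
  destruct (time_transform_bound kappa g (2 * t) Hk Hg) as (W & HW0 & HW & _).
  destruct (Ek_rate_bound kappa (S (S (S (S n)))) W (2 * t) (rate kappa x 0) (proj1 Hk)) as [B4 HB4];
    [apply Hrate; lra|].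
  destruct (hcont_bounded g (2 * t) Hg) as (G & HG0 & HG).
  destruct (hcont_bounded g' (2 * t) Hg') as (G' & HG0' & HG').
  assert (Hs : forall s, (Rabs (s - t) < t)%R -> (0 < s /\ s <= 2 * t)%R)
    by (intros s Hs; apply Rabs_def2 in Hs; lra).
  assert (Hder : forall m s r, (0 < s)%R ->
    cder (fun s => Ek kappa x s r * ((kappa * RtoC r) ^ m * time_transform kappa g s r)) s
      (Ek kappa x s r * ((kappa * RtoC r) ^ S (S m) * time_transform kappa g s r)
       + g s * (Ek kappa x 0 r * (kappa * RtoC r) ^ m))).
  { intros m s r Hs0; eapply cder_eq.
    - apply cder_mult; [apply cder_Ek_t|]; apply cder_mult; [apply cder_const|].
      apply (cder_CInt (fun tau => Ek kappa 0 (- tau) r * g tau)); [|assumption].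
      now apply hcont_time_integrand.
    - cbv beta; rewrite <- (Ek_mul kappa x s r); unfold time_transform; cbn [Cpow]; ring. }
  unfold time_J, J; apply cder_CInt_half_line with (d := t) (M := (B4 + G * B3 + G' * B2)%R)
    (F := fun s r => Ek kappa x s r * ((kappa * RtoC r) ^ n * time_transform kappa g s r))
    (F1 := fun s r => Ek kappa x s r * ((kappa * RtoC r) ^ S (S n) * time_transform kappa g s r)
       + g s * (Ek kappa x 0 r * (kappa * RtoC r) ^ n))
    (F2 := fun s r => Ek kappa x s r * ((kappa * RtoC r) ^ S (S (S (S n))) * time_transform kappa g s r)
       + g s * (Ek kappa x 0 r * (kappa * RtoC r) ^ S (S n))
       + g' s * (Ek kappa x 0 r * (kappa * RtoC r) ^ n)).
  - assumption.
  - intros s Hsd; apply Hex; apply Hs in Hsd; lra.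
  - eexists; exact HF1.
  - intros s r Hsd _; apply Hder, Hs, Hsd.
  - intros s r Hsd _; apply cder_plus; [apply Hder, Hs, Hsd|].
    eapply cder_eq; [apply cder_mult; [apply Hd, Hs, Hsd|apply cder_const]|cbv beta; ring].
  - intros s r Hsd Hr; destruct (Hs s Hsd) as [Hs1 Hs2].
    destruct HB2 as [_ HB2], HB3 as [_ HB3]; specialize (HB2 r Hr); specialize (HB3 r Hr).
    specialize (HG s ltac:(lra)); specialize (HG' s ltac:(lra)).
    assert (HE : (Cmod (Ek kappa x s r) *
      Cmod ((kappa * RtoC r) ^ S (S (S (S n))) * time_transform kappa g s r) * (1 + r) ^ 2 <= B4)%R).
    { apply HB4; try lra.
      (* On a slanted ray the rate does not depend on time, so its value at time 0 serves the whole
         interval. *)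
      - unfold rate; rewrite (proj2 (proj2 Hk)); lra.
      - rewrite Cmod_mult, (Rmult_comm W); apply Rmult_le_compat; auto using Cmod_ge_0.
        + pose proof (proj2 (Hpow (S (S (S (S n))))) r Hr) as HH; rewrite Rmult_1_l in HH; exact HH.
        + apply HW; lra. }
    pose proof (pow_1_le r 2 Hr).
    eapply Rle_trans.
    { apply Rmult_le_compat_r; [lra|]. eapply Rle_trans; [apply Cmod_triangle|].
      apply Rplus_le_compat_r, Cmod_triangle. }
    rewrite !Rmult_plus_distr_r; repeat apply Rplus_le_compat.
    + rewrite Cmod_mult; exact HE.
    + rewrite (Cmod_mult (g s)), Rmult_assoc; apply Rmult_le_compat; auto using Cmod_ge_0.
      apply Rmult_le_pos; [apply Cmod_ge_0|lra].
    + rewrite (Cmod_mult (g' s)), Rmult_assoc; apply Rmult_le_compat; auto using Cmod_ge_0.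
      apply Rmult_le_pos; [apply Cmod_ge_0|lra].
Qed.

(** Two degrees are exchanged for one derivative of [g]. The middle term is a ray integral of a
    symbol; the last is singular at x = 0 on each ray and must cancel over Gamma. *)
Lemma time_J_recurrence (kappa : C) (n : nat) (g g' : R -> C) (x t : R) :
  slanted kappa -> hcont g -> hcont g' -> (forall s, (0 < s)%R -> cder g s (g' s)) ->
  (0 < x)%R -> (0 < t)%R ->
  time_J kappa (S (S n)) g x t = time_J kappa n g' x t
    + g 0%R * J kappa (fun r => (kappa * RtoC r) ^ n) x t
    + - g t * J kappa (fun r => (kappa * RtoC r) ^ n) x 0.
Proof.
  intros Hk Hg Hg' Hd Hx Ht.
  assert (Hrate : forall s, (0 <= s)%R -> (0 < rate kappa x s)%R)
    by (intros; apply rate_pos_x; auto; apply Hk).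
  assert (Hpow := poly_growth_pow kappa n (proj1 (proj1 Hk))).
  destruct (time_J_amplitude kappa n g' t Hk Hg' ltac:(lra)) as [B HB].
  destruct (Ek_dominated kappa _ _ _ x t (proj1 Hk) HB ltac:(lra) ltac:(lra) (Hrate t ltac:(lra))) as [B1 HB1].
  destruct (Ek_dominated kappa _ _ _ x t (proj1 Hk) Hpow ltac:(lra) ltac:(lra) (Hrate t ltac:(lra))) as [B2 HB2].
  destruct (Ek_dominated kappa _ _ _ x 0 (proj1 Hk) Hpow ltac:(lra) ltac:(lra) (Hrate 0%R ltac:(lra))) as [B3 HB3].
  unfold time_J, J.
  rewrite <- (CInt_half_line_Cmult _ (g 0%R) _ HB2), <- (CInt_half_line_Cmult _ (- g t) _ HB3).
  rewrite <- (CInt_half_line_plus _ _ _ _ HB1 (dominated_Cmult _ (g 0%R) _ HB2)).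
  rewrite <- (CInt_half_line_plus _ _ _ _
    (dominated_plus _ _ _ _ HB1 (dominated_Cmult _ (g 0%R) _ HB2)) (dominated_Cmult _ (- g t) _ HB3)).
  f_equal; apply functional_extensionality; intros r.
  rewrite <- (Ek_mul kappa x t r).
  replace ((kappa * RtoC r) ^ S (S n) * time_transform kappa g t r)
    with ((kappa * RtoC r) ^ n * ((kappa * RtoC r) ^ 2 * time_transform kappa g t r))
    by (cbn [Cpow]; ring).
  rewrite (time_transform_by_parts kappa g g') by (auto; lra); ring.
Qed.

(** The value is n! / x^(n+1), the integral of [exp (- x z) z^n] along the ray [z = kappa r].
    Integration by parts supplies the factor (n+1) / x at each step, without any contour rotation.
    What matters is that [c] is fixed before [kappa]. *)
Lemma J_pow_0 (n : nat) (x : R) : (0 < x)%R -> exists c, forall kappa, slanted kappa ->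
  kappa * J kappa (fun r => (kappa * RtoC r) ^ n) x 0 = c.
Proof.
  intros Hx.
  assert (Hx0 : RtoC x <> 0) by (intro F; apply RtoC_inj in F; lra).
  assert (Hrate : forall kappa, slanted kappa -> (0 < rate kappa x 0)%R)
    by (intros kappa Hk; apply rate_pos_x; auto; try apply Hk; lra).
  induction n as [|n [c IH]].
  - exists (/ RtoC x); intros kappa Hk.
    assert (P := J_by_parts kappa (fun _ => 1) (fun _ => 0) 0 0 1 0 x 0 (proj1 Hk)
      (poly_growth_pow kappa 0 (proj1 (proj1 Hk)))
      ltac:(split; [apply hcont_const|intros; rewrite Cmod_0; lra])
      (fun r _ => cder_const 1 r) ltac:(lra) ltac:(lra) (Hrate kappa Hk)).
    change (fun r => (kappa * RtoC r) ^ 0) with (fun r : R => RtoC 1).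
    assert (Z : J kappa (fun _ => 0) x 0 = 0).
    { assert (Hone : poly_growth (fun _ => RtoC 1) 0 1) by exact (poly_growth_pow kappa 0 (proj1 (proj1 Hk))).
      pose proof (J_Cmult kappa 0 _ _ _ x 0 (proj1 Hk) Hone ltac:(lra) ltac:(lra) (Hrate kappa Hk)) as Q.
      rewrite Cmult_0_l in Q; etransitivity; [|exact Q].
      f_equal; apply functional_extensionality; intros; symmetry; apply Cmult_0_l. }
    rewrite Z in P.
    replace (kappa * J kappa (fun _ => 1) x 0) with (/ RtoC x * (kappa * RtoC x * J kappa (fun _ => 1) x 0))
      by (field; assumption).
    replace (kappa * RtoC x * J kappa (fun _ => 1) x 0) with (RtoC 1); [ring|].
    transitivity (- - (1)); [ring|].
    cbv beta in P; rewrite <- P; ring.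
  - exists (RtoC (INR (S n)) * / RtoC x * c); intros kappa Hk.
    assert (Hpow := fun m => poly_growth_pow kappa m (proj1 (proj1 Hk))).
    assert (Hc : poly_growth (fun _ => RtoC (INR (S n)) * kappa) 0 (INR (S n))).
    { split; [apply hcont_const|]; intros r _; rewrite Cmod_mult, (proj1 (proj1 Hk)), Cmod_R, Rabs_pos_eq
        by apply pos_INR; cbn [pow]; lra. }
    assert (Hc' : poly_growth (fun r => RtoC (INR (S n)) * kappa * (kappa * RtoC r) ^ n) (0 + n)
      (INR (S n) * 1)) by exact (poly_growth_mul _ _ _ _ _ _ Hc (Hpow n)).
    assert (Hd : forall r, (0 < r)%R -> cder (fun r => (kappa * RtoC r) ^ S n) r
      (RtoC (INR (S n)) * kappa * (kappa * RtoC r) ^ n)).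
    { intros r _; clear; induction n as [|n IH].
      - eapply cder_eq; [apply cder_mult; [apply cder_mult; [apply cder_const|apply cder_id]|apply cder_const]|].
        cbn; ring.
      - eapply cder_eq.
        + apply (cder_mult (fun r => kappa * RtoC r) (fun r => (kappa * RtoC r) ^ S n));
            [apply cder_mult; [apply cder_const|apply cder_id]|exact IH].
        + rewrite (S_INR (S n)), RtoC_plus; cbv beta; cbn [Cpow]; ring. }
    assert (P := J_by_parts kappa _ _ _ _ _ _ x 0 (proj1 Hk) (Hpow (S n))
      Hc' Hd ltac:(lra) ltac:(lra) (Hrate kappa Hk)).
    rewrite (J_Cmult kappa (RtoC (INR (S n)) * kappa) _ _ _ x 0 (proj1 Hk) (Hpow n)) in P by (auto; lra).
    rewrite <- (IH kappa Hk).
    replace (kappa * J kappa (fun r => (kappa * RtoC r) ^ S n) x 0)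
      with (/ RtoC x * (kappa * RtoC x * J kappa (fun r => (kappa * RtoC r) ^ S n) x 0))
      by (field; assumption).
    replace (kappa * RtoC x * J kappa (fun r => (kappa * RtoC r) ^ S n) x 0)
      with (RtoC (INR (S n)) * kappa * J kappa (fun r => (kappa * RtoC r) ^ n) x 0); [ring|].
    replace (- (kappa * RtoC 0) ^ S n) with (RtoC 0) in P by (cbn [Cpow]; ring).
    match type of P with ?l = _ =>
      replace (RtoC (INR (S n)) * kappa * J kappa (fun r => (kappa * RtoC r) ^ n) x 0)
        with (l + kappa * RtoC x * J kappa (fun r => (kappa * RtoC r) ^ S n) x 0) by ring end.
    rewrite P; ring.
Qed.

(** The trailing factor 1 gives it the shape of [symbol_div] applied to the constant symbol 1. *)
Definition damping (kappa : C) (r : R) : C := / (1 + kappa * RtoC r) * 1.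

Lemma damping_symbol (kappa : C) (d : nat) : ray kappa -> symbol d 0 1 (damping kappa).
Proof. intros Hk; exact (symbol_div d 0 0 kappa (fun _ => 1) Hk (symbol_const d 1)). Qed.

Lemma damping_poly_growth (kappa : C) : ray kappa -> poly_growth (damping kappa) 0 2.
Proof.
  intros Hk; split; [apply (symbol_hcont 0 0 1), damping_symbol, Hk|].
  intros r Hr; unfold damping; rewrite Cmult_1_r; cbn.
  pose proof (ray_denominator_inv kappa r Hk Hr); pose proof (Cmod_ge_0 (/ (1 + kappa * RtoC r))); nra.
Qed.

Lemma damping_r_poly_growth (kappa : C) :
  ray kappa -> poly_growth (fun r => kappa * RtoC r * damping kappa r) 0 2.
Proof.
  intros Hk; split; [apply hcont_mult; [apply (proj1 (poly_growth_r kappa (proj1 Hk)))|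
    apply (symbol_hcont 0 0 1), damping_symbol, Hk]|].
  intros r Hr; unfold damping; rewrite Cmult_1_r, !Cmod_mult, (proj1 Hk), Cmod_R, Rabs_pos_eq by assumption.
  pose proof (ray_denominator_inv kappa r Hk Hr); pose proof (Cmod_ge_0 (/ (1 + kappa * RtoC r))); cbn; nra.
Qed.

(** From [z = (z + z^2) / (1 + z)] and integration by parts in time for the [z^2] part. *)
Lemma time_J_1_damped (kappa : C) (g g' : R -> C) (x t : R) :
  slanted kappa -> hcont g -> hcont g' -> (forall s, (0 < s)%R -> cder g s (g' s)) ->
  (0 < x)%R -> (0 < t)%R ->
  time_J kappa 1 g x t =
    J kappa (fun r => kappa * RtoC r * damping kappa r * time_transform kappa g t r) x t
    + J kappa (fun r => damping kappa r * time_transform kappa g' t r) x t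
    + g 0%R * J kappa (damping kappa) x t + - g t * J kappa (damping kappa) x 0.
Proof.
  intros Hk Hg Hg' Hd Hx Ht.
  assert (Hrate : forall s, (0 <= s)%R -> (0 < rate kappa x s)%R)
    by (intros; apply rate_pos_x; auto; apply Hk).
  destruct (time_transform_poly_growth kappa g t Hk Hg ltac:(lra)) as [W HW].
  destruct (time_transform_poly_growth kappa g' t Hk Hg' ltac:(lra)) as [W' HW'].
  assert (P0 := poly_growth_mul _ _ _ _ _ _ (damping_r_poly_growth kappa (proj1 Hk)) HW).
  assert (P1 := poly_growth_mul _ _ _ _ _ _ (damping_poly_growth kappa (proj1 Hk)) HW').
  assert (P2 := damping_poly_growth kappa (proj1 Hk)).
  destruct (Ek_dominated kappa _ _ _ x t (proj1 Hk) P0 ltac:(lra) ltac:(lra) (Hrate t ltac:(lra))) as [B0 HB0].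
  destruct (Ek_dominated kappa _ _ _ x t (proj1 Hk) P1 ltac:(lra) ltac:(lra) (Hrate t ltac:(lra))) as [B1 HB1].
  destruct (Ek_dominated kappa _ _ _ x t (proj1 Hk) P2 ltac:(lra) ltac:(lra) (Hrate t ltac:(lra))) as [B2 HB2].
  destruct (Ek_dominated kappa _ _ _ x 0 (proj1 Hk) P2 ltac:(lra) ltac:(lra) (Hrate 0%R ltac:(lra))) as [B3 HB3].
  assert (H01 := dominated_plus _ _ _ _ HB0 HB1).
  assert (H2 := dominated_Cmult _ (g 0%R) _ HB2); assert (H3 := dominated_Cmult _ (- g t) _ HB3).
  assert (H012 := dominated_plus _ _ _ _ H01 H2).
  unfold time_J, J.
  rewrite <- (CInt_half_line_Cmult _ (g 0%R) _ HB2), <- (CInt_half_line_Cmult _ (- g t) _ HB3).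
  rewrite <- (CInt_half_line_plus _ _ _ _ HB0 HB1), <- (CInt_half_line_plus _ _ _ _ H01 H2).
  rewrite <- (CInt_half_line_plus _ _ _ _ H012 H3).
  apply (CInt_half_line_ext _ _ _ (dominated_plus _ _ _ _ H012 H3)); intros r Hr.
  rewrite <- (Ek_mul kappa x t r).
  assert (E := time_transform_by_parts kappa g g' t r Hg Hg' Hd ltac:(lra)).
  assert (Hnz := ray_denominator_neq_0 kappa r (proj1 Hk) ltac:(lra)).
  set (z := kappa * RtoC r) in *.
  transitivity (Ek kappa x t r * damping kappa r * (z * time_transform kappa g t r
     + z ^ 2 * time_transform kappa g t r)).
  - unfold damping; fold z; cbn [Cpow]; field; exact Hnz.
  - rewrite E; ring.
Qed.

(** The integral over Gamma in the variable [z = kappa r = - i lambda]: the weights [kp] and [km]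
    come from [dz = kappa dr], the minus sign from the orientation. *)
Definition time_J_gamma (kp km : C) (n : nat) (g : R -> C) (x t : R) : C :=
  kp * time_J kp n g x t + - km * time_J km n g x t.

(** [P' = P], because the integrals of [exp (i lambda x)] over the two rays cancel. *)
Lemma damping_gamma_extends (kp km : C) : slanted kp -> slanted km ->
  extends_to punctured_quadrant
    (fun x _ => kp * J kp (damping kp) x 0 + - km * J km (damping km) x 0).
Proof.
  intros Hp Hm.
  set (P := fun x => kp * J kp (damping kp) x 0 + - km * J km (damping km) x 0).
  (* This rests on [- z / (1 + z) = 1 / (1 + z) - 1] with [z = kappa r]. *)
  assert (HJ : forall kappa x, slanted kappa -> (0 < x)%R ->
    cder (fun x => J kappa (damping kappa) x 0) x
      (J kappa (damping kappa) x 0 + - (1) * J kappa (fun r => (kappa * RtoC r) ^ 0) x 0)).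
  { intros kappa x Hk Hx.
    assert (Hr : (0 < rate kappa x 0)%R) by (apply rate_pos_x; try apply Hk; lra).
    assert (P2 := damping_poly_growth kappa (proj1 Hk)).
    assert (P3 : poly_growth (fun r => - (1) * (kappa * RtoC r) ^ 0) (0 + 0) (1 * 1)).
    { apply (poly_growth_mul (fun _ => - (1)) (fun r => (kappa * RtoC r) ^ 0));
        [|apply poly_growth_pow, Hk].
      split; [apply hcont_const|]; intros; rewrite Cmod_m1; cbn; lra. }
    eapply cder_eq; [apply (cder_J_x kappa _ _ _ _ _ (proj1 Hk) P2); auto; lra|].
    rewrite <- (J_Cmult kappa (- (1)) _ _ _ x 0 (proj1 Hk) (poly_growth_pow kappa 0 (proj1 (proj1 Hk))))
      by (auto; lra).
    rewrite <- (J_plus kappa _ _ _ _ _ _ x 0 (proj1 Hk) P2 P3) by (auto; lra).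
    destruct (Ek_dominated kappa _ _ _ x 0 (proj1 Hk) P2 ltac:(lra) ltac:(lra) Hr) as [B2 HB2].
    destruct (Ek_dominated kappa _ _ _ x 0 (proj1 Hk) P3 ltac:(lra) ltac:(lra) Hr) as [B3 HB3].
    unfold J; rewrite (CInt_half_line_ext _ _ _ (dominated_plus _ _ _ _ HB2 HB3)).
    - f_equal; apply functional_extensionality; intros r; ring.
    - intros r Hr0; unfold damping; change ((kappa * RtoC r) ^ 0) with (RtoC 1).
      field; apply ray_denominator_neq_0; [apply Hk|lra]. }
  assert (HP : forall x, (0 < x)%R -> cder P x (P x)).
  { intros x Hx; destruct (J_pow_0 0 x Hx) as [c Hc].
    unfold P; eapply cder_eq.
    - apply cder_plus; (apply cder_mult; [apply cder_const|apply HJ; assumption]).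
    - cbv beta.
      replace (kp * (J kp (damping kp) x 0 + - (1) * J kp (fun r => (kp * RtoC r) ^ 0) x 0))
        with (kp * J kp (damping kp) x 0 + - (1) * (kp * J kp (fun r => (kp * RtoC r) ^ 0) x 0)) by ring.
      replace (- km * (J km (damping km) x 0 + - (1) * J km (fun r => (km * RtoC r) ^ 0) x 0))
        with (- km * J km (damping km) x 0 + km * J km (fun r => (km * RtoC r) ^ 0) x 0) by ring.
      rewrite (Hc kp Hp), (Hc km Hm); ring. }
  assert (HE : forall x, cder (fun s => Cexp (RtoC s)) x (Cexp (RtoC x))).
  { intros x; eapply cder_eq; [apply cder_Cexp, cder_id|ring]. }
  assert (HE' : forall x, cder (fun s => Cexp (- RtoC s)) x (- Cexp (- RtoC x))).
  { intros x; apply cder_ext_near with (f := fun s => Cexp (- (1) * RtoC s)) (d := 1%R); [lra| |].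
    - intros s _; f_equal; ring.
    - eapply cder_eq; [apply cder_Cexp, cder_mult; [apply cder_const|apply cder_id]|].
      cbv beta; replace (- (1) * RtoC x) with (- RtoC x) by ring; ring. }
  (* So [P] is a multiple of the exponential and extends to x = 0, although each of its two ray
     integrals diverges logarithmically there. *)
  assert (HC : forall x, (0 < x)%R -> P x * Cexp (- RtoC x) = P 1%R * Cexp (- RtoC 1)).
  { intros x Hx.
    assert (Z : (Cmod (P x * Cexp (- RtoC x) - P 1%R * Cexp (- RtoC 1)) <= 2 * 0 * Rabs (x - 1))%R).
    { apply (mean_value_C (fun s => P s * Cexp (- RtoC s)) (fun _ => 0)).
      - intros s Hs; assert (0 < s)%R by (unfold Rmin in Hs; destruct Rle_dec; lra).
        eapply cder_eq; [apply cder_mult; [apply HP; assumption|apply HE']|cbv beta; ring].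
      - intros s _; rewrite Cmod_0; lra. }
    rewrite Rmult_0_r, Rmult_0_l in Z.
    assert (Z0 := Cmod_eq_0 _ (Rle_antisym _ _ Z (Cmod_ge_0 _))).
    replace (P x * Cexp (- RtoC x)) with
      (P x * Cexp (- RtoC x) - P 1%R * Cexp (- RtoC 1) + P 1%R * Cexp (- RtoC 1)) by ring.
    rewrite Z0; ring. }
  apply extends_to_eq with (f := fun x _ => P 1%R * Cexp (- RtoC 1) * Cexp (RtoC x)).
  - intros x t Hx _; fold (P x); rewrite <- (HC x Hx), <- Cmult_assoc, <- Cexp_plus.
    replace (- RtoC x + RtoC x) with (RtoC 0) by ring; rewrite Cexp_0; ring.
  - apply extends_to_Cmult, (extends_to_x _ (fun x => Cexp (RtoC x)) punctured_closed).
    exact (hcont_cder _ _ (fun r _ => HE r)).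
Qed.

(** The recurrence passes from [g] to [g'], so the claim is proved for all [G j] at once. Degree 0
    extends ray by ray. Degree 1 and every recurrence step leave a multiple of [g t] that extends
    only as a difference over Gamma. *)
Lemma time_J_gamma_extends (kp km : C) (G : nat -> R -> C) :
  slanted kp -> slanted km -> (forall n, hcont (G n)) ->
  (forall n s, (0 < s)%R -> cder (G n) s (G (S n) s)) ->
  forall n j, extends_to punctured_quadrant (time_J_gamma kp km n (G j)).
Proof.
  intros Hp Hm Hc Hd.
  assert (Hpow : forall kappa n, slanted kappa ->
    extends_to punctured_quadrant (J kappa (fun r => (kappa * RtoC r) ^ n))).
  { intros kappa n Hk; apply J_extends_slanted with (N := n) (m := 0%nat); [apply Hk|apply Hk|].
    intros d; apply symbol_pow. }
  assert (H0 : forall kappa j, slanted kappa -> extends_to punctured_quadrant (time_J kappa 0 (G j))).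
  { intros kappa j Hk.
    exact (J_time_transform_extends kappa (fun r => (kappa * RtoC r) ^ 0) 1 (G j) (G (S j)) Hk
      (poly_growth_pow kappa 0 (proj1 (proj1 Hk))) (Hc j) (Hc (S j)) (Hd j)). }
  assert (H1 : forall j, extends_to punctured_quadrant (time_J_gamma kp km 1 (G j))).
  { intros j.
    assert (HD : forall kappa, slanted kappa -> extends_to punctured_quadrant (fun x t =>
      J kappa (fun r => kappa * RtoC r * damping kappa r * time_transform kappa (G j) t r) x t
      + J kappa (fun r => damping kappa r * time_transform kappa (G (S j)) t r) x t
      + G j 0%R * J kappa (damping kappa) x t)).
    { intros kappa Hk; apply extends_to_plus; [apply extends_to_plus|apply extends_to_Cmult].
      - apply (J_time_transform_extends kappa (fun r => kappa * RtoC r * damping kappa r) 2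
          (G j) (G (S j))); auto; apply damping_r_poly_growth, Hk.
      - apply (J_time_transform_extends kappa (damping kappa) 2 (G (S j)) (G (S (S j)))); auto.
        apply damping_poly_growth, Hk.
      - apply J_extends_slanted with (N := 0%nat) (m := 1%nat); [apply Hk|apply Hk|].
        intros d; apply damping_symbol, Hk. }
    eapply extends_to_eq; [|apply extends_to_plus; [apply extends_to_plus;
      [exact (extends_to_Cmult _ kp _ (HD kp Hp))|exact (extends_to_Cmult _ (- km) _ (HD km Hm))]|
      apply extends_to_mult; [apply extends_to_Cmult with (c := - (1)),
         (extends_to_t _ (G j) punctured_closed (Hc j))|exact (damping_gamma_extends kp km Hp Hm)]]].
    intros x t Hx Ht; cbv beta; unfold time_J_gamma.
    rewrite (time_J_1_damped kp (G j) (G (S j))), (time_J_1_damped km (G j) (G (S j))) by auto; ring. }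
  assert (HS : forall n, (forall j, extends_to punctured_quadrant (time_J_gamma kp km n (G j))) ->
    forall j, extends_to punctured_quadrant (time_J_gamma kp km (S (S n)) (G j))).
  { intros n IH j.
    eapply extends_to_eq; [|exact (extends_to_plus _ _ _ (IH (S j))
      (extends_to_plus _ _ _ (extends_to_Cmult _ (G j 0%R * kp) _ (Hpow kp n Hp))
        (extends_to_Cmult _ (G j 0%R * - km) _ (Hpow km n Hm))))].
    intros x t Hx Ht; cbv beta; unfold time_J_gamma.
    rewrite (time_J_recurrence kp n (G j) (G (S j))), (time_J_recurrence km n (G j) (G (S j))) by auto.
    destruct (J_pow_0 n x Hx) as [c Hcc].
    transitivity (kp * time_J kp n (G (S j)) x t + - km * time_J km n (G (S j)) x t
      + (G j 0%R * kp * J kp (fun r => (kp * RtoC r) ^ n) x t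
      + G j 0%R * - km * J km (fun r => (km * RtoC r) ^ n) x t)
      + - G j t * (kp * J kp (fun r => (kp * RtoC r) ^ n) x 0)
      + G j t * (km * J km (fun r => (km * RtoC r) ^ n) x 0)); [ring|].
    rewrite (Hcc kp Hp), (Hcc km Hm); ring. }
  (* The recurrence descends by two degrees, so consecutive degrees are carried together. *)
  cut (forall n, (forall j, extends_to punctured_quadrant (time_J_gamma kp km n (G j))) /\
    (forall j, extends_to punctured_quadrant (time_J_gamma kp km (S n) (G j)))); [intros H n; exact (proj1 (H n))|].
  induction n as [|n [IH1 IH2]]; split; [|exact H1|exact IH2|exact (HS n IH1)].
  intros j; unfold time_J_gamma; apply extends_to_plus; apply extends_to_Cmult, H0; assumption.
Qed.

(** The endpoint terms of [cder_time_J_t] cancel between the rays by [J_pow_0]. Over Gamma a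
    [t]-derivative therefore just raises the degree by two, and the whole tower uses [G 0] alone. *)
Lemma time_J_gamma_smoothly_extends (kp km : C) (G : nat -> R -> C) (n : nat) :
  slanted kp -> slanted km -> (forall n, hcont (G n)) ->
  (forall n s, (0 < s)%R -> cder (G n) s (G (S n) s)) ->
  smoothly_extends (time_J_gamma kp km n (G 0%nat)).
Proof.
  intros Hp Hm Hc Hd.
  exists (fun k l x t => (- (1)) ^ k * time_J_gamma kp km (k + (l + (l + n))) (G 0%nat) x t); split; [|split].
  - intros x t Hx Ht; cbn; ring.
  - intros k l x t Hx Ht; split.
    + eapply cder_eq.
      * apply cder_mult; [apply cder_const|].
        apply cder_plus; (apply cder_mult; [apply cder_const|]); apply cder_time_J_x; auto; lra.
      * cbv beta; unfold time_J_gamma; cbn [Cpow plus Nat.add]; ring.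
    + replace (k + (S l + (S l + n)))%nat with (S (S (k + (l + (l + n)))))%nat by lia.
      set (m := (k + (l + (l + n)))%nat); eapply cder_eq.
      * apply cder_mult; [apply cder_const|].
        apply cder_plus; (apply cder_mult; [apply cder_const|]);
          apply (cder_time_J_t _ m (G 0%nat) (G 1%nat)); auto.
      * destruct (J_pow_0 m x Hx) as [c Hcc]; cbv beta; unfold time_J_gamma.
        transitivity ((- (1)) ^ k * (kp * time_J kp (S (S m)) (G 0%nat) x t + - km * time_J km (S (S m)) (G 0%nat) x t
          + G 0%nat t * (kp * J kp (fun r => (kp * RtoC r) ^ m) x 0)
          + - G 0%nat t * (km * J km (fun r => (km * RtoC r) ^ m) x 0))); [ring|].
        rewrite (Hcc kp Hp), (Hcc km Hm); ring.
  - intros k l; apply extends_to_Cmult, time_J_gamma_extends; assumption.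
Qed.

(** ** The contour integrals *)

Lemma CInt_line_split (f g h : R -> C) (A B : R) :
  dominated g A -> dominated h B ->
  (forall r, (0 < r)%R -> f r = g r) -> (forall r, (0 < r)%R -> f (- r)%R = h r) ->
  CInt_line f = CInt_half_line h + CInt_half_line g.
Proof.
  intros Hg Hh Eg Eh; unfold CInt_line.
  apply (is_RInt_gen_unique (V := C_R_CompleteNormedModule) (Fa := Rbar_locally m_infty)
    (Fb := Rbar_locally p_infty) f (CInt_half_line h + CInt_half_line g)).
  apply (is_RInt_gen_Chasles (V := C_R_NormedModule) f 0%R (CInt_half_line h) (CInt_half_line g)).
  2:{ exact (hint_is_RInt_gen f g _ (dominated_hint g A Hg) Eg). }
  destruct (dominated_hint h B Hh) as [Hc Hl].
  intros P HP; specialize (Hl P HP); destruct Hl as [K HK].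
  econstructor 1 with (Q := fun a => (a < 0 /\ a < - K)%R) (R := fun b => b = 0%R).
  - exists (Rmin 0 (- K)); intros x Hx; pose proof (Rmin_l 0 (- K)); pose proof (Rmin_r 0 (- K)); lra.
  - reflexivity.
  - intros a b [Ha HaK] ->; exists (CInt h 0 (- a)); split; [|apply HK; lra].
    assert (H := RInt_correct (V := C_R_CompleteNormedModule) h 0 (- a)
      (hcont_ex_RInt h 0 (- a) Hc ltac:(lra) ltac:(lra))).
    rewrite <- Ropp_0 in H at 1.
    apply (is_RInt_comp_opp (V := C_R_NormedModule)) in H.
    apply (is_RInt_opp (V := C_R_NormedModule)) in H.
    apply (is_RInt_swap (V := C_R_NormedModule)) in H.
    cbn [fst snd].
    replace (CInt h 0 (- a)) with (opp (opp (CInt h 0 (- a) : C_R_NormedModule)))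
      by apply opp_opp.
    eapply is_RInt_ext; [|exact H].
    intros x Hx; rewrite Rmax_right in Hx by lra; cbv beta; rewrite opp_opp.
    rewrite <- Eh by lra; f_equal; lra.
Qed.

Lemma heat_exp_Ek (omega kappa : C) (x t r : R) :
  kappa = - (Ci * omega) -> heat_exp x t (RtoC r * omega) = Ek kappa x t r.
Proof.
  intros ->; unfold heat_exp, Ek; f_equal; apply C_eq; unfold Re, Im; cbn; ring.
Qed.

Lemma u0_hat_transform (u0 v : R -> C) (omega mu : C) (r : R) :
  ray mu -> mu = Ci * omega -> rapid_decay v -> (forall y, (0 < y)%R -> v y = u0 y) -> (0 <= r)%R ->
  u0_hat u0 (RtoC r * omega) = J mu v r 0.
Proof.
  intros Hm E Hv Ev Hr; destruct (rapid_decay_dominated mu v Hm Hv) as [B HB].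
  unfold u0_hat, J; apply CInt_half_line_ext with (1 := HB r Hr).
  intros y Hy; rewrite Ev by assumption.
  replace (Ek mu r 0 y) with (Cexp (- (Ci * (RtoC r * omega) * RtoC y))); [ring|].
  subst mu; unfold Ek; f_equal; apply C_eq; unfold Re, Im; cbn; ring.
Qed.

Lemma g0_tilde_time_transform (g0 g : R -> C) (omega kappa : C) (t r : R) :
  kappa = - (Ci * omega) -> (forall s, (0 < s)%R -> g s = g0 s) -> (0 <= t)%R ->
  g0_tilde g0 (RtoC r * omega) t = time_transform kappa g t r.
Proof.
  intros E Eg Ht; apply (RInt_ext (V := C_R_CompleteNormedModule)); intros s Hs.
  rewrite Rmin_left in Hs by lra; rewrite Eg by lra.
  f_equal; subst kappa; unfold Ek; f_equal; apply C_eq; unfold Re, Im; cbn; ring.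
Qed.

Lemma ray_Ci : ray Ci /\ Re (Ci * Ci) = (-1)%R.
Proof.
  split; [repeat split; [apply Cmod_Ci|cbn; lra|cbn; lra]|cbn; ring].
Qed.

Lemma ray_opp_Ci : ray (- Ci) /\ Re (- Ci * - Ci) = (-1)%R.
Proof.
  split; [repeat split; [rewrite Cmod_opp; apply Cmod_Ci|cbn; lra|cbn; lra]|cbn; ring].
Qed.

(** Here [kappa = sin theta - i cos theta], so Re kappa is [sin theta] and Re (kappa^2) is
    [sin^2 theta - cos^2 theta]. *)
Lemma slanted_of_angle (theta : R) :
  (0 < sin theta)%R -> (cos theta ^ 2 = sin theta ^ 2)%R ->
  slanted (- (Ci * Cexp (Ci * RtoC theta))).
Proof.
  intros Hs Hc.
  assert (E : Cexp (Ci * RtoC theta) = (cos theta, sin theta)).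
  { unfold Cexp; cbn.
    replace (0 * theta - 1 * 0)%R with 0%R by ring; replace (0 * 0 + 1 * theta)%R with theta by ring.
    rewrite exp_0; f_equal; ring. }
  assert (Hm : Cmod (- (Ci * Cexp (Ci * RtoC theta))) = 1%R).
  { rewrite Cmod_opp, Cmod_mult, Cmod_Ci, Cmod_Cexp.
    replace (Re (Ci * RtoC theta)) with 0%R by (cbn; ring); rewrite exp_0; ring. }
  assert (H1 : Re (- (Ci * Cexp (Ci * RtoC theta))) = sin theta) by (rewrite E; cbn; ring).
  assert (H2 : Re (- (Ci * Cexp (Ci * RtoC theta)) * - (Ci * Cexp (Ci * RtoC theta))) = 0%R).
  { rewrite E; cbn. transitivity (sin theta ^ 2 - cos theta ^ 2)%R; [ring|lra]. }
  split; [split; [assumption|split; lra]|split; lra].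
Qed.

Lemma slanted_PI4 : slanted (- (Ci * Cexp (Ci * RtoC (PI / 4)))).
Proof.
  apply slanted_of_angle.
  - apply sin_gt_0; pose proof PI_RGT_0; lra.
  - rewrite sin_PI4, cos_PI4; reflexivity.
Qed.

Lemma slanted_3PI4 : slanted (- (Ci * Cexp (Ci * RtoC (3 * PI / 4)))).
Proof.
  apply slanted_of_angle.
  - apply sin_gt_0; pose proof PI_RGT_0; lra.
  - replace (3 * PI / 4)%R with (PI - PI / 4)%R by field.
    rewrite sin_minus, cos_minus, sin_PI, cos_PI, sin_PI4, cos_PI4; ring.
Qed.

Theorem theorem1p2 (u0 g0 : R -> C) (u : R -> R -> C)
  (hu0 : schwartz_half_line u0)
  (hg0 : smooth_half_line g0)
  (hu : forall x t : R, (0 < x)%R -> (0 < t)%R ->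
          u x t = fokas_formula u0 g0 x t) :
  smooth_extension_punctured_quadrant u.
Proof.
  destruct hu0 as (F & HF & HFB), hg0 as (G & HG0 & HGd & HGl).
  assert (HS := schwartz_half_line_tower u0 F HF HFB).
  assert (HFr : rapid_decay (F 0%nat)) by exact (schwartz_rapid_decay 0 0 _ (HS 0%nat 0%nat)).
  destruct HF as (HF0 & _ & _).
  assert (HGc : forall n, hcont (G n))
    by (intros n; apply hcont_of_right_limit with (f' := G (S n)); [apply HGd|apply HGl]).
  destruct ray_Ci as [Ri Ri2], ray_opp_Ci as [Ro Ro2].
  set (op := Cexp (Ci * RtoC (PI / 4))); set (om := Cexp (Ci * RtoC (3 * PI / 4))).
  set (kp := - (Ci * op)); set (km := - (Ci * om)).
  assert (Sp : slanted kp) by exact slanted_PI4.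
  assert (Sm : slanted km) by exact slanted_3PI4.
  (* [F 0] replaces [u0], whose value at 0 is arbitrary. It need not vanish at 0, so its transform
     has order -1 and no better. *)
  set (hat := fun mu r => J mu (F 0%nat) r 0).
  assert (Hhat : forall mu, ray mu -> forall d, symbol d 0 1 (hat mu))
    by (intros mu Hm d; exact (transform_symbol mu d 0 (F 0%nat) Hm (HS _ _))).
  assert (Hdom : forall kappa mu x t, ray kappa -> ray mu -> (0 <= x)%R -> (0 <= t)%R ->
    (0 < rate kappa x t)%R -> exists B, dominated (fun r => Ek kappa x t r * hat mu r) B).
  { intros kappa mu x t Hk Hm Hx Ht Hr.
    destruct (symbol_poly_growth _ _ _ _ (Hhat mu Hm 0%nat)) as [A HA].
    eapply Ek_dominated; eauto. }
  apply smoothly_extends_extension.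
  apply smoothly_extends_eq with (u := fun x t =>
    / RtoC (2 * PI) * (J Ci (hat (- Ci)) x t + J (- Ci) (hat Ci) x t)
    + - / RtoC (2 * PI) * (op * J kp (hat kp) x t + - om * J km (hat km) x t)
    + Ci / RtoC PI * time_J_gamma kp km 1 (G 0%nat) x t).
  - intros x t Hx Ht; rewrite hu by assumption; unfold fokas_formula.
    assert (Hline : CInt_line (fun l => heat_exp x t (RtoC l) * u0_hat u0 (RtoC l)) =
      J Ci (hat (- Ci)) x t + J (- Ci) (hat Ci) x t).
    { destruct (Hdom Ci (- Ci) x t) as [A HA]; auto; try lra; [apply rate_pos_t; auto; lra|].
      destruct (Hdom (- Ci) Ci x t) as [B HB]; auto; try lra; [apply rate_pos_t; auto; lra|].
      apply (CInt_line_split _ _ _ _ _ HB HA); intros r Hr.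
      - replace (RtoC r) with (RtoC r * 1) by ring.
        rewrite (heat_exp_Ek 1 (- Ci)) by ring.
        rewrite (u0_hat_transform u0 (F 0%nat) 1 Ci) by (auto; try ring; lra); reflexivity.
      - replace (RtoC (- r)) with (RtoC r * - (1)) by (rewrite RtoC_opp; ring).
        rewrite (heat_exp_Ek (- (1)) Ci) by ring.
        rewrite (u0_hat_transform u0 (F 0%nat) (- (1)) (- Ci)) by (auto; try ring; lra); reflexivity. }
    assert (Hray : forall theta omega kappa, omega = Cexp (Ci * RtoC theta) -> kappa = - (Ci * omega) ->
      slanted kappa -> CInt_ray theta (fun l => heat_exp x t l * u0_hat u0 (- l)) =
        omega * J kappa (hat kappa) x t /\
      CInt_ray theta (fun l => heat_exp x t l * l * g0_tilde g0 l t) = - kappa * time_J kappa 1 (G 0%nat) x t).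
    { intros theta omega kappa Eo Ek0 Sk; unfold CInt_ray; rewrite <- Eo.
      assert (Hr := rate_pos_x kappa x t (proj1 Sk) (proj1 (proj2 Sk)) Hx (Rlt_le _ _ Ht)).
      destruct (Hdom kappa kappa x t) as [A HA]; try apply Sk; auto; try lra.
      destruct (time_J_amplitude kappa 1 (G 0%nat) t Sk (HGc 0%nat) ltac:(lra)) as [W HW].
      destruct (Ek_dominated kappa _ _ _ x t (proj1 Sk) HW ltac:(lra) ltac:(lra) Hr) as [B HB].
      split; unfold time_J, J.
      - rewrite <- (CInt_half_line_Cmult _ omega _ HA).
        apply CInt_half_line_ext with (1 := dominated_Cmult _ omega _ HA); intros r Hr0.
        rewrite (heat_exp_Ek omega kappa) by assumption.
        replace (- (RtoC r * omega)) with (RtoC r * - omega) by ring.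
        (* On Gamma the transform is evaluated at [- lambda], which lies in the lower half-plane;
           its parameter [Ci * - omega] is [kappa] itself. *)
        rewrite (u0_hat_transform u0 (F 0%nat) (- omega) kappa); try apply Sk; auto; try lra.
        + unfold hat; ring.
        + rewrite Ek0; ring.
      (* Since [lambda = i kappa r], [lambda dlambda] is [- kappa (kappa r) dr]: one factor
         [kappa r] makes the degree 1, and the sign turns the coefficient [- Ci / PI] into
         [Ci / PI]. *)
      - rewrite <- (CInt_half_line_Cmult _ (- kappa) _ HB).
        apply CInt_half_line_ext with (1 := dominated_Cmult _ (- kappa) _ HB); intros r Hr0.
        rewrite (heat_exp_Ek omega kappa) by assumption.
        rewrite (g0_tilde_time_transform g0 (G 0%nat) omega kappa) by (auto; lra).
        assert (Eo2 : omega = Ci * kappa).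
        { rewrite Ek0; replace (Ci * - (Ci * omega)) with (- (Ci * Ci) * omega) by ring.
          replace (Ci * Ci) with (- (1)) by (apply C_eq; cbn; ring); ring. }
        rewrite Eo2; cbn [Cpow].
        replace (Ek kappa x t r * (RtoC r * (Ci * kappa)) * time_transform kappa (G 0%nat) t r * (Ci * kappa))
          with ((Ci * Ci) * kappa * (Ek kappa x t r * (kappa * RtoC r * time_transform kappa (G 0%nat) t r)))
          by ring.
        replace (Ci * Ci) with (- (1)) by (apply C_eq; cbn; ring); ring. }
    destruct (Hray (PI / 4)%R op kp eq_refl eq_refl Sp) as [P1 P2].
    destruct (Hray (3 * PI / 4)%R om km eq_refl eq_refl Sm) as [Q1 Q2].
    unfold CInt_Gamma; rewrite Hline, P1, P2, Q1, Q2; unfold time_J_gamma; ring.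
  - apply smoothly_extends_plus; [apply smoothly_extends_plus|]; apply smoothly_extends_Cmult.
    + apply smoothly_extends_plus; apply J_smoothly_extends with (N := 0%nat) (m := 1%nat); auto.
    + apply smoothly_extends_plus; apply smoothly_extends_Cmult;
        apply J_smoothly_extends with (N := 0%nat) (m := 1%nat);
        try (apply Sp || apply Sm); try (left; apply Sp || apply Sm); apply Hhat; apply Sp || apply Sm.
    + apply time_J_gamma_smoothly_extends; assumption.
Qed.
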